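(* Let $1<p<2$ and let $d,n\ge 1$ be integers. (i) There is a constant $C$ depending only on $p,d,n$ such that for every $n\times n$ matrix weight $W$ on $\mathbb{R}^d$ with $W\in A_p$ and every $f\in L^p(\mathbb{R}^d;\mathbb{C}^n)$, $$\|M_{W,p}f\|_{L^{p,\infty}}\le C\,[W]_{A_p}^{\frac{2}{p}}\,\|f\|_{L^p}.$$ (ii) This bound is sharp in the following sense: in the scalar setting ($n=1$), there is a constant $c>0$ depending only on $p,d$ such that $$\varphi_{M_p}(t)\ge c\,t^{\frac{2}{p}}\qquad\text{for all } t\ge 1,$$ where $\varphi_{M_p}(t):=\sup_{[w]_{A_p}\le t}\|M_{w,p}\|_{L^p\to L^{p,\infty}}$.
   Context: A matrix weight $W$ on $\mathbb{R}^d$ is an $n\times n$ self-adjoint matrix function with locally integrable entries such that $W(x)$ is positive definite for a.e. $x\in\mathbb{R}^d$. $\|\cdot\|$ denotes the operator norm of a matrix, $|\cdot|$ the Euclidean norm on $\mathbb{C}^n$ (or Lebesgue measure of a set), and $p'=p/(p-1)$. For $p>1$, $W\in A_p$ means $$[W]_{A_p}:=\sup_{Q}\frac{1}{|Q|}\int_Q\Big(\frac{1}{|Q|}\int_Q\|W(x)^{1/p}W(y)^{-1/p}\|^{p'}dy\Big)^{p/p'}dx<\infty,$$ the supremum being over all cubes $Q\subset\mathbb{R}^d$. For $n=1$ (a scalar weight $w$, i.e. a non-negative locally integrable function) this is the usual constant $$[w]_{A_p}=\sup_{Q}\Big(\frac{1}{|Q|}\int_Qw\Big)\Big(\frac{1}{|Q|}\int_Qw^{-\frac{1}{p-1}}\Big)^{p-1}.$$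 The Christ--Goldberg maximal operator is $$M_{W,p}f(x):=\sup_{Q\ni x}\frac{1}{|Q|}\int_Q|W^{1/p}(x)W^{-1/p}(y)f(y)|\,dy,$$ the supremum being over all cubes $Q$ containing $x$; in the scalar case $M_{w,p}f=w^{1/p}M(fw^{-1/p})$, where $M$ is the Hardy--Littlewood maximal operator. The weak norm (unweighted, with respect to Lebesgue measure) is $\|g\|_{L^{p,\infty}}=\sup_{\alpha>0}\alpha\,|\{x:|g(x)|>\alpha\}|^{1/p}$, and $\|M_{w,p}\|_{L^p\to L^{p,\infty}}$ is the smallest constant $K$ with $\|M_{w,p}f\|_{L^{p,\infty}}\le K\|f\|_{L^p}$ for all $f\in L^p(\mathbb{R}^d)$. In $\varphi_{M_p}$ the supremum is over all scalar weights $w$ with $[w]_{A_p}\le t$. *)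

(* Defs.v *)
From HB Require Import structures.
From mathcomp Require Import all_boot all_order all_algebra.
From mathcomp Require Import all_classical all_reals all_analysis.
From mathcomp Require Import complex.

Set Implicit Arguments.
Unset Strict Implicit.
Unset Printing Implicit Defensive.
Import Order.TTheory GRing.Theory Num.Theory.
Import numFieldNormedType.Exports.

Local Open Scope classical_set_scope.
Local Open Scope ring_scope.
Local Open Scope complex_scope.
Local Open Scope sesquilinear_scope.

Section LebesgueMeasure.
Context (R : realType) (d : nat).
Local Open Scope ereal_scope.

Definition box (a b : 'rV[R]_d) : set 'rV[R]_d :=
  [set x | forall i, (a 0 i <= x 0 i <= b 0 i)%R].

Definition box_vol (a b : 'rV[R]_d) : R :=
  (\prod_i Num.max 0 (b 0 i - a 0 i))%R.

Lemma box_vol_ge0 a b : 0 <= (box_vol a b)%:E.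
Proof. by rewrite lee_fin; apply: prodr_ge0 => i _; rewrite le_max lexx. Qed.

(* The index set [D] makes the covers at most countable; allowing [D] to be
   empty gives the empty set measure 0 also when [d = 0]. *)
Definition box_cover (A : set 'rV[R]_d) (D : set nat)
    (F : nat -> 'rV[R]_d * 'rV[R]_d) : Prop :=
  A `<=` \bigcup_(k in D) box (F k).1 (F k).2.

Definition lebesgue_outer (A : set 'rV[R]_d) : \bar R :=
  ereal_inf [set s | exists D F,
    box_cover A D F /\ s = \esum_(k in D) (box_vol (F k).1 (F k).2)%:E].

Lemma lebesgue_outer_ge0 A : 0 <= lebesgue_outer A.
Proof.
apply: le_ereal_inf_tmp => _ [D [F [_ ->]]].
by apply: esum_ge0 => k _; exact: box_vol_ge0.
Qed.

Lemma lebesgue_outer0 : lebesgue_outer set0 = 0.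
Proof.
apply/eqP; rewrite eq_le lebesgue_outer_ge0 andbT.
apply: ereal_inf_lbound; exists set0, (fun=> (0%R, 0%R)); split.
  by move=> x.
by rewrite esum_set0.
Qed.

Lemma le_lebesgue_outer :
  {homo lebesgue_outer : A B / A `<=` B >-> A <= B}.
Proof.
move=> A B AB; apply: ereal_inf_le_tmp => _ [D [F [cF ->]]].
by exists D, F; split => //; exact: subset_trans cF.
Qed.

Lemma lebesgue_outer_sigma_subadditive : sigma_subadditive lebesgue_outer.
Proof.
move=> A; have [[i ioo]|] := pselect (exists i, lebesgue_outer (A i) = +oo).
  rewrite (eseries_pinfty _ _ ioo) ?leey// => n _.
  by rewrite -ltNye (lt_le_trans _ (lebesgue_outer_ge0 _)).
rewrite -forallNE => Aoo.
suff add2e (e : {posnum R}) : lebesgue_outer (\bigcup_n A n) <=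
    \sum_(i <oo) lebesgue_outer (A i) + e%:num%:E.
  by apply/lee_addgt0Pr => _/posnumP[].
rewrite (le_trans _ (epsilon_trick _ _ _))//; last first.
  by move=> n; exact: lebesgue_outer_ge0.
pose v (B : 'rV[R]_d * 'rV[R]_d) := (box_vol B.1 B.2)%:E.
have v0 B : 0 <= v B by exact: box_vol_ge0.
pose P n (G : set nat * (nat -> 'rV[R]_d * 'rV[R]_d)) :=
  box_cover (A n) G.1 G.2 /\
  \esum_(k in G.1) v (G.2 k) <=
    lebesgue_outer (A n) + (e%:num / (2 ^ n.+1)%:R)%:E.
have [G PG] : {G : nat -> _ & forall n, P n (G n)}.
  apply: (@choice _ _ P) => n; rewrite /P.
  have fin : lebesgue_outer (A n) \is a fin_num.
    by rewrite ge0_fin_numE ?lebesgue_outer_ge0// ltey; exact/eqP.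
  have en1 : (0 < e%:num / (2 ^ n.+1)%:R)%R by [].
  have [_ [D [F [cF ->]]] xS] := lb_ereal_inf_adherent en1 fin.
  by exists (D, F); split => //; exact/ltW.
have /card_esym/ppcard_eqP[f] := card_nat2.
pose D2 := [set ij : nat * nat | (G ij.1).1 ij.2].
pose w (ij : nat * nat) := v ((G ij.1).2 ij.2).
have w0 ij : 0 <= w ij by exact: v0.
apply: (@le_trans _ _ (\esum_(ij in D2) w ij)).
  apply: ereal_inf_lbound.
  exists (f @^-1` D2), (fun k => (G (f k).1).2 (f k).2); split.
    move=> t [i _ /(PG i).1 [j Dj tj]].
    exists (f^-1%FUN (i, j)); first by rewrite /= /D2/= invK ?inE.
    by rewrite invK ?inE.
  rewrite (reindex_esum (f @^-1` D2) D2 f)//.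
  split => //.
  - by move=> x y _ _; apply: inj; rewrite inE.
  - move=> ij Dij; exists (f^-1%FUN ij); last by rewrite invK ?inE.
    by rewrite /= invK ?inE.
rewrite (_ : D2 = [set: nat] `*`` (fun i => (G i).1)); last first.
  by apply/seteqP; split => // -[i j] // [].
rewrite -(@esum_esum _ _ _ _ _ (fun i j => v ((G i).2 j)))//.
rewrite nneseries_esumT//; last first.
  by move=> n; rewrite adde_ge0 ?lebesgue_outer_ge0// lee_fin.
by apply: le_esum => n _; exact: (PG n).2.
Qed.

HB.instance Definition _ := isOuterMeasure.Build R _ lebesgue_outer
  lebesgue_outer0 lebesgue_outer_ge0 le_lebesgue_outer
  lebesgue_outer_sigma_subadditive.

Definition Rd : measurableType _ := caratheodory_type lebesgue_outer.

Definition leb : set Rd -> \bar R := lebesgue_outer.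

HB.instance Definition _ := isMeasure.Build _ Rd R leb
  (@caratheodory_measure0 R _ lebesgue_outer)
  (@caratheodory_measure_ge0 R _ lebesgue_outer)
  (@caratheodory_measure_sigma_additive _ _ lebesgue_outer).

End LebesgueMeasure.

Section Cubes.
Context (R : realType) (d : nat).
Implicit Types (Q : set (Rd R d)) (g : Rd R d -> \bar R).
Local Open Scope ereal_scope.

(* Cubes are taken closed, with sides parallel to the axes. *)
Definition is_cube Q : Prop := exists (a : 'rV[R]_d) (l : R),
  (0 < l)%R /\ Q = box a (a + const_mx l)%R.

Definition average Q g : \bar R :=
  (fine (@leb R d Q))^-1%:E * \int[@leb R d]_(x in Q) g x.

Definition HL_max g (x : Rd R d) : \bar R :=
  ereal_sup [set average Q (abse \o g) | Q in [set Q | is_cube Q /\ Q x]].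

Definition weak_Lnorm (p : R) g : \bar R :=
  ereal_sup [set a%:E * @leb R d [set x | a%:E < `|g x|] `^ p^-1 |
             a in [set a : R | (0 < a)%R]].

Definition locally_integrable_Rd (g : Rd R d -> R) : Prop :=
  forall K : set 'rV[R]_d, compact K -> (@leb R d).-integrable K (EFin \o g).

Definition locally_integrable_C (g : Rd R d -> R[i]) : Prop :=
  locally_integrable_Rd (fun x => complex.Re (g x)) /\
  locally_integrable_Rd (fun x => complex.Im (g x)).

Definition measurable_C (g : Rd R d -> R[i]) : Prop :=
  measurable_fun [set: Rd R d] (fun x => complex.Re (g x)) /\
  measurable_fun [set: Rd R d] (fun x => complex.Im (g x)).

End Cubes.

Section Matrices.
Context (R : realType) (n : nat).
Implicit Types (A : 'M[R[i]]_n) (v : 'cV[R[i]]_n).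

Definition vnorm v : R := Num.sqrt (\sum_i ComplexField.Normc.normc (v i 0) ^+ 2).

Definition opnorm A : R := sup [set vnorm (A *m v) | v in [set v | vnorm v <= 1]].

Definition posdefmx A : Prop :=
  A \is hermsymmx /\ forall v, v != 0 -> 0 < (v^t* *m A *m v) 0 0.

(* A = U^-1 diag(lambda) U with U unitary gives A^s = U^-1 diag(lambda^s) U. *)
Definition mxpow A (s : R) : 'M[R[i]]_n :=
  invmx (spectralmx A) *m
  diag_mx (map_mx (fun z => (complex.Re z `^ s)%:C) (spectral_diag A)) *m
  spectralmx A.

End Matrices.

Section MatrixWeights.
Context (R : realType) (d n : nat) (p : R).
Implicit Types (W : Rd R d -> 'M[R[i]]_n) (f : Rd R d -> 'cV[R[i]]_n).
Local Open Scope ereal_scope.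

Definition matrix_weight W : Prop :=
  [/\ forall x, W x \is hermsymmx,
      forall i j, locally_integrable_C (fun x => W x i j) &
      {ae @leb R d, forall x, posdefmx (W x)}].

Definition Ap_matrix W : \bar R :=
  let p' := (p / (p - 1))%R in
  ereal_sup [set
    average Q (fun x =>
      average Q (fun y =>
        ((opnorm (mxpow (W x) p^-1 *m mxpow (W y) (- p^-1))) `^ p')%:E)
      `^ (p / p'))
    | Q in @is_cube R d].

Definition christ_goldberg_max W f (x : Rd R d) : \bar R :=
  ereal_sup [set
    average Q (fun y =>
      (vnorm (mxpow (W x) p^-1 *m mxpow (W y) (- p^-1) *m f y))%:E)
    | Q in [set Q | is_cube Q /\ Q x]].

Definition Lp_norm_vec f : \bar R :=
  Lnorm (@leb R d) p%:E (fun x => (vnorm (f x))%:E).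

Definition in_Lp_vec f : Prop :=
  (forall i, measurable_C (fun x => f x i 0%R)) /\ Lp_norm_vec f < +oo.

End MatrixWeights.

Section ScalarWeights.
Context (R : realType) (d : nat) (p : R).
Implicit Types (w : Rd R d -> R) (f : Rd R d -> R[i]).
Local Open Scope ereal_scope.

Definition scalar_weight w : Prop :=
  (forall x, (0 <= w x)%R) /\ locally_integrable_Rd w.

(* The library's [powR] has [0 `^ s = 0] for [s < 0]; here the value is [+oo]. *)
Definition epow (a s : R) : \bar R :=
  if (a == 0%R) && (s < 0)%R then +oo else (a `^ s)%:E.

Definition Ap_scalar w : \bar R :=
  ereal_sup [set
    average Q (EFin \o w) *
    average Q (fun x => epow (w x) (- (p - 1)^-1)) `^ (p - 1)
    | Q in @is_cube R d].

Definition scalar_max w f (x : Rd R d) : \bar R :=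
  epow (w x) p^-1 *
  HL_max (fun y => (ComplexField.Normc.normc (f y))%:E * epow (w y) (- p^-1)) x.

Definition Lp_norm f : \bar R :=
  Lnorm (@leb R d) p%:E (fun x => (ComplexField.Normc.normc (f x))%:E).

Definition in_Lp f : Prop := measurable_C f /\ Lp_norm f < +oo.

(* [+oo] when no finite constant is admissible. *)
Definition scalar_max_norm w : \bar R :=
  ereal_inf [set K%:E | K in [set K : R | (0 <= K)%R /\
    forall f, in_Lp f -> weak_Lnorm p (scalar_max w f) <= K%:E * Lp_norm f]].

Definition phi_M (t : R) : \bar R :=
  ereal_sup [set scalar_max_norm w | w in
    [set w | scalar_weight w /\ Ap_scalar w <= t%:E]].

End ScalarWeights.

(* Main.v *)
Require Import Defs.
From mathcomp Require Import all_boot all_order all_algebra.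
From mathcomp Require Import all_classical all_reals all_analysis.
From mathcomp Require Import complex measurable_realfun perm ring lra.

Set Implicit Arguments.
Unset Strict Implicit.
Unset Printing Implicit Defensive.
Import Order.TTheory GRing.Theory Num.Theory.
Import numFieldNormedType.Exports.

Local Open Scope classical_set_scope.
Local Open Scope ring_scope.

(** Let [W] be a matrix weight, [A = W^(1/p)], [B = W^(-1/p)].

Upper bound. Put [nu_x(z) = |A(x) z|], with the l1 norm in real coordinates, and
[u = B f], so that [nu_y(u(y))] is comparable to [|f(y)|], and the maximal function
at [x] to the supremum of the averages of [nu_x(u)]. The weight enters only through
one inequality, a consequence of the A_p condition by Hoelder's inequality
([averaging_from_Ap]): for every cube [Q] and every [g],
  [int_Q (int_Q nu_x(g(y)) dy)^p dx <= K |Q|^p int_Q nu_y(g(y))^p dy]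
with [K] a multiple of [Ap_matrix p W]. Testing it on constant vectors restricted
to subsets shows that each scalar weight [nu_x(z)^p] is A-infinity with constant
of order [K]; testing it on [u], multiplied by signs, controls averages of
coordinates of [u].

By the one-third trick it suffices to treat the cells of finitely many dyadic grids.
Each cell [P] gets a basis which is nearly orthonormal for the norm
[rho(z) = (average over P of nu_x(z)^p)^(1/p)] ([almost_auerbach]). Then
[average of nu_x(u) <= (largest nu_x of a basis vector) * (average of the coordinates
of u)], and the second factor is at most a constant times
[(K * average of nu(u)^p)^(1/p)] ([near_basis_average]). Passing from cells to
principal cells, along which the averages of the coordinates double, reduces the
level set to a union, over principal cells [P], of the parts of [P] where some
basis vector [e] has [nu_x(e)^p] larger than [al^p / (K * average of nu(u)^p)], up to
constants. Sort the principal cells by this ratio into classes [2 a^n]. By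
Chebyshev's inequality alone the [n]-th class would contribute an amount bounded
uniformly in [n]; the A-infinity property improves this by a factor
[(1 - 1/kap)^n] with [kap] of order [K] ([Ainf_distribution]). The cells of one
class have total measure at most twice that of their union ([sparse_measure_le]),
which the weak-type inequality for [nu(u)^p] bounds by [K a^n / al^p] times the
integral. The geometric series sums to a second factor [kap], hence [K^2 / al^p],
and the [p]-th root gives the exponent [2/p].

Many functions here are not known to be measurable (operator norms of products of
matrix powers, the maximal function itself). Their integrals are lower integrals,
and only monotonicity, modulo null sets, and scaling are used; level sets are enclosed in
measurable sets.

Lower bound. The weight depends on one coordinate [t]. It is 1 for [|t| <= 1] and
[(m min(|t|, 8^m))^(p-1)] beyond; for each of the [m] scales [s_j = 8^j] a bump centred
at [3 s_j] is added, of height [m s_j^p] on an interval of length 2 and decaying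
like [s_j^p] over the distance up to the distance [s_j]. Near the origin the weight
has average of order [m s^(p-1)] at scale [s] while the dual weight has average of
order [1/s], because the [m] scales contribute [1/m] each; around a bump the
average is at most of order [m] times the minimum. So the A_p constant is of order
[m] ([weight_Ap]); the condition [p < 2] is used through [m^(p-1) <= m]. For the
indicator of the slab [|t| <= 1/2] (cut to a large box) the averages over cubes
reaching the [j]-th bump are at least [1/(4 s_j)], so the maximal function is at
least [m^(1/p)/4] on each of the [m] bumps, and the norm is at least of order
[m^(2/p)] ([weight_norm_ge]). *)

(** * Stopping times for nested partitions *)

Section DyadicStructure.
Context (dsp : measure_display) (T : measurableType dsp) (R : realType).
Context (mu : {measure set T -> \bar R}).
Context (J : countType) (idx : nat -> T -> J) (D : R).
Local Open Scope ereal_scope.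

Definition cell k x : set T := [set y | idx k y = idx k x].

(** Cells are fibres of [idx k], of comparable measure between consecutive
levels. The last field, outer regularity by unions of arbitrarily small cells, is
the only trace of topology: it stands in for the differentiation theorem. *)
Record dyadic : Prop := {
  dy_meas : forall k x, measurable (cell k x);
  dy_nest : forall k x y, idx k.+1 x = idx k.+1 y -> idx k x = idx k y;
  dy_pos : forall k x, 0 < mu (cell k x);
  dy_fin : forall k x, mu (cell k x) < +oo;
  dy_dbl : forall k x, mu (cell k x) <= D%:E * mu (cell k.+1 x);
  dy_reg : forall E m (e : R), measurable E -> mu E < +oo -> (0 < e)%R ->
    exists U, [/\ measurable U, E `<=` U, mu U <= mu E + e%:E &
      forall x, U x -> exists2 k, (m <= k)%N & cell k x `<=` U] }.

Hypothesis dy : dyadic.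

Lemma idx_le l k x y : (l <= k)%N -> idx k x = idx k y -> idx l x = idx l y.
Proof.
move=> lk; rewrite -(subnKC lk); elim: (k - l)%N => [|i IH]; first by rewrite addn0.
by rewrite addnS => /(dy_nest dy)/IH.
Qed.

Lemma cell_refl k x : cell k x x. Proof. by []. Qed.

Lemma cell_eq k x y : idx k x = idx k y -> cell k x = cell k y.
Proof. by rewrite /cell => ->. Qed.

Lemma cell_le l k x : (l <= k)%N -> cell k x `<=` cell l x.
Proof. by move=> lk y; exact: idx_le. Qed.

Lemma cell_fin k x : mu (cell k x) \is a fin_num.
Proof. by rewrite ge0_fin_numE ?measure_ge0// (dy_fin dy). Qed.

Definition cell_pred (S : nat -> T -> Prop) :=
  forall k x y, idx k x = idx k y -> S k x -> S k y.

Definition first_stop (S : nat -> T -> Prop) k x :=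
  S k x /\ forall l, (l < k)%N -> ~ S l x.

Definition stopped (S : nat -> T -> Prop) : set T := [set x | exists k, S k x].

(** The maximal stopping cells as a sequence: the number of a cell is the code
of its level and its index. *)
Definition stop_cell (S : nat -> T -> Prop) (n : nat) : set T :=
  [set x | exists k, n = pickle (k, idx k x) /\ first_stop S k x].

Lemma first_stop_pred S : cell_pred S -> cell_pred (first_stop S).
Proof.
move=> cS k x y e [Sk nS]; split; first exact: cS e Sk.
by move=> l lk Sl; apply: (nS _ lk); apply: cS Sl; apply: idx_le (esym e); exact: ltnW.
Qed.

Lemma stop_cellP S n : cell_pred S ->
  stop_cell S n = set0 \/
  exists k x, first_stop S k x /\ stop_cell S n = cell k x.
Proof.
move=> cS; have [->|/set0P[x [k [-> fx]]]] := eqVneq (stop_cell S n) set0.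
  by left.
right; exists k, x; split => //; apply/seteqP; split => y.
  by move=> [l [/(pcan_inj pickleK)[<-]]].
by move=> e; exists k; split; [rewrite e|exact: first_stop_pred fx].
Qed.

Lemma stop_cell_measurable S n : cell_pred S -> measurable (stop_cell S n).
Proof.
by move=> /(stop_cellP n)[->//|[k [x [_ ->]]]]; exact: dy_meas.
Qed.

Lemma first_stop_uniq S k l x : first_stop S k x -> first_stop S l x -> k = l.
Proof.
by move=> [Sk nk] [Sl nl]; case: (ltngtP k l) => // h; [case: (nl _ h)|case: (nk _ h)].
Qed.

Lemma stop_cell_trivIset S : trivIset setT (stop_cell S).
Proof.
move=> m n _ _ [x [[k [-> fk]] [l [-> fl]]]].
by rewrite (first_stop_uniq fk fl).
Qed.

Lemma bigcup_stop_cell S : \bigcup_n stop_cell S n = stopped S.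
Proof.
apply/seteqP; split => x; first by move=> [n _ [k [_ [Sk _]]]]; exists k.
move=> /= Sx; have Sx' : exists k, `[<S k x>] by case: Sx => k Sk; exists k; apply/asboolP.
have [k /asboolP Sk kmin] := ex_minnP Sx'.
exists (pickle (k, idx k x)) => //; exists k; split => //; split => // l lk Sl.
by have := kmin l (asboolT Sl); rewrite leqNgt lk.
Qed.

Lemma stopped_measurable S : cell_pred S -> measurable (stopped S).
Proof.
move=> cS; rewrite -bigcup_stop_cell; apply: bigcup_measurable => n _.
exact: stop_cell_measurable.
Qed.

(** Integrals over a union of disjoint cells are compared cell by cell. *)
Lemma stopped_integral_le S (g h : T -> \bar R) : cell_pred S ->
  measurable_fun [set: T] g -> measurable_fun [set: T] h ->
  (forall x, 0 <= g x) -> (forall x, 0 <= h x) ->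
  (forall k x, first_stop S k x ->
    \int[mu]_(y in cell k x) g y <= \int[mu]_(y in cell k x) h y) ->
  \int[mu]_(y in stopped S) g y <= \int[mu]_(y in stopped S) h y.
Proof.
move=> cS mg mh g0 h0 gh; rewrite -bigcup_stop_cell.
rewrite !ge0_integral_bigcup//; first last.
- exact: stop_cell_trivIset.
- by rewrite bigcup_stop_cell; apply: measurable_funTS.
- by move=> n; exact: stop_cell_measurable.
- exact: stop_cell_trivIset.
- by rewrite bigcup_stop_cell; apply: measurable_funTS.
- by move=> n; exact: stop_cell_measurable.
apply: lee_nneseries => [n _ _|n _]; first exact: integral_ge0.
have [->|[k [x [fx ->]]]] := stop_cellP n cS; last exact: gh.
by rewrite !integral_set0.
Qed.

Definition heavy (g : T -> \bar R) (l : R) k x :=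
  l%:E * mu (cell k x) < \int[mu]_(y in cell k x) g y.

Lemma heavy_pred g l : cell_pred (heavy g l).
Proof. by move=> k x y e; rewrite /heavy (cell_eq e). Qed.

Lemma stopped_weak_type S (g : T -> \bar R) (l : R) : cell_pred S ->
  measurable_fun [set: T] g -> (forall x, 0 <= g x) -> (0 <= l)%R ->
  (forall k x, S k x -> heavy g l k x) ->
  l%:E * mu (stopped S) <= \int[mu]_(y in stopped S) g y.
Proof.
move=> cS mg g0 l0 Sh; rewrite -integral_cst; last exact: stopped_measurable.
apply: stopped_integral_le => // k x [/Sh/ltW h _].
by rewrite integral_cst//; exact: (dy_meas dy).
Qed.

(** The half of the differentiation theorem needed below: where no small cell
is heavy, the function itself is not large in mean. Regularity of the measure
lets disjoint cells cover [E] with little waste. *)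
Lemma light_integral_le (g : T -> \bar R) (l : R) m E :
  measurable_fun [set: T] g -> (forall x, 0 <= g x) -> (0 <= l)%R ->
  measurable E -> mu E < +oo ->
  (forall k x, E x -> (m <= k)%N -> ~ heavy g l k x) ->
  \int[mu]_(y in E) g y <= l%:E * mu E.
Proof.
move=> mg g0 l0 mE finE light.
have fE : mu E \is a fin_num by rewrite ge0_fin_numE.
apply/lee_addgt0Pr => e e0.
have e0' : (0 < e / (l + 1))%R by rewrite divr_gt0// ltr_wpDl.
have [U [mU EU Ue Uc]] := dy_reg dy m mE finE e0'.
pose S k x := [/\ (m <= k)%N, cell k x `<=` U & exists2 y, cell k x y & E y].
have cS : cell_pred S.
  by move=> k x y /cell_eq e' [? ? ?]; rewrite /S -e'; split.
have ES : E `<=` stopped S.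
  by move=> x Ex; have [k mk kU] := Uc _ (EU _ Ex); exists k; split => //; exists x.
have SU : stopped S `<=` U by move=> x [k [_ + _]]; apply; exact: cell_refl.
apply: (@le_trans _ _ (\int[mu]_(y in stopped S) g y)).
  apply: ge0_subset_integral => //; first exact: stopped_measurable.
  exact: measurable_funTS.
apply: (@le_trans _ _ (\int[mu]_(y in stopped S) (cst l%:E) y)).
  apply: stopped_integral_le => // k x [[mk _ [y ky Ey]] _].
  have /negP := light k y Ey mk.
  by rewrite /heavy (cell_eq ky) -leNgt integral_cst//; exact: (dy_meas dy).
rewrite integral_cst; last exact: stopped_measurable.
apply: (@le_trans _ _ (l%:E * (mu E + (e / (l + 1))%:E))).
  rewrite lee_wpmul2l ?lee_fin// (le_trans _ Ue)// le_measure ?inE//.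
  exact: stopped_measurable.
rewrite -(fineK fE) -EFinD -!EFinM -EFinD lee_fin mulrDr lerD2l.
rewrite mulrCA; apply: ler_piMr; first exact: ltW.
by rewrite ler_pdivrMr ?ltr_wpDl// mul1r lerDl.
Qed.

End DyadicStructure.

(** * A-infinity weights along nested partitions *)

Section Ainfinity.
Context (dsp : measure_display) (T : measurableType dsp) (R : realType).
Context (mu : {measure set T -> \bar R}).
Context (J : countType) (idx : nat -> T -> J) (D : R).
Hypothesis dy : dyadic mu idx D.
Local Open Scope ereal_scope.

Lemma dyadic_ge1 (x : T) : (1 <= D)%R.
Proof.
have := dy_dbl dy 0 x; have f0 := cell_fin dy 0 x; have f1 := cell_fin dy 1 x.
have := dy_pos dy 1 x.
have : mu (cell idx 1 x) <= mu (cell idx 0 x).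
  by rewrite le_measure ?inE//; [exact: (dy_meas dy)..|exact: (cell_le dy)].
rewrite -(fineK f0) -(fineK f1) -EFinM !lee_fin lte_fin => h1 h2 h3.
rewrite -(ler_pM2r h2) mul1r; exact: le_trans h1 h3.
Qed.

Context (w : T -> R) (kap : R) (m : nat) (x0 : T).
Hypothesis mw : measurable_fun [set: T] w.
Hypothesis w0 : forall x, (0 <= w x)%R.
Hypothesis kap1 : (1 <= kap)%R.
(* one form of the A-infinity condition *)
Hypothesis Ainf : forall k x E, measurable E -> E `<=` cell idx k x ->
  mu (cell idx k x) <= 2%:E * mu E ->
  \int[mu]_(y in cell idx k x) (w y)%:E <= kap%:E * \int[mu]_(y in E) (w y)%:E.
Hypothesis avg1 :
  \int[mu]_(y in cell idx m x0) (w y)%:E <= mu (cell idx m x0).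

Let a := (2 * D)%R.

Definition high_avg n i x := [/\ (m <= i)%N, cell idx m x0 x &
  heavy mu idx (EFin \o w) (a ^+ n) i x].

Let a1 : (1 <= a)%R.
Proof. by rewrite /a; have := dyadic_ge1 x0; lra. Qed.

Let a0 : (0 <= a)%R. Proof. exact: le_trans a1. Qed.

Let mwE : measurable_fun [set: T] (EFin \o w).
Proof. exact/measurable_EFinP. Qed.

Let wE0 x : 0 <= (EFin \o w) x. Proof. by rewrite lee_fin. Qed.

Lemma high_avg_pred n : cell_pred idx (high_avg n).
Proof.
move=> i x y e [mi cx hx]; split => //; last exact: heavy_pred hx.
by rewrite /cell/= -(idx_le dy mi e).
Qed.

Let mOm : forall n, measurable (stopped (high_avg n)).
Proof. by move=> n; exact: (stopped_measurable dy (@high_avg_pred n)). Qed.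

Lemma high_avg_sub n : stopped (high_avg n) `<=` cell idx m x0.
Proof. by move=> x [i []]. Qed.

Lemma high_avg_le n i x : high_avg n.+1 i x -> high_avg n i x.
Proof.
move=> [? ? h]; split => //; apply: le_lt_trans h.
by rewrite lee_wpmul2r ?measure_ge0// lee_fin exprS ler_peMl// exprn_ge0.
Qed.

Lemma int_sub A B : measurable A -> measurable B -> A `<=` B ->
  \int[mu]_(y in A) (w y)%:E <= \int[mu]_(y in B) (w y)%:E.
Proof.
move=> mA mB AB; apply: ge0_subset_integral => //.
- exact: measurable_funTS mwE.
- by move=> y _; exact: wE0.
Qed.

Lemma int_sub_fin A B : measurable A -> measurable B -> A `<=` B ->
  \int[mu]_(y in B) (w y)%:E < +oo ->
  \int[mu]_(y in A) (w y)%:E \is a fin_num.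
Proof.
move=> mA mB AB fB; rewrite ge0_fin_numE; last by apply: integral_ge0 => y _; exact: wE0.
by apply: le_lt_trans fB; exact: int_sub.
Qed.

Lemma first_high_avg n i x : first_stop (high_avg n) i x ->
  \int[mu]_(y in cell idx i x) (w y)%:E <= (D * a ^+ n)%:E * mu (cell idx i x).
Proof.
move=> [[mi cx hx] nh].
have mlti : (m < i)%N.
  rewrite ltn_neqAle mi andbT; apply/eqP => mE; move: hx; rewrite -mE; apply/negP.
  rewrite /heavy -leNgt (cell_eq cx) (le_trans avg1)//.
  by rewrite -[leLHS]mul1e lee_wpmul2r// lee_fin exprn_ege1.
case: i => // i in mi hx nh mlti *.
have : ~ heavy mu idx (EFin \o w) (a ^+ n) i x.
  by move=> h; apply: (nh i (ltnSn i)); split.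
move=> /negP; rewrite /heavy -leNgt => h.
apply: (@le_trans _ _ (\int[mu]_(y in cell idx i x) (w y)%:E)).
  by apply: int_sub; [exact: (dy_meas dy)..|exact: (cell_le dy)].
apply: (le_trans h); rewrite [(D * _)%R]mulrC EFinM -muleA lee_wpmul2l//.
  by rewrite lee_fin exprn_ge0.
exact: (dy_dbl dy).
Qed.

(** Inside a first cell where the average exceeds [a ^+ n] the higher level set
takes at most half of the measure, so by the A-infinity hypothesis it misses a
fixed proportion of the mass. *)
Lemma high_avg_cell n i x : first_stop (high_avg n) i x ->
  \int[mu]_(y in cell idx i x) ((EFin \o w) \_ (stopped (high_avg n.+1))) y <=
  \int[mu]_(y in cell idx i x) ((1 - kap^-1)%:E * (w y)%:E).
Proof.
move=> fx; have mC := dy_meas dy i x.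
have intle := first_high_avg fx.
have [[mi cx hx] nh] := fx.
pose S j y := [/\ (i <= j)%N, cell idx i x y &
  heavy mu idx (EFin \o w) (a ^+ n.+1) j y].
have cS : cell_pred idx S.
  move=> j y z e [ij cy hy]; split => //; last exact: heavy_pred hy.
  by rewrite /cell/= -(idx_le dy ij e).
have mS : measurable (stopped S) by exact: (stopped_measurable dy cS).
have SC : stopped S `<=` cell idx i x by move=> y [j []].
have fC : \int[mu]_(y in cell idx i x) (w y)%:E < +oo.
  apply: le_lt_trans intle _; rewrite lte_mul_pinfty// ?lee_fin ?mulr_ge0 ?exprn_ge0//.
    exact: le_trans (dyadic_ge1 x0).
  exact: (dy_fin dy).
have finC := int_sub_fin mC mC (@subset_refl _ _) fC.
have finS := int_sub_fin mS mC SC fC.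
pose E := cell idx i x `\` stopped S.
have mE : measurable E by exact: measurableD.
have EC : E `<=` cell idx i x by move=> y [].
have finE := int_sub_fin mE mC EC fC.
have EUS : E `|` stopped S = cell idx i x by rewrite setUC /E setDUK.
have EIS : E `&` stopped S = set0 by rewrite /E setDKI.
have splitC : \int[mu]_(y in cell idx i x) (w y)%:E =
    \int[mu]_(y in E) (w y)%:E + \int[mu]_(y in stopped S) (w y)%:E.
  rewrite -EUS ge0_integral_setU//.
  - exact: measurable_funTS mwE.
  - by move=> y _; exact: wE0.
  - exact/disj_set2P.
have muS : 2%:E * mu (stopped S) <= mu (cell idx i x).
  have : (a ^+ n.+1)%:E * mu (stopped S) <= (D * a ^+ n)%:E * mu (cell idx i x).
    apply: le_trans intle; apply: (le_trans (y := \int[mu]_(y in stopped S) (w y)%:E)).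
      apply: (stopped_weak_type dy) => //; first by rewrite exprn_ge0.
      by move=> j y [].
    exact: int_sub.
  have fC' := cell_fin dy i x.
  have fS' : mu (stopped S) \is a fin_num.
    rewrite ge0_fin_numE// (le_lt_trans _ (dy_fin dy i x))//.
    by rewrite le_measure ?inE.
  rewrite -(fineK fC') -(fineK fS') -!EFinM !lee_fin.
  have Da : (0 < D * a ^+ n)%R.
    by rewrite mulr_gt0 ?exprn_gt0//; have := dyadic_ge1 x0; have := a1; lra.
  move=> h; rewrite -(ler_pM2l Da); apply: le_trans h.
  by rewrite exprS (_ : _ * (2 * _) = a * a ^+ n * fine (mu (stopped S)))%R// /a; ring.
have muE : mu (cell idx i x) <= 2%:E * mu E.
  have fS' : mu (stopped S) \is a fin_num.
    rewrite ge0_fin_numE// (le_lt_trans _ (dy_fin dy i x))//.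
    by rewrite le_measure ?inE.
  have : mu (cell idx i x) = mu E + mu (stopped S).
    by rewrite -measureU// EUS.
  have fE' : mu E \is a fin_num.
    rewrite ge0_fin_numE// (le_lt_trans _ (dy_fin dy i x))//.
    by rewrite le_measure ?inE.
  move: muS; rewrite -(fineK fS') -(fineK (cell_fin dy i x)) -(fineK fE').
  rewrite -EFinD -!EFinM !lee_fin => h [h']; lra.
have := Ainf mE EC muE.
rewrite ge0_integralZl_EFin//; last first.
- by rewrite subr_ge0 invf_le1// (lt_le_trans _ kap1).
- exact: measurable_funTS mwE.
- by move=> y _; exact: wE0.
have : \int[mu]_(y in cell idx i x) ((EFin \o w) \_ (stopped (high_avg n.+1))) y
    <= \int[mu]_(y in stopped S) (w y)%:E.
  rewrite -integral_mkcondr; apply: int_sub => //; first exact: measurableI.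
  move=> y [cy [j hj]]; exists j; split => //; last by case: hj.
  rewrite leqNgt; apply/negP => ji; apply: (nh j ji).
  apply: high_avg_pred (high_avg_le hj); apply: (idx_le dy (ltnW ji)).
  exact: cy.
move=> h hE; apply: (le_trans h).
move: hE splitC; rewrite -(fineK finC) -(fineK finE) -(fineK finS).
rewrite -EFinD -!EFinM !lee_fin => hE [hs].
have k0 : (0 < kap)%R by rewrite (lt_le_trans _ kap1).
have h2 : (kap^-1 * fine (\int[mu]_(y in cell idx i x) (w y)%:E) <=
    fine (\int[mu]_(y in E) (w y)%:E))%R by rewrite ler_pdivrMl.
lra.
Qed.

(** Iteration of the one-step loss, cell by cell. *)
Lemma high_avg_decay n :
  \int[mu]_(y in stopped (high_avg n)) (w y)%:E <=
  ((1 - kap^-1) ^+ n)%:E * mu (cell idx m x0).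
Proof.
have k0 : (0 <= 1 - kap^-1)%R.
  by rewrite subr_ge0 invf_le1// (lt_le_trans _ kap1).
elim: n => [|n IH].
  rewrite expr0 mul1e; apply: le_trans avg1; apply: int_sub => //; last exact: high_avg_sub.
  exact: (dy_meas dy).
apply: (@le_trans _ _ ((1 - kap^-1)%:E *
    \int[mu]_(y in stopped (high_avg n)) (w y)%:E)); last first.
  by rewrite exprS EFinM -muleA lee_wpmul2l.
rewrite -ge0_integralZl_EFin//;
  [|by move=> y _; exact: wE0|exact: measurable_funTS mwE].
rewrite (_ : \int[mu]_(y in stopped (high_avg n.+1)) _ =
  \int[mu]_(y in stopped (high_avg n))
    ((EFin \o w) \_ (stopped (high_avg n.+1))) y); last first.
  rewrite -integral_mkcondr setIidr// => x [i h]; exists i; exact: high_avg_le.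
apply: (stopped_integral_le dy) => //; first exact: high_avg_pred.
- by apply/(measurable_restrictT _ _).1 => //; exact: measurable_funTS mwE.
- exact: measurable_funeM.
- by move=> x; apply: erestrict_ge0.
- by move=> x; apply: mule_ge0; rewrite lee_fin.
- exact: high_avg_cell.
Qed.

(** Quantitative gain over Chebyshev: a factor geometric in the level. *)
Lemma Ainf_distribution n :
  mu [set x | cell idx m x0 x /\ (2 * a ^+ n <= w x)%R] <=
  ((a ^- n) * (1 - kap^-1) ^+ n)%:E * mu (cell idx m x0).
Proof.
set G := [set x | _]; have an : (0 < a ^+ n)%R by rewrite exprn_gt0// (lt_le_trans _ a1).
have mC := dy_meas dy m x0.
have mG : measurable G.
  rewrite (_ : G = cell idx m x0 `&` (w @^-1` `[(2 * a ^+ n)%R, +oo[)).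
    by apply: measurableI => //; rewrite -[X in measurable X]setTI; exact: mw.
  by apply/seteqP; split => x /= [? h]; split => //; move: h; rewrite /= in_itv/= andbT.
have GC : G `<=` cell idx m x0 by move=> x [].
have fin A : measurable A -> A `<=` cell idx m x0 -> mu A \is a fin_num.
  move=> mA AC; rewrite ge0_fin_numE// (le_lt_trans _ (dy_fin dy m x0))//.
  by rewrite le_measure ?inE.
set O := stopped (high_avg n).
have mO : measurable O by exact: mOm.
have mE : measurable (G `\` O) by exact: measurableD.
have EC : G `\` O `<=` cell idx m x0 by move=> x [/GC].
have fE := fin _ mE EC.
have E0 : mu (G `\` O) = 0.
  have h1 : \int[mu]_(y in G `\` O) (w y)%:E <= (a ^+ n)%:E * mu (G `\` O).
    apply: (@light_integral_le _ _ _ mu _ idx D dy _ _ m) => //; first exact: ltW.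
      by rewrite -ge0_fin_numE.
    by move=> k x [[cx _] nO] mk h; apply: nO; exists k.
  have h2 : (2 * a ^+ n)%:E * mu (G `\` O) <= \int[mu]_(y in G `\` O) (w y)%:E.
    rewrite -integral_cst//; apply: ge0_le_integral => //.
    - by move=> x _; rewrite lee_fin mulr_ge0// ltW.
    - exact: measurable_funTS mwE.
    - by move=> x [[_ h] _]; rewrite lee_fin.
  have := le_trans h2 h1; have f0 : (0 <= fine (mu (G `\` O)))%R by rewrite fine_ge0.
  rewrite -(fineK fE) -!EFinM !lee_fin => h; congr EFin; apply/eqP.
  rewrite eq_le f0 andbT; by move: h; nra.
have h3 : (a ^+ n)%:E * mu (G `&` O) <= ((1 - kap^-1) ^+ n)%:E * mu (cell idx m x0).
  apply: le_trans (high_avg_decay n).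
  have mGO : measurable (G `&` O) by exact: measurableI.
  rewrite -integral_cst//; apply: (@le_trans _ _ (\int[mu]_(y in G `&` O) (w y)%:E)).
    apply: ge0_le_integral => //.
    - by move=> x _; rewrite lee_fin ltW.
    - exact: measurable_funTS mwE.
    - by move=> x [[_ h] _]; rewrite lee_fin (le_trans _ h)// ler_peMl ?ltW//; lra.
  exact: int_sub.
have -> : mu G = mu (G `&` O).
  transitivity (mu (G `\` O) + mu (G `&` O)); first exact: measureDI.
  by rewrite E0 add0e.
have fGO : mu (G `&` O) \is a fin_num by apply: fin; [exact: measurableI|move=> x [/GC]].
move: h3; rewrite -(fineK fGO) -(fineK (cell_fin dy m x0)) -!EFinM !lee_fin.
by rewrite -mulrA [X in (_ -> _ <= X)%R]mulrC ler_pdivlMr// [(_ * a ^+ n)%R]mulrC.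
Qed.

End Ainfinity.

(** * Principal cells *)

Section PrincipalCells.
Context (dsp : measure_display) (T : measurableType dsp) (R : realType).
Context (mu : {measure set T -> \bar R}).
Context (J : countType) (idx : nat -> T -> J) (D : R).
Hypothesis dy : dyadic mu idx D.
Local Open Scope ereal_scope.

Lemma level_measurable (S : nat -> T -> Prop) k :
  cell_pred idx S -> measurable [set x | S k x].
Proof.
move=> cS; pose S' j x := j = k /\ S j x.
rewrite (_ : [set x | _] = stopped S').
  apply: (stopped_measurable dy) => j x y e [jk Sj]; split => //; exact: cS e Sj.
by apply/seteqP; split => x /=; [exists k|move=> [j [-> ]]].
Qed.

Context (h : nat -> T -> T -> \bar R).
Hypothesis h_eq : forall k x y, idx k x = idx k y -> h k x = h k y.
Hypothesis mh : forall k x, measurable_fun [set: T] (h k x).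
Hypothesis h0 : forall k x y, 0 <= h k x y.
Hypothesis hfin : forall k x, \int[mu]_(y in cell idx k x) h k x y < +oo.

Definition own_avg k x : R :=
  (fine (\int[mu]_(y in cell idx k x) h k x y) / fine (mu (cell idx k x)))%R.

(** Level of the smallest principal cell containing the cell of level [k]:
a cell becomes principal when the average of the function attached to the current
principal cell has doubled on it. *)
Fixpoint principal k x : nat :=
  if k is k'.+1 then
    let l := principal k' x in
    if `[< heavy mu idx (h l x) (2 * own_avg l x) k x >] then k else l
  else 0%N.

Lemma own_avg_ge0 k x : (0 <= own_avg k x)%R.
Proof.
by rewrite divr_ge0// fine_ge0// integral_ge0// => y _.
Qed.

Lemma own_avgE k x :
  \int[mu]_(y in cell idx k x) h k x y = (own_avg k x)%:E * mu (cell idx k x).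
Proof.
rewrite /own_avg; have fC := cell_fin dy k x.
have /fineK <- : \int[mu]_(y in cell idx k x) h k x y \is a fin_num.
  by rewrite ge0_fin_numE// integral_ge0// => y _.
rewrite -(fineK fC) -EFinM divfK// gt_eqF//.
by rewrite -lte_fin fineK// (dy_pos dy).
Qed.

Lemma own_avg_eq k x y : idx k x = idx k y -> own_avg k x = own_avg k y.
Proof. by move=> e; rewrite /own_avg (h_eq e) (cell_eq e). Qed.

Lemma principal_le k x : (principal k x <= k)%N.
Proof.
elim: k => //= k IH; case: asboolP => // _; exact: leqW.
Qed.

Lemma principal_eq k x y : idx k x = idx k y -> principal k x = principal k y.
Proof.
elim: k => //= k IH e; have e' := dy_nest dy e; rewrite -(IH e').
set l := principal k x; have el : idx l x = idx l y.
  by apply: (idx_le dy) e'; exact: principal_le.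
by rewrite /heavy (h_eq el) (own_avg_eq el) (cell_eq e).
Qed.

Lemma principal_idem k x : principal (principal k x) x = principal k x.
Proof.
elim: k => // k IH; rewrite [principal k.+1 x]/=.
by case: asboolP => [hv|//]; rewrite /=; case: asboolP.
Qed.

Lemma principal_light k x : let l := principal k x in
  \int[mu]_(y in cell idx k x) h l x y <=
  (2 * own_avg l x)%:E * mu (cell idx k x).
Proof.
have own j : \int[mu]_(y in cell idx j x) h j x y <=
    (2 * own_avg j x)%:E * mu (cell idx j x).
  rewrite own_avgE lee_wpmul2r// lee_fin; have := own_avg_ge0 j x; lra.
case: k => [|k] /=; first exact: own.
case: asboolP => [_|/negP]; first exact: own.
by rewrite /heavy -leNgt.
Qed.

(** The part of a principal cell outside all later principal cells. *)
Definition leaf k x : set T :=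
  [set y | cell idx k x y /\ forall l, (k <= l)%N -> principal l y = k].

Lemma leaf_measurable k x : measurable (leaf k x).
Proof.
rewrite (_ : leaf k x = cell idx k x `&`
  \bigcap_(l in [set l | (k <= l)%N]) [set y | principal l y = k]); last first.
  by apply/seteqP; split => y.
apply: measurableI; first exact: (dy_meas dy).
apply: bigcap_measurableType => l _.
apply: (@level_measurable (fun l y => principal l y = k)) => j y z e <-.
by rewrite (principal_eq e).
Qed.

(** The later principal cells lie where the average exceeds twice its value, a
set of at most half of the measure by the weak-type inequality. *)
Lemma leaf_half k x : principal k x = k ->
  mu (cell idx k x) <= 2%:E * mu (leaf k x).
Proof.
move=> pk; pose S j y := [/\ (k <= j)%N, cell idx k x y &
  heavy mu idx (h k x) (2 * own_avg k x) j y].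
have cS : cell_pred idx S.
  move=> j y z e [kj cy hy]; split => //; last exact: heavy_pred hy.
  by rewrite /cell/= -(idx_le dy kj e).
have mS : measurable (stopped S) by exact: (stopped_measurable dy cS).
have mC := dy_meas dy k x.
have SC : stopped S `<=` cell idx k x by move=> y [j []].
have CS : cell idx k x `<=` leaf k x `|` stopped S.
  move=> y cy; have [|nS] := pselect (stopped S y); [by right|left].
  split => // l; elim: l => [|l IH].
    by rewrite leqn0 => /eqP k0; move: pk; rewrite k0.
  rewrite leq_eqVlt => /predU1P[<-|kl].
    by rewrite -[RHS]pk; apply: principal_eq.
  rewrite /= IH//; case: asboolP => // hv; exfalso; apply: nS; exists l.+1.
  by split => //; [exact: ltnW|rewrite -(h_eq cy) -(own_avg_eq cy)].
have fin A : measurable A -> A `<=` cell idx k x -> mu A \is a fin_num.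
  move=> mA AC; rewrite ge0_fin_numE// (le_lt_trans _ (dy_fin dy k x))//.
  by rewrite le_measure ?inE.
have mL := leaf_measurable k x.
have fL : mu (leaf k x) \is a fin_num by apply: fin => // y [].
have fS := fin _ mS SC.
have muS : 2%:E * mu (stopped S) <= mu (cell idx k x).
  have [a0|a0] := eqVneq (own_avg k x) 0%R.
    rewrite (_ : stopped S = set0) ?measure0 ?mule0//.
    rewrite -subset0 => y [j [kj cy]]; rewrite /heavy a0 mulr0 mul0e ltNge => /negP; apply.
    rewrite (_ : 0%E = \int[mu]_(y in cell idx k x) h k x y); last first.
      by rewrite own_avgE a0 mul0e.
    apply: ge0_subset_integral => //; first exact: (dy_meas dy).
      exact: measurable_funTS.
    move=> z /(idx_le dy kj) e; rewrite /cell/= e; exact: cy.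
  have : (2 * own_avg k x)%:E * mu (stopped S) <= (own_avg k x)%:E * mu (cell idx k x).
    rewrite -own_avgE; apply: (@le_trans _ _ (\int[mu]_(y in stopped S) h k x y)).
      apply: (stopped_weak_type dy) => //; last by move=> j y [].
      by rewrite mulr_ge0// own_avg_ge0.
    by apply: ge0_subset_integral => //; exact: measurable_funTS.
  have a1 : (0 < own_avg k x)%R by rewrite lt_neqAle eq_sym a0 own_avg_ge0.
  rewrite -(fineK fS) -(fineK (cell_fin dy k x)) -!EFinM !lee_fin.
  by rewrite [(2 * own_avg _ _)%R]mulrC -mulrA ler_pM2l.
have : mu (cell idx k x) <= mu (leaf k x) + mu (stopped S).
  apply: (@le_trans _ _ (mu (leaf k x `|` stopped S))).
    by rewrite le_measure ?inE//; exact: measurableU.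
  exact: measureU2.
move: muS; rewrite -(fineK fL) -(fineK fS) -(fineK (cell_fin dy k x)).
rewrite -EFinD -!EFinM !lee_fin; lra.
Qed.

(** Leaves of distinct principal cells are disjoint, so measures of principal
cells add up to at most twice the measure of their union. *)
Lemma sparse_measure_le (Z : nat -> T -> Prop) (G : nat -> T -> set T) (c : R) :
  cell_pred idx Z -> (forall k x y, idx k x = idx k y -> G k x = G k y) ->
  (forall k x, measurable (G k x)) -> (0 <= c)%R ->
  (forall k x, principal k x = k -> Z k x ->
    mu (G k x) <= c%:E * mu (cell idx k x)) ->
  let S := [set x | exists k, [/\ principal k x = k, Z k x & G k x x]] in
  measurable S /\ mu S <= (2 * c)%:E * mu (stopped Z).
Proof.
move=> cZ Geq mG c0 Gc S.
pose part (A : nat -> T -> set T) n :=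
  [set x | exists k, [/\ n = pickle (k, idx k x), principal k x = k, Z k x & A k x x]].
have partP A n : (forall k x y, idx k x = idx k y -> A k x = A k y) ->
    part A n = set0 \/ exists k x, [/\ principal k x = k, Z k x,
      n = pickle (k, idx k x) & part A n = cell idx k x `&` A k x].
  move=> Aeq; have [->|/set0P[x [k [-> pk Zk Ak]]]] := eqVneq (part A n) set0.
    by left.
  right; exists k, x; split => //; apply/seteqP; split => y.
    by move=> [l [/(pcan_inj pickleK)[<-] e _ _ Ay]]; split; [|rewrite (Aeq _ _ _ e)].
  move=> [cy Ay]; exists k; split; [by rewrite cy|by rewrite -(principal_eq (esym cy))| |].
    by apply: cZ Zk; rewrite cy.
  by rewrite (Aeq _ _ _ cy).
have leaf_eq k x y : idx k x = idx k y -> leaf k x = leaf k y.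
  by move=> e; rewrite /leaf (cell_eq e).
have mpart A n : (forall k x y, idx k x = idx k y -> A k x = A k y) ->
    (forall k x, measurable (A k x)) -> measurable (part A n).
  move=> Aeq mA; have [->//|[k [x [_ _ _ ->]]]] := partP A n Aeq.
  by apply: measurableI => //; exact: (dy_meas dy).
have SE : S = \bigcup_n part G n.
  apply/seteqP; split => x; first by move=> [k [pk Zk Gk]]; exists (pickle (k, idx k x)) => //; exists k.
  by move=> [n _ [k [_ pk Zk Gk]]]; exists k.
have mS : measurable S by rewrite SE; apply: bigcup_measurable => n _; exact: mpart.
split => //; apply: (@le_trans _ _ (\sum_(n <oo) mu (part G n))).
  apply: measure_sigma_subadditive => //; last by rewrite SE.
  by move=> n; exact: mpart.
have trL : trivIset setT (part leaf).
  move=> m n _ _ [x [[k [-> pk _ [_ Lk]]] [l [-> pl _ [_ Ll]]]]].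
  suff -> : k = l by [].
  by case: (leqP k l) => [/Lk|/ltnW/Ll]; rewrite ?pk ?pl.
have mpl n : measurable (part leaf n) by apply: mpart => // k x; exact: leaf_measurable.
have partle n : mu (part G n) <= (2 * c)%:E * mu (part leaf n).
  have [->|[k [x [pk Zk nE ->]]]] := partP G n Geq.
    by rewrite measure0 mule_ge0// lee_fin mulr_ge0.
  have -> : part leaf n = leaf k x.
    apply/seteqP; split => y.
      move=> [l [ ]]; rewrite nE => /(pcan_inj pickleK)[<-] e _ _.
      by rewrite (leaf_eq _ _ _ e).
    move=> [cy Ly]; exists k; split; [by rewrite cy| by apply: Ly | |by split].
    by apply: cZ Zk; rewrite cy.
  apply: (@le_trans _ _ (mu (G k x))).
    by rewrite le_measure ?inE//; apply: measurableI => //; exact: (dy_meas dy).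
  apply: (le_trans (Gc _ _ pk Zk)).
  by rewrite mulrC EFinM -muleA lee_wpmul2l ?lee_fin//; exact: leaf_half.
apply: (@le_trans _ _ (\sum_(n <oo) ((2 * c)%:E * mu (part leaf n)))).
  by apply: lee_nneseries => n _.
rewrite nneseriesZl//.
rewrite lee_wpmul2l ?lee_fin ?mulr_ge0// -measure_semi_bigcup//; last exact: bigcup_measurable.
rewrite le_measure ?inE//.
- by apply: bigcup_measurable.
- exact: (stopped_measurable dy).
- by move=> x [n _ [k [_ _ Zk _]]]; exists k.
Qed.

End PrincipalCells.

(** * Nearly optimal bases *)

Section Auerbach.
Context (R : realType) (m : nat) (rho : 'rV[R]_m -> R) (B : R).
Hypothesis rho_ge0 : forall z, 0 <= rho z.
Hypothesis rhoZ : forall c z, rho (c *: z) = `|c| * rho z.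
Hypothesis B_ge0 : 0 <= B.
Hypothesis rho_ge : forall (z : 'rV[R]_m) (i : 'I_m), `|z 0 i| <= B * rho z.

Lemma det_le_of_rows (E : 'M[R]_m) : (forall i, rho (row i E) <= 1) ->
  `|\det E| <= \sum_(s : 'S_m) B ^+ m.
Proof.
move=> Er; apply: le_trans (ler_norm_sum _ _ _) _; apply: ler_sum => s _.
rewrite normrM normrX normrN1 expr1n mul1r normr_prod.
rewrite -[m in B ^+ m]card_ord -prodr_const; apply: ler_prod => i _.
rewrite normr_ge0/=; have := rho_ge (row i E) (s i); rewrite mxE => /le_trans; apply.
by rewrite ler_piMr.
Qed.

(** Rows nearly maximizing the determinant among rows of size at most one: by
Cramer's rule every vector then has small coordinates in this basis. Near
maximality replaces the compactness in the usual argument. *)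
Lemma almost_auerbach : exists E : 'M[R]_m, [/\ E \in unitmx,
  forall i, rho (row i E) <= 1 &
  forall (z : 'rV[R]_m) (i : 'I_m), `|(z *m invmx E) 0 i| <= 2 * rho z].
Proof.
pose S := [set `|\det E| | E in [set E : 'M[R]_m | forall i, rho (row i E) <= 1]].
have ubS : has_ubound S by exists (\sum_(s : 'S_m) B ^+ m) => _ [E Er <-]; exact: det_le_of_rows.
(* small enough for the rows of the scalar matrix [c] to be admissible *)
pose c : R := (1 + \sum_i rho (delta_mx 0 i))^-1.
have s0 : 0 < 1 + \sum_i rho (delta_mx 0 i) by rewrite ltr_pwDl// sumr_ge0.
have c0 : 0 < c by rewrite invr_gt0.
have SE0 : S `|\det (@scalar_mx R m c)|.
  exists c%:M => // i; rewrite (_ : row i _ = c *: delta_mx 0 i); last first.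
    by apply/rowP => j; rewrite !mxE eqxx/= mulr_natr [j == i]eq_sym.
  rewrite rhoZ gtr0_norm// mulrC ler_pdivrMr// mul1r.
  by rewrite (bigD1 i)//= addrCA lerDl addr_ge0// sumr_ge0.
have hsS : has_sup S by split => //; exists `|\det (@scalar_mx R m c)|.
have D0 : 0 < sup S.
  apply: lt_le_trans (ub_le_sup ubS SE0); rewrite normr_gt0 det_scalar.
  by rewrite expf_neq0// gt_eqF.
have [_ [E Er <-] EE] := sup_adherent (divr_gt0 D0 (ltr0n R 2)) hsS.
have dE : 0 < `|\det E| by move: EE; lra.
have uE : E \in unitmx by rewrite unitmxE unitfE -normr_gt0.
exists E; split => // z i.
have [z0|z0] := eqVneq (rho z) 0.
  rewrite (_ : z = 0) ?mul0mx ?mxE ?normr0 ?mulr_ge0//.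
  by apply/rowP => j; apply/eqP; rewrite mxE -normr_le0 (le_trans (rho_ge z j))// z0 mulr0.
have z1 : 0 < rho z by rewrite lt_neqAle eq_sym z0 rho_ge0.
pose E' : 'M[R]_m := \matrix_(k, j) if k == i then (rho z)^-1 * z 0 j else E k j.
have dE' : \det E' = (rho z)^-1 * ((z *m \adj E) 0 i).
  rewrite (expand_det_row _ i) mxE mulr_sumr; apply: eq_bigr => j _.
  rewrite !mxE eqxx -mulrA; congr (_ * (_ * _)); rewrite /cofactor.
  congr (_ * _); congr determinant.
  by apply/matrixP => k l; rewrite !mxE eq_sym (negbTE (neq_lift _ _)).
have : `|\det E'| <= sup S.
  apply: ub_le_sup => //; exists E' => // k.
  have [->|ki] := eqVneq k i.
    rewrite (_ : row i E' = (rho z)^-1 *: z); last by apply/rowP => j; rewrite !mxE eqxx.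
    by rewrite rhoZ ger0_norm ?invr_ge0// mulVf.
  rewrite (_ : row k E' = row k E)//; apply/rowP => j.
  by rewrite !mxE (negbTE ki).
rewrite dE' normrM [`|_^-1|]gtr0_norm ?invr_gt0// ler_pdivrMl// => h.
rewrite /invmx uE -scalemxAr mxE normrM normfV mulrC ler_pdivrMr//.
apply: le_trans h _; have h2 : sup S <= 2 * `|\det E| by move: EE; lra.
by have := ler_wpM2l (ltW z1) h2; lra.
Qed.

End Auerbach.

(** * Averaged norms on one cell *)

Lemma ler_powR_inv (R : realType) (p a b : R) : 0 < p -> 0 <= a -> 0 <= b ->
  a `^ p <= b `^ p -> a <= b.
Proof.
move=> p0 a0 b0 h; rewrite leNgt; apply/negP => ba.
have := gt0_ltr_powR p0 b0 a0 ba; rewrite ltNge; exact/negP/negPn.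
Qed.

Section NonmeasurableIntegral.
Context (dsp : measure_display) (T : measurableType dsp) (R : realType).
Context (mu : {measure set T -> \bar R}).
Local Open Scope ereal_scope.

Lemma ge0_le_integral_any (A B : set T) (f g : T -> \bar R) :
  A `<=` B -> (forall x, A x -> 0 <= f x) -> (forall x, B x -> 0 <= g x) ->
  (forall x, A x -> f x <= g x) ->
  \int[mu]_(x in A) f x <= \int[mu]_(x in B) g x.
Proof.
move=> AB f0 g0 fg; rewrite !ge0_integralE//.
apply: ge_ereal_sup => _ [h hf <-]; apply: ereal_sup_ubound; exists h => // x.
apply: (le_trans (hf x)); rewrite !patchE; case: ifPn => [/set_mem Ax|_].
  by rewrite mem_set; [exact: fg|exact: AB].
by case: ifPn => // /set_mem Bx; exact: g0.
Qed.

End NonmeasurableIntegral.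

Section NormField.
Context (dsp : measure_display) (T : measurableType dsp) (R : realType).
Context (mu : {measure set T -> \bar R}) (m : nat) (p : R).
Context (G H : T -> 'M[R]_m).
Hypothesis p_ge1 : (1 <= p)%R.
Hypothesis mG : forall i j, measurable_fun [set: T] (fun x => G x i j).
Hypothesis mH : forall i j, measurable_fun [set: T] (fun x => H x i j).
Hypothesis GH : forall x, G x *m H x = 1%:M.

(** The l1 norm is used because the triangle inequality for integrals then holds
one coordinate at a time. *)
Definition nu (x : T) (z : 'rV[R]_m) : R := (\sum_(k < m) `|(z *m G x) 0 k|)%R.

Lemma nu_ge0 x z : (0 <= nu x z)%R. Proof. exact: sumr_ge0. Qed.

Lemma nuZ x c z : nu x (c *: z) = (`|c| * nu x z)%R.
Proof.
rewrite /nu mulr_sumr; apply: eq_bigr => k _.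
by rewrite -scalemxAl mxE normrM.
Qed.

Lemma nu0 x : nu x 0 = 0%R.
Proof. by rewrite -(scale0r (0 : 'rV[R]_m)) nuZ normr0 mul0r. Qed.

Lemma nuD x y z : (nu x (y + z) <= nu x y + nu x z)%R.
Proof.
rewrite /nu -big_split/=; apply: ler_sum => k _.
by rewrite mulmxDl mxE ler_normD.
Qed.

Lemma nu_sum x (I : finType) (F : I -> 'rV[R]_m) :
  (nu x (\sum_i F i)%R <= \sum_i nu x (F i))%R.
Proof.
elim/big_ind2: _ => [|z1 r1 z2 r2 h1 h2|//]; first by rewrite nu0.
by apply: le_trans (nuD _ _ _) _; exact: lerD.
Qed.

Definition vmeas (g : T -> 'rV[R]_m) :=
  forall j, measurable_fun [set: T] (fun y => g y 0 j).

Lemma mulmx_measurable (g : T -> 'rV[R]_m) (A : T -> 'M[R]_m) k : vmeas g ->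
  (forall i j, measurable_fun [set: T] (fun x => A x i j)) ->
  measurable_fun [set: T] (fun y => (g y *m A y) 0 k).
Proof.
move=> mg mA; rewrite (_ : (fun y => _) = (fun y => \sum_j g y 0 j * A y j k)%R).
  by apply: measurable_sum => j; apply: measurable_funM; [exact: mg|exact: mA].
by apply/funext => y; rewrite mxE.
Qed.

Lemma nu_measurable (g : T -> 'rV[R]_m) x : vmeas g ->
  measurable_fun [set: T] (fun y => nu x (g y)).
Proof.
move=> mg; apply: measurable_sum => k; apply: measurableT_comp => //.
by apply: (@mulmx_measurable g (fun=> G x)).
Qed.

Lemma nu_measurable_diag (g : T -> 'rV[R]_m) : vmeas g ->
  measurable_fun [set: T] (fun y => nu y (g y)).
Proof.
move=> mg; apply: measurable_sum => k; apply: measurableT_comp => //.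
exact: mulmx_measurable.
Qed.

Lemma nu_measurable_cst z : measurable_fun [set: T] (fun y => nu y z).
Proof. by apply: nu_measurable_diag => j; exact: measurable_cst. Qed.

Definition nu_inv (x : T) : R := (1 + \sum_k \sum_i `|H x k i|)%R.

Lemma coord_le_nu x (z : 'rV[R]_m) i : (`|z 0 i| <= nu_inv x * nu x z)%R.
Proof.
rewrite -[z in leLHS]mulmx1 -(GH x) mulmxA mxE.
apply: le_trans (ler_norm_sum _ _ _) _; rewrite /nu mulr_sumr.
apply: ler_sum => k _; rewrite normrM mulrC ler_wpM2r//.
rewrite /nu_inv (bigD1 k)//= (bigD1 i)//=.
set A := (\sum_(_ < _ | _) _)%R; set C := (\sum_(_ < _ | _) _)%R.
have A0 : (0 <= A)%R by exact: sumr_ge0.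
have C0 : (0 <= C)%R by apply: sumr_ge0 => l _; exact: sumr_ge0.
lra.
Qed.

Lemma nu_inv_measurable : measurable_fun [set: T] nu_inv.
Proof.
apply: measurable_funD => //; apply: measurable_sum => k.
by apply: measurable_sum => i; exact: measurableT_comp.
Qed.

Definition nu_pow (z : 'rV[R]_m) x : R := nu x z `^ p.

Lemma nu_pow_measurable z : measurable_fun [set: T] (nu_pow z).
Proof.
apply: (measurableT_comp (measurable_powR p)); exact: nu_measurable_cst.
Qed.

Section OneCell.
Local Open Scope ereal_scope.
Context (P : set T) (K : R).
Hypothesis mP : measurable P.
Hypothesis P_gt0 : 0 < mu P.
Hypothesis P_fin : mu P < +oo.
Hypothesis K_ge0 : (0 <= K)%R.
Hypothesis AP : forall g, vmeas g ->
  \int[mu]_(y in P) (nu y (g y) `^ p)%:E < +oo ->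
  \int[mu]_(x in P) (\int[mu]_(y in P) (nu x (g y))%:E) `^ p <=
  (K * fine (mu P) `^ p)%:E * \int[mu]_(y in P) (nu y (g y) `^ p)%:E.

Let fP : mu P \is a fin_num. Proof. by rewrite ge0_fin_numE. Qed.
Let P0 : (0 < fine (mu P))%R. Proof. by rewrite -lte_fin fineK. Qed.
Let p0 : (0 < p)%R. Proof. exact: lt_le_trans p_ge1. Qed.

Lemma sub_fin_num E : measurable E -> E `<=` P -> mu E \is a fin_num.
Proof.
move=> mE EP; rewrite ge0_fin_numE// (le_lt_trans _ P_fin)//.
by rewrite le_measure ?inE.
Qed.

(** Testing the averaging inequality on a vector restricted to [E]. *)
Lemma nu_pow_comparison z E : measurable E -> E `<=` P ->
  \int[mu]_(x in E) (nu_pow z x)%:E < +oo ->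
  (fine (mu E) `^ p)%:E * \int[mu]_(x in P) (nu_pow z x)%:E <=
  (K * fine (mu P) `^ p)%:E * \int[mu]_(x in E) (nu_pow z x)%:E.
Proof.
move=> mE EP finE; have fE := sub_fin_num mE EP.
pose g y := (\1_E y : R) *: z.
have mg : vmeas g.
  move=> j; rewrite (_ : (fun y => _) = (fun y => \1_E y * z 0 j)%R); last first.
    by apply/funext => y; rewrite /g mxE.
  by apply: measurable_funM => //; exact: measurable_indic.
have := AP mg.
have -> : \int[mu]_(y in P) (nu y (g y) `^ p)%:E = \int[mu]_(x in E) (nu_pow z x)%:E.
  rewrite -[in RHS](setIidr EP) integral_mkcondr; apply: eq_integral => y _.
  rewrite patchE /g nuZ indicE; case: (y \in E); first by rewrite normr1 mul1r.
  by rewrite normr0 mul0r powR0 ?gt_eqF.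
move=> /(_ finE).
have -> : \int[mu]_(x in P) (\int[mu]_(y in P) (nu x (g y))%:E) `^ p =
   \int[mu]_(x in P) ((fine (mu E) `^ p)%:E * (nu_pow z x)%:E).
  apply: eq_integral => x _.
  have -> : \int[mu]_(y in P) (nu x (g y))%:E = \int[mu]_(y in P) ((nu x z)%:E * (\1_E y)%:E).
    apply: eq_integral => y _; rewrite /g nuZ -EFinM mulrC indicE.
    by case: (y \in E); rewrite ?normr1 ?normr0.
  rewrite ge0_integralZl_EFin//; last 2 first.
  - by apply/measurable_EFinP; exact: measurable_funTS.
  - exact: nu_ge0.
  rewrite integral_indic// setIidl// -(fineK fE) -EFinM poweR_EFin.
  by rewrite powRM ?nu_ge0// /nu_pow mulrC EFinM.
rewrite ge0_integralZl_EFin//.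
- by move=> x _; rewrite lee_fin powR_ge0.
- by apply/measurable_EFinP; apply: measurable_funTS; exact: nu_pow_measurable.
Qed.

Lemma sublevel_pos (f : T -> R) : measurable_fun [set: T] f ->
  exists n : nat, 0 < mu (P `&` [set x | (f x <= n%:R)%R]).
Proof.
move=> mf; apply: contrapT => /forallNP h.
have mF n : measurable (P `&` [set x | (f x <= n%:R)%R]).
  apply: measurableI => //; rewrite (_ : [set x | _] = f @^-1` `]-oo, n%:R]).
    by rewrite -[X in measurable X]setTI; exact: mf.
  by apply/seteqP; split => x /=; rewrite in_itv.
have : mu P <= \sum_(n <oo) mu (P `&` [set x | (f x <= n%:R)%R]).
  apply: measure_sigma_subadditive => // x Px.
  exists (Num.bound `|f x|%R) => //; split => //=.
  by apply: le_trans (ler_norm _) _; apply/ltW/archi_boundP.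
rewrite eseries0; last by move=> n _ _; apply/eqP; rewrite eq_le measure_ge0 andbT leNgt; exact/negP/h.
by rewrite leNgt P_gt0.
Qed.

(** On a part of [P] of positive measure the norm is bounded, and the comparison
passes this finiteness to the whole cell. *)
Lemma nu_pow_fin z : \int[mu]_(x in P) (nu_pow z x)%:E \is a fin_num.
Proof.
rewrite ge0_fin_numE; last by apply: integral_ge0 => x _; rewrite lee_fin powR_ge0.
have [n] := sublevel_pos (nu_measurable_cst z).
set E := P `&` _ => E0.
have mE : measurable E.
  apply: measurableI => //; rewrite (_ : [set x | _] = (nu ^~ z) @^-1` `]-oo, n%:R]).
    by rewrite -[X in measurable X]setTI; exact: nu_measurable_cst.
  by apply/seteqP; split => x /=; rewrite in_itv.
have EP : E `<=` P by move=> x [].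
have fE := sub_fin_num mE EP.
have Ele : \int[mu]_(x in E) (nu_pow z x)%:E <= (n%:R `^ p)%:E * mu E.
  rewrite -integral_cst//; apply: ge0_le_integral => //.
  - by move=> x _; rewrite lee_fin powR_ge0.
  - by apply/measurable_EFinP; apply: measurable_funTS; exact: nu_pow_measurable.
  - by move=> x [_ h]; rewrite lee_fin ge0_ler_powR// ?nnegrE ?nu_ge0 ?(ltW p0).
have Efin : \int[mu]_(x in E) (nu_pow z x)%:E < +oo.
  by apply: (le_lt_trans Ele); rewrite -(fineK fE) -EFinM ltry.
have := nu_pow_comparison mE EP Efin.
rewrite ltNge leye_eq => h; apply/negP => /eqP iE; move: h; rewrite iE.
rewrite gt0_muley ?lte_fin ?powR_gt0//; last by rewrite -lte_fin fineK.
rewrite leye_eq; apply/negP; rewrite -ltey.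
by rewrite lte_mul_pinfty ?lee_fin ?mulr_ge0 ?powR_ge0.
Qed.

(** The norm of [x |-> nu x z] in the Lebesgue space of exponent [p] over [P] with
normalized measure: a norm on vectors adapted to the cell. *)
Definition rho z : R :=
  ((fine (\int[mu]_(x in P) (nu_pow z x)%:E) / fine (mu P)) `^ p^-1)%R.

Lemma rho_ge0 z : (0 <= rho z)%R. Proof. exact: powR_ge0. Qed.

Lemma int_nu_pow_ge0 z : (0 <= fine (\int[mu]_(x in P) (nu_pow z x)%:E))%R.
Proof. by apply: fine_ge0; apply: integral_ge0 => x _; rewrite lee_fin powR_ge0. Qed.

Lemma rho_powR z : \int[mu]_(x in P) (nu_pow z x)%:E = (rho z `^ p)%:E * mu P.
Proof.
rewrite /rho -powRrM mulVf ?gt_eqF// powRr1 ?divr_ge0 ?int_nu_pow_ge0 ?(ltW P0)//.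
by rewrite -[in RHS](fineK fP) -EFinM divfK ?gt_eqF// fineK// nu_pow_fin.
Qed.

Lemma rho_le z c : (0 <= c)%R ->
  \int[mu]_(x in P) (nu_pow z x)%:E <= (c `^ p)%:E * mu P -> (rho z <= c)%R.
Proof.
move=> c0; rewrite rho_powR -(fineK fP) -!EFinM lee_fin ler_pM2r// => h.
exact: (ler_powR_inv p0 (rho_ge0 z)).
Qed.

Lemma int_nu_powZ c z : \int[mu]_(x in P) (nu_pow (c *: z) x)%:E =
  (`|c| `^ p)%:E * \int[mu]_(x in P) (nu_pow z x)%:E.
Proof.
rewrite -ge0_integralZl_EFin//.
- by apply: eq_integral => x _; rewrite /nu_pow nuZ powRM ?nu_ge0// EFinM.
- by move=> x _; rewrite lee_fin powR_ge0.
- by apply/measurable_EFinP; apply: measurable_funTS; exact: nu_pow_measurable.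
Qed.

Lemma rhoZ c z : rho (c *: z) = (`|c| * rho z)%R.
Proof.
transitivity (((`|c| `^ p * fine (\int[mu]_(x in P) (nu_pow z x)%:E)) / fine (mu P)) `^ p^-1)%R.
  congr ((_ / _) `^ _)%R; transitivity (fine ((`|c| `^ p)%:E * \int[mu]_(x in P) (nu_pow z x)%:E)).
    by congr fine; exact: int_nu_powZ.
  by rewrite fineM// nu_pow_fin.
rewrite -mulrA powRM ?powR_ge0 ?divr_ge0 ?int_nu_pow_ge0 ?(ltW P0)//.
by rewrite -powRrM mulfV ?gt_eqF// powRr1.
Qed.

(** On a part of [P] of positive measure [nu_inv] is bounded, so that [nu x]
dominates coordinates uniformly there. *)
Lemma rho_ge : exists2 B, (0 <= B)%R & forall (z : 'rV[R]_m) (i : 'I_m),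
  (`|z 0 i| <= B * rho z)%R.
Proof.
have [n] := sublevel_pos nu_inv_measurable.
set E := P `&` _ => E0.
have mE : measurable E.
  apply: measurableI => //; rewrite (_ : [set x | _] = nu_inv @^-1` `]-oo, n%:R]).
    by rewrite -[X in measurable X]setTI; exact: nu_inv_measurable.
  by apply/seteqP; split => x /=; rewrite in_itv.
have EP : E `<=` P by move=> x [].
have fE := sub_fin_num mE EP.
have E0' : (0 < fine (mu E))%R by rewrite -lte_fin fineK.
exists (n%:R * (fine (mu P) / fine (mu E)) `^ p^-1)%R.
  by rewrite mulr_ge0// powR_ge0.
move=> z i.
have h : ((`|z 0 i| `^ p)%:E * mu E <= (n%:R `^ p)%:E * \int[mu]_(x in P) (nu_pow z x)%:E).
  rewrite -ge0_integralZl_EFin//; last 2 first.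
  - by move=> x _; rewrite lee_fin powR_ge0.
  - by apply/measurable_EFinP; apply: measurable_funTS; exact: nu_pow_measurable.
  rewrite -integral_cst//; apply: ge0_le_integral_any => //.
  - by move=> x _; rewrite lee_fin powR_ge0.
  - by move=> x _; rewrite mule_ge0// lee_fin powR_ge0.
  move=> x [_ hx]; rewrite -EFinM lee_fin -powRM ?nu_ge0//.
  rewrite ge0_ler_powR ?nnegrE ?mulr_ge0 ?nu_ge0 ?(ltW p0)//.
  by apply: le_trans (coord_le_nu x z i) _; rewrite ler_wpM2r ?nu_ge0.
have {h} : (`|z 0 i| `^ p * fine (mu E) <= n%:R `^ p * (rho z `^ p * fine (mu P)))%R.
  by rewrite -lee_fin !EFinM !fineK// -rho_powR.
move: E0' P0 (rho_ge0 z).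
move: (rho z) (fine (mu P)) (fine (mu E)) => r a b b0 a0 r0.
rewrite -ler_pdivlMr// => h; apply: (ler_powR_inv p0).
- by [].
- by rewrite !mulr_ge0 ?powR_ge0.
apply: (le_trans h); rewrite [leRHS]powRM ?mulr_ge0 ?powR_ge0// powRM ?powR_ge0//.
rewrite -[(((a / b) `^ _) `^ _)%R]powRrM mulVf ?gt_eqF// powRr1 ?divr_ge0 ?(ltW a0) ?(ltW b0)//.
by rewrite le_eqVlt; apply/orP; left; apply/eqP; ring.
Qed.

Definition near_basis (E : 'M[R]_m) := [/\ E \in unitmx,
  forall i, (rho (row i E) <= 1)%R &
  forall (z : 'rV[R]_m) (i : 'I_m), (`|(z *m invmx E) 0 i| <= 2 * rho z)%R].

Lemma near_basis_exists : exists E, near_basis E.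
Proof.
have [B B0 hB] := rho_ge.
exact: (almost_auerbach rho_ge0 rhoZ B0 hB).
Qed.

End OneCell.
End NormField.

(** * Coordinates in the averaged basis *)

Section BasisAverage.
Context (dsp : measure_display) (T : measurableType dsp) (R : realType).
Context (mu : {measure set T -> \bar R}) (m : nat) (p : R).
Context (G H : T -> 'M[R]_m).
Hypothesis p_ge1 : (1 <= p)%R.
Hypothesis mG : forall i j, measurable_fun [set: T] (fun x => G x i j).
Hypothesis mH : forall i j, measurable_fun [set: T] (fun x => H x i j).
Hypothesis GH : forall x, G x *m H x = 1%:M.
Context (P : set T) (K : R).
Local Open Scope ereal_scope.
Hypothesis mP : measurable P.
Hypothesis P_gt0 : 0 < mu P.
Hypothesis P_fin : mu P < +oo.
Hypothesis K_ge0 : (0 <= K)%R.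
Hypothesis AP : forall g, vmeas g ->
  \int[mu]_(y in P) (nu G y (g y) `^ p)%:E < +oo ->
  \int[mu]_(x in P) (\int[mu]_(y in P) (nu G x (g y))%:E) `^ p <=
  (K * fine (mu P) `^ p)%:E * \int[mu]_(y in P) (nu G y (g y) `^ p)%:E.
Context (u : T -> 'rV[R]_m).
Hypothesis mu_u : vmeas u.
Let F y : \bar R := (nu G y (u y) `^ p)%:E.
Hypothesis F_fin : \int[mu]_(y in P) F y < +oo.

Let fP : mu P \is a fin_num. Proof. by rewrite ge0_fin_numE. Qed.
Let P0 : (0 < fine (mu P))%R. Proof. by rewrite -lte_fin fineK. Qed.
Let p0 : (0 < p)%R. Proof. exact: lt_le_trans p_ge1. Qed.
Let F_fin_num : \int[mu]_(y in P) F y \is a fin_num.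
Proof. by rewrite ge0_fin_numE// integral_ge0// => y _; rewrite lee_fin powR_ge0. Qed.

(** The averaging inequality makes the integral of [nu x u] finite for
some [x], and a single norm [nu x] controls all coordinates. *)
Lemma integrable_coord j : mu.-integrable P (fun y => (u y 0 j)%:E).
Proof.
have [x Px hx] : exists2 x, P x & \int[mu]_(y in P) (nu G x (u y))%:E < +oo.
  apply: contrapT => /forall2NP hn.
  have : \int[mu]_(x in P) (\int[mu]_(y in P) (nu G x (u y))%:E) `^ p < +oo.
    apply: le_lt_trans (AP mu_u F_fin) _; rewrite lte_mul_pinfty ?lee_fin//.
    by rewrite mulr_ge0// powR_ge0.
  rewrite (_ : \int[mu]_(x in P) _ = \int[mu]_(x in P) (cst +oo) x); last first.
    apply: eq_integral => x /set_mem Px; have [//|/negP] := hn x.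
    by rewrite -leNgt leye_eq => /eqP ->; rewrite poweRyr// gt_eqF.
  by rewrite integral_cst// gt0_mulye// ltxx.
have hI : mu.-integrable P (fun y => (nu_inv H x)%:E * (nu G x (u y))%:E).
  apply: integrableZl => //; apply/integrableP; split.
    by apply/measurable_EFinP/measurable_funTS; exact: nu_measurable.
  by under eq_integral do rewrite gee0_abs ?lee_fin ?nu_ge0//.
apply: (le_integrable mP _ _ hI).
  by apply/measurable_EFinP/measurable_funTS; exact: mu_u.
move=> y _; rewrite -EFinM !abse_EFin lee_fin (le_trans (coord_le_nu GH x _ j))//.
exact: ler_norm.
Qed.

Section Weighted.
Context (th : T -> R).
Hypothesis mth : measurable_fun [set: T] th.
Hypothesis th1 : forall y, (`|th y| <= 1)%R.

Definition weighted_mean : 'rV[R]_m :=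
  \row_j Rintegral mu P (fun y => th y * u y 0 j)%R.

Lemma integrable_weighted j : mu.-integrable P (EFin \o (fun y => th y * u y 0 j)%R).
Proof.
apply: (le_integrable mP _ _ (integrable_coord j)).
  apply/measurable_EFinP/measurable_funTS/measurable_funM => //; exact: mu_u.
by move=> y _; rewrite /= lee_fin normrM ler_piMl.
Qed.

Lemma integrable_lin (a : 'I_m -> R) :
  mu.-integrable P (EFin \o (fun y => \sum_j (th y * u y 0 j) * a j)%R).
Proof.
rewrite (_ : EFin \o _ = fun y => \sum_j ((a j)%:E * (EFin \o (fun y => th y * u y 0 j)%R) y)).
  by apply: integrable_sum => // j _; apply: integrableZl => //; exact: integrable_weighted.
by apply/funext => y /=; rewrite -sumEFin; apply: eq_bigr => j _; rewrite -EFinM mulrC.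
Qed.

Lemma weighted_mean_lin (a : 'I_m -> R) :
  (\sum_j weighted_mean 0 j * a j)%R =
  Rintegral mu P (fun y => \sum_j (th y * u y 0 j) * a j)%R.
Proof.
rewrite /Rintegral; transitivity (fine (\sum_j \int[mu]_(y in P)
   ((a j)%:E * (EFin \o (fun y => th y * u y 0 j)%R) y))).
  rewrite -[LHS]/(fine (_%:E)); congr fine; rewrite -sumEFin; apply: eq_bigr => j _.
  rewrite integralZl//; last exact: integrable_weighted.
  rewrite mxE /Rintegral mulrC EFinM fineK//.
  by apply: integrable_fin_num => //; exact: integrable_weighted.
rewrite -integral_sum//.
  congr fine; apply: eq_integral => y _; rewrite -sumEFin; apply: eq_bigr => j _.
  by rewrite /= -EFinM mulrC.
by move=> j; apply: integrableZl => //; exact: integrable_weighted.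
Qed.

(** The triangle inequality for integrals, coordinate by coordinate. *)
Lemma nu_weighted_mean x :
  (nu G x weighted_mean)%:E <= \int[mu]_(y in P) (nu G x (u y))%:E.
Proof.
rewrite /nu -sumEFin.
under eq_integral do rewrite -sumEFin.
rewrite ge0_integral_sum//; last first.
  move=> k; apply/measurable_EFinP/measurable_funTS; apply: measurableT_comp => //.
  by apply: (@mulmx_measurable _ _ _ _ u (fun=> G x)).
apply: lee_sum => k _; rewrite mxE weighted_mean_lin.
rewrite EFin_normr_Rintegral//; last exact: integrable_lin.
apply: (le_trans (le_abse_integral _ mP _)).
  by have /integrableP[] := integrable_lin (fun j => G x j k).
apply: ge0_le_integral_any => // y _; rewrite /= lee_fin mxE.
under eq_bigr do rewrite -mulrA.
by rewrite -mulr_sumr normrM ler_piMl.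
Qed.

(** Duality in disguise: the averaging inequality bounds the size of
every mean of [u] with a bounded factor. *)
Lemma rho_weighted_mean :
  (rho mu p G P weighted_mean <= fine (mu P) *
    (K * (fine (\int[mu]_(y in P) F y) / fine (mu P))) `^ p^-1)%R.
Proof.
have Z0 : (0 <= K * (fine (\int[mu]_(y in P) F y) / fine (mu P)))%R.
  rewrite mulr_ge0// divr_ge0// ?(ltW P0)// fine_ge0// integral_ge0// => y _.
  by rewrite lee_fin powR_ge0.
set Z := (_ `^ _)%R.
have ZE : (Z `^ p = K * (fine (\int[mu]_(y in P) F y) / fine (mu P)))%R.
  by rewrite /Z -powRrM mulVf ?gt_eqF// powRr1.
apply: (rho_le p_ge1 mG mP P_gt0 P_fin K_ge0 AP); first by rewrite mulr_ge0 ?powR_ge0// ltW.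
rewrite powRM ?powR_ge0 ?(ltW P0)// ZE.
apply: (le_trans (y := \int[mu]_(x in P) (\int[mu]_(y in P) (nu G x (u y))%:E) `^ p)).
  apply: ge0_le_integral_any => // x _; first by rewrite lee_fin powR_ge0.
    exact: poweR_ge0.
  rewrite /nu_pow -poweR_EFin; apply: gt0_ler_poweR.
  - exact: ltW.
  - by rewrite in_itv/= lee_fin nu_ge0 leey.
  - by rewrite in_itv/= leey andbT integral_ge0// => y _; rewrite lee_fin nu_ge0.
  - exact: nu_weighted_mean.
apply: (le_trans (AP mu_u F_fin)).
rewrite -/F -{1}(fineK F_fin_num) -{4}(fineK fP) -!EFinM lee_fin le_eqVlt.
apply/orP; left; apply/eqP; field; exact: lt0r_neq0.
Qed.

End Weighted.

(** Testing each coordinate functional of the basis against its own sign. *)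
Lemma near_basis_average (E : 'M[R]_m) : near_basis mu p G P E ->
  \int[mu]_(y in P) (\sum_i `|(u y *m invmx E) 0 i|)%:E <=
  ((2 * m%:R) * (K * (fine (\int[mu]_(y in P) F y) / fine (mu P))) `^ p^-1)%:E * mu P.
Proof.
move=> [_ _ hE]; set Z := (_ `^ _)%R.
under eq_integral do rewrite -sumEFin.
have mE i : measurable_fun [set: T] (fun y => ((u y *m invmx E) 0 i)%R).
  by apply: (@mulmx_measurable _ _ _ _ u (fun=> invmx E)).
rewrite ge0_integral_sum//; last first.
  by move=> i; apply/measurable_EFinP/measurable_funTS; exact: measurableT_comp.
apply: (@le_trans _ _ (\sum_(i < m) (2 * (fine (mu P) * Z))%:E)); last first.
  rewrite sumEFin sumr_const card_ord -(fineK fP) -EFinM lee_fin -mulr_natr le_eqVlt.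
  by apply/orP; left; apply/eqP; rewrite fineK//; ring.
apply: lee_sum => i _.
pose c y := ((u y *m invmx E) 0 i)%R; pose N := [set y | (c y < 0)%R].
have mN : measurable N.
  rewrite (_ : N = c @^-1` `]-oo, 0%R[).
    by rewrite -[X in measurable X]setTI; exact: mE.
  by apply/seteqP; split => y /=; rewrite in_itv.
(* the sign of [c], as a measurable function *)
pose th y := (1 - 2 * \1_N y : R)%R.
have thE y : th y = (if (c y < 0)%R then -1 else 1)%R.
  rewrite /th indicE; case: ifPn => h; first by rewrite mem_set//=; lra.
  by rewrite memNset//=; [lra|exact/negP].
have mth : measurable_fun [set: T] th.
  by apply: measurable_funB => //; apply: measurable_funM => //; exact: measurable_indic.
have th1 y : (`|th y| <= 1)%R by rewrite thE; case: ifP; rewrite ?normrN normr1.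
have e : Rintegral mu P (fun y => `|c y|)%R = ((weighted_mean th *m invmx E) 0 i)%R.
  rewrite mxE (weighted_mean_lin mth th1); apply: eq_Rintegral => y _.
  under eq_bigr do rewrite -mulrA.
  rewrite -mulr_sumr thE; have -> : (\sum_j u y 0 j * invmx E j i = c y)%R by rewrite /c mxE.
  by case: ltP => h; [rewrite ltr0_norm// mulN1r|rewrite ger0_norm// mul1r].
have ic : mu.-integrable P (fun y => `|c y|%:E).
  have := integrable_lin mth th1 (fun j => invmx E j i).
  apply: eq_integrable => // y _ /=; congr EFin.
  under eq_bigr do rewrite -mulrA.
  rewrite -mulr_sumr thE; have -> : (\sum_j u y 0 j * invmx E j i = c y)%R by rewrite /c mxE.
  by case: ltP => h; [rewrite ltr0_norm// mulN1r|rewrite ger0_norm// mul1r].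
rewrite -(fineK (integrable_fin_num mP ic)) lee_fin.
rewrite -[leLHS]/(Rintegral mu P (fun y => `|c y|)%R) e.
apply: le_trans (ler_norm _) _; apply: le_trans (hE _ _) _.
by rewrite ler_pM2l//; exact: rho_weighted_mean.
Qed.

End BasisAverage.

(** * The weak-type bound for nested partitions *)

Lemma geometric_level (R : realType) (a t : R) : 2 <= a ->
  exists n, t < 2 * a ^+ n.+1 /\ (n = 0%N \/ 2 * a ^+ n <= t).
Proof.
move=> a2; have ex : exists n, t < 2 * a ^+ n.+1.
  exists (Num.bound `|t|); apply: le_lt_trans (ler_norm _) _.
  apply: lt_le_trans (archi_boundP (normr_ge0 _)) _.
  set n := Num.bound _.
  have h : n%:R <= a ^+ n :> R.
    apply: (@le_trans _ _ ((2 ^ n)%:R)); first by rewrite ler_nat ltnW// ltn_expl.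
    by rewrite natrX lerXn2r ?nnegrE//; lra.
  apply: le_trans h _; rewrite exprS mulrA ler_peMl ?exprn_ge0//; lra.
have [n ht hmin] := ex_minnP ex; exists n; split => //.
case: n => [|n] in ht hmin *; [by left|right].
by rewrite leNgt; apply/negP => /hmin; rewrite ltnn.
Qed.

Lemma nneseries_geometric_le (R : realType) (c r : R) (f : nat -> \bar R) :
  0 <= c -> 0 <= r < 1 -> (forall n, 0 <= f n)%E ->
  (forall n, f n <= (c * r ^+ n)%:E)%E ->
  (\sum_(n <oo) f n <= (c / (1 - r))%:E)%E.
Proof.
move=> c0 /andP[r0 r1] f0 fle; apply: lime_le.
  by apply: is_cvg_nneseries => n _.
apply: nearW => n; apply: (@le_trans _ _ (\sum_(0 <= i < n) (c * r ^+ i)%:E)%E).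
  by apply: lee_sum.
rewrite sumEFin lee_fin -[leLHS]/(series (geometric c r) n).
rewrite geometric_seriesE ?lt_eqF//= ler_wpM2r ?invr_ge0 ?subr_ge0 ?(ltW r1)//.
by rewrite ler_piMr// lerBlDr lerDl exprn_ge0.
Qed.

Lemma mem_bigsetU (T : Type) (I : finType) (A : I -> set T) y :
  (\big[setU/set0]_i A i) y <-> exists i, A i y.
Proof.
split => [|[i Ai]]; last by rewrite (bigD1 i)//=; left.
elim/big_ind: _ => [//|X Y hX hY [/hX|/hY]//|i _ Ai]; by exists i.
Qed.

Lemma measure_bigsetU_le (dsp : measure_display) (T : measurableType dsp) (R : realType)
    (mu : {measure set T -> \bar R}) (I : Type) (s : seq I) (A : I -> set T) :
  (forall i, measurable (A i)) ->
  (mu (\big[setU/set0]_(i <- s) A i) <= \sum_(i <- s) mu (A i))%E.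
Proof.
move=> mA; elim: s => [|i s IH]; first by rewrite !big_nil measure0.
rewrite !big_cons; apply: le_trans (measureU2 _ _ _) _ => //.
  exact: bigsetU_measurable.
by rewrite leeD2l.
Qed.

Section Assembly.
Context (dsp : measure_display) (T : measurableType dsp) (R : realType).
Context (mu : {measure set T -> \bar R}).
Context (J : countType) (idx : nat -> T -> J) (D : R).
Hypothesis dy : dyadic mu idx D.
Context (m : nat) (p : R) (G H : T -> 'M[R]_m).
Hypothesis m_gt0 : (0 < m)%N.
Hypothesis p_ge1 : (1 <= p)%R.
Hypothesis mG : forall i j, measurable_fun [set: T] (fun x => G x i j).
Hypothesis mH : forall i j, measurable_fun [set: T] (fun x => H x i j).
Hypothesis GH : forall x, G x *m H x = 1%:M.
Context (K : R).
Hypothesis K_ge0 : (0 <= K)%R.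
Local Open Scope ereal_scope.
Hypothesis AP : forall k x0 g, vmeas g ->
  \int[mu]_(y in cell idx k x0) (nu G y (g y) `^ p)%:E < +oo ->
  \int[mu]_(x in cell idx k x0)
      (\int[mu]_(y in cell idx k x0) (nu G x (g y))%:E) `^ p <=
  (K * fine (mu (cell idx k x0)) `^ p)%:E *
    \int[mu]_(y in cell idx k x0) (nu G y (g y) `^ p)%:E.
Context (u : T -> 'rV[R]_m).
Hypothesis mu_u : vmeas u.
Let F y : \bar R := (nu G y (u y) `^ p)%:E.
Hypothesis F_fin : \int[mu]_y F y < +oo.
Context (x0 : T).

Let p0 : (0 < p)%R. Proof. exact: lt_le_trans p_ge1. Qed.
Let mC k x : measurable (cell idx k x). Proof. exact: (dy_meas dy). Qed.
Let C_gt0 k x : 0 < mu (cell idx k x). Proof. exact: (dy_pos dy). Qed.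
Let C_fin k x : mu (cell idx k x) < +oo. Proof. exact: (dy_fin dy). Qed.
Let C0 k x : (0 < fine (mu (cell idx k x)))%R.
Proof. by rewrite -lte_fin fineK// (cell_fin dy). Qed.

Let F0 y : 0 <= F y. Proof. by rewrite lee_fin powR_ge0. Qed.
Let mF : measurable_fun [set: T] F.
Proof.
apply/measurable_EFinP; apply: (measurableT_comp (measurable_powR p)).
exact: nu_measurable_diag.
Qed.

Lemma F_cell_fin k x : \int[mu]_(y in cell idx k x) F y < +oo.
Proof. by apply: le_lt_trans F_fin; exact: ge0_subset_integral. Qed.

(** For a constant test vector the two sides agree up to the factor [K]. *)
Lemma averaging_ge1 : (1 <= K)%R.
Proof.
pose P := cell idx 0 x0.
have mPP : measurable P := mC 0 x0.
have [B B0 hB] := rho_ge p_ge1 mG mH GH mPP (C_gt0 0 x0) (C_fin 0 x0) K_ge0 (@AP 0 x0).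
pose i0 := Ordinal m_gt0; pose z : 'rV[R]_m := delta_mx 0%R i0.
have := hB z i0; rewrite mxE !eqxx normr1 => h.
have r0 : (0 < rho mu p G P z)%R.
  rewrite lt_neqAle rho_ge0 andbT eq_sym; apply/eqP => r0.
  by move: h; rewrite r0 mulr0 ler10.
have fI := nu_pow_fin p_ge1 mG mPP (C_gt0 0 x0) (C_fin 0 x0) K_ge0 (@AP 0 x0) z.
have fI' : \int[mu]_(x in P) (nu_pow p G z x)%:E < +oo by rewrite ltey_eq fI.
have := nu_pow_comparison p_ge1 mG mPP (C_fin 0 x0) (@AP 0 x0) mPP (@subset_refl _ _) fI'.
rewrite (rho_powR p_ge1 mG mPP (C_gt0 0 x0) (C_fin 0 x0) K_ge0 (@AP 0 x0) z).
have fK : (fine (mu P))%:E = mu P by rewrite fineK// (cell_fin dy).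
rewrite -{2 4}fK.
have P0 : (0 < fine (mu P))%R := C0 0 x0.
rewrite -!EFinM lee_fin -mulrA.
set t := (fine (mu P) `^ p * (_ * _))%R; have t0 : (0 < t)%R.
  rewrite /t; apply: mulr_gt0; [exact: powR_gt0|apply: mulr_gt0 => //; exact: powR_gt0].
by rewrite -{1}[t]mul1r ler_pM2r.
Qed.

Let kap := (K * 2 `^ p)%R.

Let kap1 : (1 <= kap)%R.
Proof.
rewrite /kap; have h := averaging_ge1; have : (1 <= 2 `^ p :> R)%R.
  by rewrite -[leLHS](powRr0 2) ler_powR ?ler1n// ltW.
by move=> h2; rewrite -[leLHS]mulr1 ler_pM.
Qed.

(** The case of subsets of at least half of the measure in
[nu_pow_comparison]. *)
Lemma nu_pow_Ainf z k x E : measurable E -> E `<=` cell idx k x ->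
  mu (cell idx k x) <= 2%:E * mu E ->
  \int[mu]_(y in cell idx k x) (nu_pow p G z y)%:E <=
  kap%:E * \int[mu]_(y in E) (nu_pow p G z y)%:E.
Proof.
move=> mE EC half; have fE := sub_fin_num (mC k x) (C_fin k x) mE EC.
have fI := nu_pow_fin p_ge1 mG (mC k x) (C_gt0 k x) (C_fin k x) K_ge0 (@AP k x) z.
have fJ : \int[mu]_(y in E) (nu_pow p G z y)%:E \is a fin_num.
  rewrite ge0_fin_numE; last by apply: integral_ge0 => y _; rewrite lee_fin powR_ge0.
  apply: (@le_lt_trans _ _ (\int[mu]_(y in cell idx k x) (nu_pow p G z y)%:E)).
    by apply: ge0_le_integral_any => // y _; rewrite lee_fin powR_ge0.
  by rewrite -ge0_fin_numE// integral_ge0// => y _; rewrite lee_fin powR_ge0.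
have fJ' : \int[mu]_(y in E) (nu_pow p G z y)%:E < +oo by rewrite ltey_eq fJ.
have := nu_pow_comparison p_ge1 mG (mC k x) (C_fin k x) (@AP k x) mE EC fJ'.
have J0 : (0 <= fine (\int[mu]_(y in E) (nu_pow p G z y)%:E))%R.
  by apply: fine_ge0; apply: integral_ge0 => y _; rewrite lee_fin powR_ge0.
move: half J0; rewrite -(fineK fI) -(fineK fJ) -(fineK fE) -(fineK (cell_fin dy k x)).
rewrite -!EFinM !lee_fin /=.
have := C0 k x; move: (fine (mu (cell idx k x))) (fine (mu E)) => b e.
move: (fine (\int[mu]_(y in E) _)) (fine (\int[mu]_(y in cell idx k x) _)) => j i.
move=> b0 be j0 h.
have e0 : (0 < e)%R by lra.
have ep : (0 < e `^ p)%R by rewrite powR_gt0.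
rewrite -(ler_pM2l ep); apply: (le_trans h).
have : (b `^ p <= 2 `^ p * e `^ p)%R.
  by rewrite -powRM ?(ltW e0)// ge0_ler_powR ?nnegrE ?(ltW p0) ?mulr_ge0 ?(ltW b0) ?(ltW e0).
move=> h2; rewrite /kap -mulrA [leRHS](_ : _ = K * ((2 `^ p * e `^ p) * j))%R; last by ring.
by rewrite ler_wpM2l// ler_wpM2r.
Qed.

(** A function of the cell alone, so that [coef] is constant along fibres. *)
Definition basis (P : set T) : 'M[R]_m := xget 0%R [set E | near_basis mu p G P E].

Lemma basisP k x : near_basis mu p G (cell idx k x) (basis (cell idx k x)).
Proof.
have [E hE] := near_basis_exists p_ge1 mG mH GH (mC k x) (C_gt0 k x) (C_fin k x) K_ge0 (@AP k x).
by rewrite /basis; case: xgetP => [E' -> //|/(_ E)].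
Qed.

Definition coef k x y : \bar R :=
  (\sum_i `|(u y *m invmx (basis (cell idx k x))) 0%R i|)%:E.

Lemma coef_eq k x y : idx k x = idx k y -> coef k x = coef k y.
Proof. by move=> e; rewrite /coef (cell_eq e). Qed.

Lemma coef_measurable k x : measurable_fun [set: T] (coef k x).
Proof.
apply/measurable_EFinP; apply: measurable_sum => i; apply: measurableT_comp => //.
by apply: (@mulmx_measurable _ _ _ _ u (fun=> invmx _)).
Qed.

Lemma coef_ge0 k x y : 0 <= coef k x y.
Proof. by rewrite lee_fin sumr_ge0. Qed.

Definition mean_F k x : R :=
  (fine (\int[mu]_(y in cell idx k x) F y) / fine (mu (cell idx k x)))%R.

Lemma mean_F_ge0 k x : (0 <= mean_F k x)%R.
Proof. by rewrite divr_ge0// fine_ge0// integral_ge0. Qed.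

Lemma coef_int_le k x : \int[mu]_(y in cell idx k x) coef k x y <=
  (2 * m%:R * (K * mean_F k x) `^ p^-1)%:E * mu (cell idx k x).
Proof.
exact: (near_basis_average p_ge1 mG GH (mC k x) (C_gt0 k x) (C_fin k x) K_ge0
  (@AP k x) mu_u (F_cell_fin k x) (basisP k x)).
Qed.

Lemma coef_fin k x : \int[mu]_(y in cell idx k x) coef k x y < +oo.
Proof.
apply: le_lt_trans (coef_int_le k x) _.
by rewrite -(fineK (cell_fin dy k x)) -EFinM ltry.
Qed.

Lemma coef_own_avg k x :
  (own_avg mu idx coef k x <= 2 * m%:R * (K * mean_F k x) `^ p^-1)%R.
Proof.
have := coef_int_le k x; rewrite (own_avgE dy coef_ge0 coef_fin).
by rewrite -(fineK (cell_fin dy k x)) -!EFinM lee_fin ler_pM2r.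
Qed.

(** Expand [u z] in the basis of the cell and keep the largest basis vector at
[y]: the dependence on the two points separates. *)
Lemma nu_le_coef k x y : exists i : 'I_m, forall z,
  (nu G y (u z))%:E <= (nu G y (row i (basis (cell idx k x))))%:E * coef k x z.
Proof.
have [uE _ _] := basisP k x; set E := basis _ in uE *.
case: (arg_maxP (fun i => nu G y (row i E)) (erefl true : xpredT (Ordinal m_gt0))) => i _ imax.
exists i => z; rewrite -EFinM lee_fin.
have uzE : u z = (\sum_j (u z *m invmx E) 0 j *: row j E)%R.
  by rewrite -mulmx_sum_row mulmxKV.
rewrite [in leLHS]uzE.
apply: le_trans (nu_sum _ _ _) _; rewrite mulr_sumr; apply: ler_sum => j _.
by rewrite nuZ [leRHS]mulrC; apply: ler_wpM2l => //; exact: imax.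
Qed.

Context (al : R).
Hypothesis al_gt0 : (0 < al)%R.

Definition threshold : R := (al `^ p / ((4 * m%:R) `^ p * K))%R.

Let K_gt0 : (0 < K)%R. Proof. exact: lt_le_trans averaging_ge1. Qed.
Let m4 : (0 < 4 * m%:R :> R)%R. Proof. by rewrite mulr_gt0// ltr0n. Qed.

Lemma threshold_gt0 : (0 < threshold)%R.
Proof. by rewrite divr_gt0 ?mulr_gt0 ?powR_gt0. Qed.

(** Where the average over some cell is large, the principal cell above it has
a basis vector that is large at the point, relative to the mean of [F]. *)
Lemma large_average_principal k x :
  al%:E * mu (cell idx k x) < \int[mu]_(y in cell idx k x) (nu G x (u y))%:E ->
  let l := principal mu idx coef k x in
  exists i, (threshold < nu_pow p G (row i (basis (cell idx l x))) x * mean_F l x)%R.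
Proof.
move=> hal l; have [i hi] := nu_le_coef l x x; exists i.
set V := nu G x (row i _) in hi.
have V0 : (0 <= V)%R by exact: nu_ge0.
have h1 : al%:E * mu (cell idx k x) <
    V%:E * ((2 * own_avg mu idx coef l x)%:E * mu (cell idx k x)).
  apply: lt_le_trans hal _.
  apply: (@le_trans _ _ (\int[mu]_(y in cell idx k x) (V%:E * coef l x y))).
    apply: ge0_le_integral_any => // y _; first by rewrite lee_fin nu_ge0.
    by rewrite mule_ge0 ?coef_ge0 ?lee_fin.
  rewrite ge0_integralZl_EFin//.
  - rewrite lee_wpmul2l ?lee_fin//.
    exact: (principal_light dy coef_ge0 coef_fin).
  - by move=> y _; exact: coef_ge0.
  - by apply: measurable_funTS; exact: coef_measurable.
have h2 : (al < V * (2 * own_avg mu idx coef l x))%R.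
  move: h1; rewrite -(fineK (cell_fin dy k x)) -!EFinM lte_fin mulrA.
  by rewrite ltr_pM2r.
have h3 : (al < 4 * m%:R * V * (K * mean_F l x) `^ p^-1)%R.
  apply: lt_le_trans h2 _; have := ler_wpM2l V0 (coef_own_avg l x); lra.
have Z0 : (0 <= K * mean_F l x)%R by rewrite mulr_ge0 ?mean_F_ge0.
have := gt0_ltr_powR p0 (ltW al_gt0) _ h3.
rewrite nnegrE !mulr_ge0 ?(ltW m4) ?powR_ge0// => /(_ isT).
rewrite powRM ?powR_ge0 ?mulr_ge0 ?(ltW m4)// powRM ?(ltW m4)//.
rewrite -powRrM mulVf ?gt_eqF// powRr1// => h4.
rewrite /threshold ltr_pdivrMr ?mulr_gt0 ?powR_gt0//.
by apply: lt_le_trans h4 _; rewrite /nu_pow -/V le_eqVlt; apply/orP; left; apply/eqP; ring.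
Qed.

Let a := (2 * D)%R.
Let a_ge2 : (2 <= a)%R. Proof. by rewrite /a; have := dyadic_ge1 dy x0; lra. Qed.
Let a_gt0 : (0 < a)%R. Proof. exact: lt_le_trans a_ge2. Qed.

(** The lower bound on the mean is the half of the sorting that bounds the total
measure of a class. *)
Definition mean_class n k x := (threshold / (2 * a ^+ n.+1) < mean_F k x)%R.

(** At level 0 there is no lower bound to exploit and the whole cell is kept. *)
Definition large_part n k x : set T := [set y | cell idx k x y /\
  (n = 0%N \/ exists i, (2 * a ^+ n <= nu_pow p G (row i (basis (cell idx k x))) y)%R)].

Lemma large_part_eq n k x y : idx k x = idx k y -> large_part n k x = large_part n k y.
Proof. by move=> e; rewrite /large_part (cell_eq e). Qed.

Let level i n k x := [set y | cell idx k x y /\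
  (2 * a ^+ n <= nu_pow p G (row i (basis (cell idx k x))) y)%R].

Let level_meas : forall i n k x, measurable (level i n k x).
Proof.
move=> i n k x; rewrite /level; set z := row i _.
rewrite (_ : [set y | _] = cell idx k x `&` (nu_pow p G z @^-1` `[(2 * a ^+ n)%R, +oo[)).
  apply: measurableI => //; rewrite -[X in measurable X]setTI.
  exact: (nu_pow_measurable p mG z).
by apply/seteqP; split => y /= [? h]; split => //; move: h; rewrite /= in_itv/= andbT.
Qed.

Lemma large_partE n k x : large_part n.+1 k x = \big[setU/set0]_(i < m) level i n.+1 k x.
Proof.
apply/seteqP; split => y.
  by move=> [cy [//|[i hi]]]; apply/mem_bigsetU; exists i.
by move=> /mem_bigsetU[i [cy hi]]; split => //; right; exists i.
Qed.

Lemma large_part_measurable n k x : measurable (large_part n k x).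
Proof.
case: n => [|n]; last by rewrite large_partE; apply: bigsetU_measurable.
rewrite (_ : large_part 0 k x = cell idx k x)//.
by apply/seteqP; split => y; [move=> []|move=> cy; split => //; left].
Qed.

(** The distribution estimate for each basis vector, whose norm has [p]-th powers
of average at most 1. *)
Lemma large_part_le n k x : mu (large_part n k x) <=
  (m%:R * (a ^- n * (1 - kap^-1) ^+ n))%:E * mu (cell idx k x).
Proof.
case: n => [|n].
  rewrite !expr0 invr1 !mulr1 (_ : large_part 0 k x = cell idx k x).
    by rewrite -[leLHS]mul1e lee_wpmul2r// lee_fin ler1n.
  by apply/seteqP; split => y; [move=> []|move=> cy; split => //; left].
rewrite large_partE; apply: (@le_trans _ _ (\sum_(i < m) mu (level i n.+1 k x))).
  exact: measure_bigsetU_le.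
apply: (@le_trans _ _ (\sum_(i < m)
    ((a ^- n.+1 * (1 - kap^-1) ^+ n.+1)%:E * mu (cell idx k x)))).
  apply: lee_sum => i _; set z := row i (basis (cell idx k x)).
  apply: (Ainf_distribution dy (nu_pow_measurable p mG z)) => //.
  - by move=> y; exact: powR_ge0.
  - by move=> j y E; exact: nu_pow_Ainf.
  rewrite (rho_powR p_ge1 mG (mC k x) (C_gt0 k x) (C_fin k x) K_ge0 (@AP k x) z).
  rewrite -[leRHS]mul1e lee_wpmul2r// lee_fin.
  have [_ h _] := basisP k x.
  have -> : 1%R = (1 `^ p)%R :> R by rewrite powR1.
  by rewrite ge0_ler_powR ?nnegrE ?rho_ge0 ?(ltW p0)//; exact: h.
rewrite -(fineK (cell_fin dy k x)); under eq_bigr do rewrite -EFinM.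
rewrite sumEFin sumr_const card_ord -EFinM lee_fin -mulr_natl le_eqVlt.
by apply/orP; left; apply/eqP; ring.
Qed.

Lemma mean_class_pred n : cell_pred idx (mean_class n).
Proof. by move=> k x y e; rewrite /mean_class /mean_F (cell_eq e). Qed.

Let lev_gt0 n : (0 < threshold / (2 * a ^+ n.+1))%R.
Proof. by rewrite divr_gt0 ?threshold_gt0// mulr_gt0// exprn_gt0. Qed.

(** The weak-type inequality for the function [F]. *)
Lemma mean_class_le n :
  (threshold / (2 * a ^+ n.+1))%:E * mu (stopped (mean_class n)) <= \int[mu]_y F y.
Proof.
apply: (@le_trans _ _ (\int[mu]_(y in stopped (mean_class n)) F y)).
  apply: (stopped_weak_type dy (@mean_class_pred n)) => //.
    exact/ltW/lev_gt0.
  move=> k x; rewrite /mean_class /mean_F /heavy ltr_pdivlMr//.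
  rewrite -lte_fin EFinM !fineK ?(cell_fin dy)//.
  by rewrite ge0_fin_numE ?F_cell_fin// integral_ge0.
apply: ge0_subset_integral => //.
exact: (stopped_measurable dy (@mean_class_pred n)).
Qed.

(** [4 m] combines the doubled averages of principal cells with the factor [2 m]
of [near_basis_average]; [2 `^ p] is the one in [kap]. *)
Definition weak_const : R := (8 * m%:R * D * (4 * m%:R) `^ p * 2 `^ p)%R.

(** One factor [K] comes from [threshold], the other one from the sum of the
geometric series over the classes. *)
Theorem dyadic_weak_type : exists S : set T, [/\ measurable S,
  forall k x, al%:E * mu (cell idx k x) <
    \int[mu]_(y in cell idx k x) (nu G x (u y))%:E -> S x &
  mu S <= (weak_const * K ^+ 2 / al `^ p)%:E * \int[mu]_y F y].
Proof.
pose S n := [set x | exists k, [/\ principal mu idx coef k x = k,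
  mean_class n k x & large_part n k x x]].
pose I := fine (\int[mu]_y F y).
have IE : \int[mu]_y F y = I%:E by rewrite fineK// ge0_fin_numE// integral_ge0.
have I0 : (0 <= I)%R by rewrite fine_ge0// integral_ge0.
have kap0 : (0 < kap)%R by exact: lt_le_trans kap1.
have r0 : (0 <= 1 - kap^-1)%R by rewrite subr_ge0 invf_le1.
have hS n : measurable (S n) /\ mu (S n) <=
    ((2 * (m%:R * (a ^- n * (1 - kap^-1) ^+ n)))%:E * mu (stopped (mean_class n))).
  apply: (sparse_measure_le dy coef_eq coef_measurable coef_ge0 coef_fin).
  - exact: mean_class_pred.
  - exact: large_part_eq.
  - exact: large_part_measurable.
  - by rewrite !mulr_ge0 ?exprn_ge0// invr_ge0 exprn_ge0// ltW.
  - by move=> k x _ _; exact: large_part_le.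
have mS n : measurable (S n) by exact: (hS n).1.
exists (\bigcup_n S n); split; first exact: bigcup_measurable.
  move=> k x hal; have /= := large_average_principal hal.
  set l := principal _ _ _ _ _ => -[i hi].
  have Z0 : (0 < mean_F l x)%R.
    rewrite lt_neqAle mean_F_ge0 andbT eq_sym; apply/eqP => Z0.
    by move: hi; rewrite Z0 mulr0 ltNge ltW// threshold_gt0.
  (* the level of the basis vector at [x] fixes the class of the principal cell *)
  have [n [hn hn']] := geometric_level (threshold / mean_F l x)%R a_ge2.
  exists n => //; exists l; split.
  - exact: principal_idem.
  - rewrite /mean_class ltr_pdivrMr ?mulr_gt0 ?exprn_gt0// mulrC.
    by rewrite -ltr_pdivrMr.
  - split; first by [].
    case: hn' => [->|hn']; [by left|right; exists i].
    by apply: (le_trans hn'); rewrite ler_pdivrMr// ltW.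
apply: (@le_trans _ _ (\sum_(n <oo) mu (S n))).
  by apply: measure_sigma_subadditive => //; exact: bigcup_measurable.
have muS n : mu (S n) <=
    ((4 * m%:R * a * I / threshold) * (1 - kap^-1) ^+ n)%:E.
  have := mean_class_le n; rewrite IE => hn.
  have fst : mu (stopped (mean_class n)) \is a fin_num.
    rewrite ge0_fin_numE// ltNge leye_eq; apply/negP => /eqP e.
    by move: hn; rewrite e gt0_muley ?lte_fin ?lev_gt0// leye_eq.
  apply: (le_trans (hS n).2); move: hn; rewrite -(fineK fst) -!EFinM !lee_fin.
  move: (fine _) => s; rewrite mulrC -ler_pdivlMr ?lev_gt0// => hs.
  apply: (@le_trans _ _ (2 * (m%:R * (a ^- n * (1 - kap^-1) ^+ n)) *
     (I / (threshold / (2 * a ^+ n.+1))))%R).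
    rewrite ler_wpM2l// !mulr_ge0 ?exprn_ge0// invr_ge0 exprn_ge0// ltW//.
  rewrite le_eqVlt; apply/orP; left; apply/eqP; rewrite exprS; field.
  by rewrite !gt_eqF ?threshold_gt0 ?exprn_gt0.
apply: (le_trans (nneseries_geometric_le _ _ _ muS)) => //.
- apply: divr_ge0; last exact/ltW/threshold_gt0.
  apply: mulr_ge0 => //; apply: mulr_ge0; last exact: ltW.
  by rewrite mulr_ge0.
- by rewrite r0 ltrBlDr ltrDl invr_gt0.
rewrite IE -EFinM lee_fin le_eqVlt; apply/orP; left; apply/eqP.
rewrite /threshold /weak_const /kap /a; field.
by rewrite !gt_eqF ?powR_gt0// ?mulr_gt0 ?powR_gt0//; lra.
Qed.

End Assembly.

(** * Lebesgue measure of boxes *)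

Section BoxMeasure.
Context (R : realType) (d : nat).
Notation leb := (@leb R d).

(** Indicator of a product of sets after integration over the coordinates in
[s]; it interpolates between indicators and volumes. *)
Definition mixed (s : seq 'I_d) (I : 'I_d -> set R) (x : 'I_d -> R) : R :=
  \prod_i (if i \in s then fine (lebesgue_measure (I i)) else \1_(I i) (x i)).

Definition upd (x : 'I_d -> R) (j : 'I_d) (t : R) (i : 'I_d) : R :=
  if i == j then t else x i.

Lemma mixed_ge0 s I x : 0 <= mixed s I x.
Proof.
by apply: prodr_ge0 => i _; case: ifP => _; [exact: fine_ge0|rewrite indicE].
Qed.

Lemma mixed_upd s I x j t : j \notin s -> mixed s I (upd x j t) =
  \1_(I j) t * \prod_(i | i != j)
     (if i \in s then fine (lebesgue_measure (I i)) else \1_(I i) (x i)).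
Proof.
move=> js; rewrite /mixed (bigD1 j)//= (negbTE js) /upd eqxx; congr (_ * _).
by apply: eq_bigr => i /negbTE ->.
Qed.

Lemma integral_mixed s I x j : j \notin s -> measurable (I j) ->
  lebesgue_measure (I j) \is a fin_num ->
  (\int[lebesgue_measure]_t (mixed s I (upd x j t))%:E = (mixed (j :: s) I x)%:E)%E.
Proof.
move=> js mI fI; set C := \prod_(i | i != j)
     (if i \in s then fine (lebesgue_measure (I i)) else \1_(I i) (x i)).
have C0 : 0 <= C.
  by apply: prodr_ge0 => i _; case: ifP => _; [exact: fine_ge0|rewrite indicE].
under eq_integral do rewrite mixed_upd// -/C mulrC EFinM.
rewrite ge0_integralZl_EFin//; last first.
  by apply/measurable_EFinP; exact: measurable_indic.
rewrite integral_indic// setIT -[X in (_ * X)%E](fineK fI) -EFinM; congr EFin.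
rewrite mulrC /mixed (bigD1 j)//= inE eqxx/=; congr (_ * _).
by apply: eq_bigr => i /negbTE ij; rewrite inE ij.
Qed.

Lemma mixed_measurable s I x j : j \notin s -> measurable (I j) ->
  measurable_fun [set: R] (fun t => mixed s I (upd x j t)).
Proof.
move=> js mI; under eq_fun do rewrite mixed_upd//.
by apply: measurable_funM => //; exact: measurable_indic.
Qed.

(** A cover of a product by products gives an inequality between indicators;
integrating one coordinate after the other turns it into one between volumes. *)
Lemma mixed_cover (I0 : 'I_d -> set R) (I : nat -> 'I_d -> set R) (c : nat -> R) s :
  (forall i, measurable (I0 i) /\ lebesgue_measure (I0 i) \is a fin_num) ->
  (forall k i, measurable (I k i) /\ lebesgue_measure (I k i) \is a fin_num) ->
  (forall k, 0 <= c k) ->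
  (forall x, (forall i, I0 i (x i)) -> exists2 k, c k = 1 & forall i, I k i (x i)) ->
  uniq s -> forall x,
  ((mixed s I0 x)%:E <= \sum_(k <oo) (c k * mixed s (I k) x)%:E)%E.
Proof.
move=> h0 h c0 cov; elim: s => [_ x|j s IH /andP[js us] x].
  have [Ix|nIx] := pselect (forall i, I0 i (x i)).
    have [k ck Ik] := cov x Ix.
    have one J : (forall i, J i (x i)) -> mixed [::] J x = 1.
      by move=> Jx; rewrite /mixed big1// => i _; rewrite indicE mem_set.
    rewrite one//; apply: le_trans (nneseries_lim_ge k.+1 _); last first.
      by move=> i _; rewrite lee_fin mulr_ge0// mixed_ge0.
    rewrite big_nat_recr//= -[leLHS]add0e leeD//.
      by apply: sume_ge0 => i _; rewrite lee_fin mulr_ge0// mixed_ge0.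
    by rewrite ck mul1r one.
  have [i nI] : exists i, ~ I0 i (x i) by apply: contrapT => /forallNP h'; apply: nIx => i; apply: contrapT; exact: h'.
  rewrite [mixed _ I0 x]/mixed (bigD1 i)//= indicE memNset// mul0r.
  by apply: nneseries_ge0 => k _ _; rewrite lee_fin mulr_ge0// mixed_ge0.
rewrite -integral_mixed//; [|exact: (h0 j).1|exact: (h0 j).2].
have -> : (\sum_(k <oo) (c k * mixed (j :: s) (I k) x)%:E =
  \int[lebesgue_measure]_t \sum_(k <oo) (c k * mixed s (I k) (upd x j t))%:E)%E.
  rewrite integral_nneseries//; last 2 first.
  - move=> k; apply/measurable_EFinP; apply: measurable_funM => //.
    by apply: mixed_measurable => //; exact: (h k j).1.
  - by move=> k t _; rewrite lee_fin mulr_ge0// mixed_ge0.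
  apply: eq_eseriesr => k _; under eq_integral do rewrite EFinM.
  rewrite ge0_integralZl_EFin//.
  - by rewrite integral_mixed//; [exact: (h k j).1|exact: (h k j).2].
  - by move=> t _; rewrite lee_fin mixed_ge0.
  - by apply/measurable_EFinP; apply: mixed_measurable => //; exact: (h k j).1.
apply: ge0_le_integral => //.
- by move=> t _; rewrite lee_fin mixed_ge0.
- by apply/measurable_EFinP; apply: mixed_measurable => //; exact: (h0 j).1.
- apply: ge0_emeasurable_sum => k; first by move=> t _ _; rewrite lee_fin mulr_ge0// mixed_ge0.
  move=> _; apply/measurable_EFinP; apply: measurable_funM => //.
  by apply: mixed_measurable => //; exact: (h k j).1.
- by move=> t _; exact: IH.
Qed.

Lemma mixed_full I x :
  mixed (enum 'I_d) I x = \prod_i fine (lebesgue_measure (I i)).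
Proof. by apply: eq_bigr => i _; rewrite mem_enum. Qed.

Lemma fine_itv_length (a b : R) (b1 b2 : bool) :
  fine (lebesgue_measure [set` Interval (BSide b1 a) (BSide b2 b)]) = Num.max 0 (b - a).
Proof.
rewrite lebesgue_measure_itv/= lte_fin; case: ltP => ab.
  by rewrite -EFinB/= max_r// subr_ge0 ltW.
by rewrite max_l// subr_le0.
Qed.

Lemma itv_fin (a b : R) (b1 b2 : bool) :
  lebesgue_measure [set` Interval (BSide b1 a) (BSide b2 b)] \is a fin_num.
Proof. by rewrite lebesgue_measure_itv/=; case: ifP. Qed.

Definition cobox (a b : 'rV[R]_d) : set (Rd R d) :=
  [set x | forall i, a 0 i <= x 0 i < b 0 i].

Lemma leb_box_le (a b : 'rV[R]_d) : (leb (box a b) <= (box_vol a b)%:E)%E.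
Proof.
apply: ereal_inf_lbound; exists [set 0%N], (fun=> (a, b)); split.
  by move=> x xab; exists 0%N.
by rewrite esum_set1// box_vol_ge0.
Qed.

(** The case of all coordinates in [mixed_cover]: countable covers cannot beat
the volume. *)
Lemma leb_cobox_ge (a b : 'rV[R]_d) : ((box_vol a b)%:E <= leb (cobox a b))%E.
Proof.
apply: le_ereal_inf_tmp => _ [D [F [cF ->]]].
pose I0 i : set R := [set` Interval (BLeft (a 0 i)) (BLeft (b 0 i))].
pose I k i : set R := [set` Interval (BLeft ((F k).1 0 i)) (BRight ((F k).2 0 i))].
pose c k : R := (k \in D)%:R.
have := @mixed_cover I0 I c (enum 'I_d) _ _ _ _ (enum_uniq _) (fun=> 0).
rewrite mixed_full (_ : \prod_i _ = box_vol a b); last first.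
  by apply: eq_bigr => i _; rewrite fine_itv_length.
rewrite (_ : \sum_(k <oo) _ = \esum_(k in D) (box_vol (F k).1 (F k).2)%:E)%E; last first.
  rewrite -[D in RHS]set_mem_set -nneseries_esum; last by move=> *; exact: box_vol_ge0.
  rewrite [in RHS]eseries_mkcond; apply: eq_eseriesr => k _.
  rewrite /c mixed_full; case: (k \in D); last by rewrite mul0r.
  by rewrite mul1r; congr EFin; apply: eq_bigr => i _; rewrite fine_itv_length.
apply.
- by move=> i; split; [exact: measurable_itv|exact: itv_fin].
- by move=> k i; split; [exact: measurable_itv|exact: itv_fin].
- by move=> k; rewrite /c.
- move=> x Ix; have [k Dk xk] : (\bigcup_(k in D) box (F k).1 (F k).2) (\row_i x i).
    by apply: cF => i; move: (Ix i); rewrite mxE /I0/= in_itv/=.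
  exists k; first by rewrite /c mem_set.
  by move=> i; move: (xk i); rewrite mxE /I/= in_itv/=.
Qed.

Lemma cobox_box (a b : 'rV[R]_d) : cobox a b `<=` box a b.
Proof. by move=> x h i; have /andP[-> /ltW] := h i. Qed.

Lemma leb_box (a b : 'rV[R]_d) : leb (box a b) = (box_vol a b)%:E.
Proof.
apply/eqP; rewrite eq_le leb_box_le/= (le_trans (leb_cobox_ge a b))//.
by apply: le_lebesgue_outer; exact: cobox_box.
Qed.

Lemma leb_cobox (a b : 'rV[R]_d) : leb (cobox a b) = (box_vol a b)%:E.
Proof.
apply/eqP; rewrite eq_le leb_cobox_ge andbT (le_trans _ (leb_box_le a b))//.
by apply: le_lebesgue_outer; exact: cobox_box.
Qed.

Lemma box_vol_split (a b : 'rV[R]_d) (i : 'I_d) (c : R) :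
  box_vol a (\row_j if j == i then Num.min (b 0 j) c else b 0 j) +
  box_vol (\row_j if j == i then Num.max (a 0 j) c else a 0 j) b = box_vol a b.
Proof.
rewrite /box_vol (bigD1 i)//= [X in _ + X](bigD1 i)//= [RHS](bigD1 i)//= !mxE eqxx.
rewrite (eq_bigr (fun j => Num.max 0 (b 0 j - a 0 j))); last first.
  by move=> j /negbTE ji; rewrite mxE ji.
rewrite [X in _ + _ * X](eq_bigr (fun j => Num.max 0 (b 0 j - a 0 j))); last first.
  by move=> j /negbTE ji; rewrite mxE ji.
rewrite -mulrDl; congr (_ * _).
rewrite /Num.max /Num.min; case: (ltP (b 0 i) c) => h1; case: (ltP (a 0 i) c) => h2;
by do ![case: ltP => ?]; lra.
Qed.

(** A hyperplane parallel to the axes splits every box into two boxes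
whose volumes add up, so it splits every cover. *)
Lemma halfspace_measurable (i : 'I_d) (c : R) :
  measurable ([set x : 'rV[R]_d | x 0 i <= c] : set (Rd R d)).
Proof.
apply: le_caratheodory_measurable => X; apply: le_ereal_inf_tmp => _ [D [F [cF ->]]].
pose F1 k := ((F k).1, \row_j if j == i then Num.min ((F k).2 0 j) c else (F k).2 0 j) : 'rV[R]_d * 'rV[R]_d.
pose F2 k := (\row_j if j == i then Num.max ((F k).1 0 j) c else (F k).1 0 j, (F k).2) : 'rV[R]_d * 'rV[R]_d.
have -> : (\esum_(k in D) (box_vol (F k).1 (F k).2)%:E =
   \esum_(k in D) (box_vol (F1 k).1 (F1 k).2)%:E + \esum_(k in D) (box_vol (F2 k).1 (F2 k).2)%:E)%E.
  rewrite -esumD; try by move=> *; exact: box_vol_ge0.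
  by apply: eq_esum => k _; rewrite -EFinD box_vol_split.
apply: leeD; apply: ereal_inf_lbound.
  exists D, F1; split => // x [Xx xc]; have [k Dk xk] := cF _ Xx; exists k => // j.
  rewrite /F1/= mxE; have /andP[-> h] := xk j; case: eqP => [ji|//].
  by rewrite le_min h ji.
exists D, F2; split => // x [Xx xc]; have [k Dk xk] := cF _ Xx; exists k => // j.
rewrite /F2/= mxE; have /andP[h ->] := xk j; rewrite andbT; case: eqP => [ji|//].
by rewrite ge_max h ji/=; move/negP: xc; rewrite /= -ltNge => /ltW.
Qed.

Lemma coord_measurable (i : 'I_d) :
  measurable_fun [set: Rd R d] (fun x : Rd R d => (x : 'rV[R]_d) 0 i).
Proof.
move=> mD; apply: (measurability _ (RGenOInfty.measurableE R)) => //.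
move=> _ [_ [x ->] <-]; rewrite setTI.
rewrite (_ : _ @^-1` _ = ~` [set y : 'rV[R]_d | y 0 i <= x]).
  by apply: measurableC; exact: halfspace_measurable.
by apply/seteqP; split => y /=; rewrite in_itv/= andbT => h; [apply/negP; rewrite -ltNge|rewrite ltNge; exact/negP].
Qed.

Lemma box_measurable (a b : 'rV[R]_d) : measurable (box a b : set (Rd R d)).
Proof.
rewrite (_ : box a b = \bigcap_(i in [set: 'I_d])
  ((fun x : Rd R d => (x : 'rV[R]_d) 0 i) @^-1` `[a 0 i, b 0 i])).
  apply: fin_bigcap_measurable => // i _; rewrite -[X in measurable X]setTI.
  exact: coord_measurable.
by apply/seteqP; split => x h i; [move=> _|]; have := h i; rewrite /= in_itv//; exact.
Qed.

Lemma cobox_measurable (a b : 'rV[R]_d) : measurable (cobox a b).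
Proof.
rewrite (_ : cobox a b = \bigcap_(i in [set: 'I_d])
  ((fun x : Rd R d => (x : 'rV[R]_d) 0 i) @^-1` `[a 0 i, b 0 i[)).
  apply: fin_bigcap_measurable => // i _; rewrite -[X in measurable X]setTI.
  exact: coord_measurable.
by apply/seteqP; split => x h i; [move=> _|]; have := h i; rewrite /= in_itv//; exact.
Qed.

End BoxMeasure.

(** * Dyadic grids *)

(** A saturated set is a countable union of fibres. *)
Lemma fibers_measurable (dsp : measure_display) (T : measurableType dsp)
    (J : countType) (f : T -> J) (S : set T) :
  (forall x, measurable [set y | f y = f x]) ->
  (forall x y, f x = f y -> S x -> S y) -> measurable S.
Proof.
move=> mf sat; rewrite (_ : S = \bigcup_n [set x | S x /\ pickle (f x) = n]); last first.
  by apply/seteqP; split => x; [exists (pickle (f x))|move=> [n _ []]].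
apply: bigcup_measurable => n _; set A := [set x | _].
have [->//|/set0P[x [Sx xn]]] := eqVneq A set0.
rewrite (_ : A = [set y | f y = f x]); first exact: mf.
apply/seteqP; split => y; first by move=> [_]; rewrite -xn => /(pcan_inj pickleK).
by move=> /= e; split; [exact: sat (esym e) Sx|rewrite e].
Qed.

Section Grid.
Context (R : realType) (d : nat) (L : R) (o : 'rV[R]_d).
Hypothesis L0 : 0 < L.
Notation leb := (@leb R d).
Implicit Types x y : Rd R d.

Definition side (k : nat) : R := L / 2 ^+ k.

Lemma side_gt0 k : 0 < side k.
Proof. by rewrite divr_gt0// exprn_gt0. Qed.

Lemma sideS k : side k = 2 * side k.+1.
Proof. by rewrite /side exprS; field; rewrite expf_neq0. Qed.

(** Cells are named by integer positions, hence by a countable type. *)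
Definition grid (k : nat) (x : Rd R d) : 'rV[int]_d :=
  \row_i Num.floor (((x : 'rV[R]_d) 0 i - o 0 i) / side k).

Definition corner (k : nat) (x : Rd R d) : 'rV[R]_d :=
  \row_i (o 0 i + (grid k x 0 i)%:~R * side k).

Lemma floor_eqP (t : R) (n : int) : (n%:~R <= t < (n + 1)%:~R) <-> Num.floor t = n.
Proof.
split; first exact: floor_def.
by move=> <-; exact: floor_itv.
Qed.

Lemma cell_grid k x : cell grid k x = cobox (corner k x) (corner k x + const_mx (side k)).
Proof.
have s0 := side_gt0 k; apply/seteqP; split => y.
  move=> e i; have : grid k y 0 i = grid k x 0 i by rewrite e.
  rewrite [grid k y 0 i]mxE => /floor_eqP; rewrite !mxE intrD.
  by rewrite ler_pdivlMr// ltr_pdivrMr// => /andP[h1 h2]; apply/andP; split; lra.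
move=> h; apply/rowP => i; rewrite [LHS]mxE; apply/floor_eqP.
have := h i; rewrite !mxE intrD ler_pdivlMr// ltr_pdivrMr// => /andP[h1 h2].
by apply/andP; split; lra.
Qed.

Lemma leb_cell k x : leb (cell grid k x) = (side k ^+ d)%:E.
Proof.
rewrite cell_grid leb_cobox /box_vol; congr EFin.
rewrite (eq_bigr (fun=> side k)); first by rewrite prodr_const card_ord.
by move=> i _; rewrite [in X in X - _]mxE [const_mx _ _ _]mxE addrAC subrr add0r max_r// ltW// side_gt0.
Qed.

Lemma prod_perturb (c : 'I_d -> R) (s : seq 'I_d) : (forall i, 0 <= c i) ->
  exists2 M, 0 <= M & forall e, 0 <= e <= 1 ->
    \prod_(i <- s) (c i + 2 * e) <= \prod_(i <- s) c i + e * M.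
Proof.
move=> c0; elim: s => [|i s [M M0 IH]].
  by exists 0 => // e _; rewrite !big_nil mulr0 addr0.
have P0 : 0 <= \prod_(i <- s) c i by exact: prodr_ge0.
exists (2 * \prod_(i <- s) c i + c i * M + 2 * M).
  by rewrite !addr_ge0 ?mulr_ge0.
move=> e e01; rewrite !big_cons; have {}IH := IH e e01.
have /andP[e0 e1] := e01; have ci := c0 i.
apply: (le_trans (ler_wpM2l _ IH)); first by lra.
have : 0 <= (1 - e) * e * M by rewrite !mulr_ge0//; lra.
lra.
Qed.

Lemma side_small m (e : R) : 0 < e -> exists2 k, (m <= k)%N & side k <= e.
Proof.
move=> e0; exists (m + Num.bound (L / e))%N; first exact: leq_addr.
have Le0 : 0 <= L / e by rewrite divr_ge0// ltW.
have := archi_boundP Le0; set n := Num.bound _ => h.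
rewrite /side ler_pdivrMr ?exprn_gt0// mulrC -ler_pdivrMr//.
apply: (le_trans (ltW h)); apply: (@le_trans _ _ ((2 ^ n)%:R)).
  by rewrite ler_nat ltnW// ltn_expl.
by rewrite natrX exprD ler_peMl ?exprn_ge0// exprn_ege1// ler1n.
Qed.

(** The cells of a fine level that meet a box overshoot it only slightly. *)
Lemma box_cells (F : 'rV[R]_d * 'rV[R]_d) m (e : R) : 0 < e ->
  exists U : set (Rd R d), [/\ measurable U, box F.1 F.2 `<=` U,
    (leb U <= (box_vol F.1 F.2 + e)%:E)%E &
    forall x, U x -> exists2 k, (m <= k)%N & cell grid k x `<=` U].
Proof.
move=> e0; pose c i := Num.max 0 (F.2 0 i - F.1 0 i).
have c0 i : 0 <= c i by rewrite le_max lexx.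
have [M M0 hM] := prod_perturb (index_enum _) c0.
have e1 : 0 < Num.min 1 (e / (M + 1)) by rewrite lt_min ltr01 divr_gt0// ltr_wpDl.
have [k mk sk] := side_small m e1; move: sk; rewrite le_min => /andP[sk1 ske].
pose U := [set x : Rd R d | exists2 y, box F.1 F.2 y & grid k y = grid k x].
exists U; split.
- apply: (@fibers_measurable _ _ _ (grid k)) => [x|x y xy [z Bz zx]].
    rewrite -/(cell grid k x) cell_grid; exact: cobox_measurable.
  by exists z => //; rewrite zx.
- by move=> x Fx; exists x.
- have UB : U `<=` box (F.1 - const_mx (side k)) (F.2 + const_mx (side k)).
    move=> x [y By yx]; have : cell grid k x y by [].
    rewrite cell_grid => hy; have : cell grid k x x by [].
    rewrite {1}cell_grid => hx i; have := hx i; have := hy i; have := By i.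
    rewrite !mxE; lra.
  apply: (le_trans (le_lebesgue_outer UB)); apply: (le_trans (leb_box_le _ _)).
  rewrite lee_fin; apply: (@le_trans _ _ (\prod_i (c i + 2 * side k))).
    apply: ler_prod => i _; rewrite le_max lexx/= !mxE.
    have s0 := side_gt0 k; have ci := c0 i.
    have cF : F.2 0 i - F.1 0 i <= c i by rewrite /c le_max lexx orbT.
    by rewrite ge_max; apply/andP; split; lra.
  apply: (le_trans (hM _ _)); first by rewrite (ltW (side_gt0 k)).
  rewrite lerD2l; move: ske; rewrite ler_pdivlMr ?ltr_wpDl// => h.
  by apply: le_trans h; rewrite ler_wpM2l ?(ltW (side_gt0 k))// lerDl.
- move=> x [y By yx]; exists k => // z zx; exists y => //.
  by rewrite yx; exact: esym zx.
Qed.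

Lemma grid_nest k x y : grid k.+1 x = grid k.+1 y -> grid k x = grid k y.
Proof.
move=> e; apply/rowP => i; rewrite !mxE; apply/floor_eqP.
have : grid k.+1 x 0 i = grid k.+1 y 0 i by rewrite e.
rewrite !mxE; set tx := _ / side k.+1; set ty := _ / side k.+1 => e1.
have s1 := lt0r_neq0 (side_gt0 k.+1).
have -> : (x : 'rV[R]_d) 0 i - o 0 i = tx * side k.+1 by rewrite divfK.
have -> : (y : 'rV[R]_d) 0 i - o 0 i = ty * side k.+1 by rewrite divfK.
have h t : t * side k.+1 / side k = t / 2 by rewrite (sideS k); field.
rewrite !h; move: e1; set n := Num.floor ty => /floor_eqP nx.
have /floor_eqP ny : Num.floor ty = n by [].
set j := Num.floor (ty / 2); have /floor_eqP hj : Num.floor (ty / 2) = j by [].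
have jn : (j * 2)%:~R < (n + 1)%:~R :> R by rewrite intrM; move: hj ny; lra.
have nj : n%:~R < ((j + 1) * 2)%:~R :> R by rewrite intrM; move: hj ny; lra.
move: jn nj; rewrite !ltr_int ltzD1 => jn; rewrite -lezD1 => nj.
have jn' : (j * 2)%:~R <= n%:~R :> R by rewrite ler_int.
have nj' : (n + 1)%:~R <= ((j + 1) * 2)%:~R :> R by rewrite ler_int.
move: jn' nj' nx; rewrite !intrM !intrD; lra.
Qed.

(** Cover by boxes of nearly the right total volume and replace each box by
the fine cells that meet it. *)
Lemma grid_regular (E : set (Rd R d)) m (e : R) : measurable E ->
  (leb E < +oo)%E -> 0 < e ->
  exists U, [/\ measurable U, E `<=` U, (leb U <= leb E + e%:E)%E &
    forall x, U x -> exists2 k, (m <= k)%N & cell grid k x `<=` U].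
Proof.
move=> mE finE e0; have fE : leb E \is a fin_num by rewrite ge0_fin_numE.
have [_ [D [F [cF ->]]] hD] := lb_ereal_inf_adherent (divr_gt0 e0 (ltr0n R 2)) fE.
have ep k : 0 < e / 2 / (2 ^ k.+1)%:R by rewrite !divr_gt0// ltr0n expn_gt0.
have [V hV] := choice (fun k => box_cells (F k) m (ep k)).
pose U k := if k \in D then V k else set0.
exists (\bigcup_k U k); split.
- apply: bigcup_measurable => k _; rewrite /U; case: ifP => // _.
  by have [] := hV k.
- move=> x Ex; have [k Dk xk] := cF x Ex; exists k => //; rewrite /U mem_set//.
  by have [_ + _ _] := hV k; apply.
- pose v k : \bar R := if k \in D then (box_vol (F k).1 (F k).2)%:E else 0%E.
  have v0 k : (0 <= v k)%E by rewrite /v; case: ifP => // _; exact: box_vol_ge0.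
  apply: (@le_trans _ _ (\sum_(k <oo) leb (U k))%E).
    exact: lebesgue_outer_sigma_subadditive.
  apply: (@le_trans _ _ (\sum_(k <oo) (v k + (e / 2 / (2 ^ k.+1)%:R)%:E))%E).
    apply: lee_nneseries => // k _; rewrite /U /v; case: ifP => _.
      by have [_ _ + _] := hV k; rewrite EFinD.
    by rewrite measure0 add0e lee_fin ltW.
  apply: (le_trans (epsilon_trick _ v0 _)); first by rewrite divr_ge0// ltW.
  rewrite (_ : \sum_(k <oo) v k = \esum_(k in D) (box_vol (F k).1 (F k).2)%:E)%E.
    apply: (@le_trans _ _ (leb E + (e / 2)%:E + (e / 2)%:E)%E).
      by rewrite leeD2r// ltW.
    by rewrite -addeA -EFinD -splitr.
  rewrite -[D in RHS]set_mem_set -nneseries_esum; last by move=> *; exact: box_vol_ge0.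
  by rewrite [in RHS]eseries_mkcond.
- move=> x [k _]; rewrite /U; case: ifPn => // kD Vx.
  have [_ _ _ /(_ x Vx)[l ml hl]] := hV k; exists l => // y /hl Vy.
  by exists k => //; rewrite /U kD.
Qed.

Lemma grid_dyadic : dyadic leb grid (2 ^+ d).
Proof.
split => [k x|k x y|k x|k x|k x|E m e].
- rewrite cell_grid; exact: cobox_measurable.
- exact: grid_nest.
- by rewrite [X in (_ < X)%E]leb_cell lte_fin exprn_gt0// side_gt0.
- by rewrite [X in (X < _)%E]leb_cell ltry.
- by rewrite [X in (X <= _)%E]leb_cell [X in (_ <= _ * X)%E]leb_cell -EFinM lee_fin -exprMn -sideS.
- exact: grid_regular.
Qed.

End Grid.

(** * From grids to cubes *)

Section OneThird.
Context (R : realType) (d : nat) (L : R).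
Hypothesis L0 : 0 < L.

Lemma pow2_not_dvd3 (k : nat) (n : int) : n * 3 <> (2 ^ k)%:Z.
Proof.
move=> h; have : (3 %| `|(2 ^ k)%:Z|)%N.
  by rewrite -h abszM dvdn_mull.
by rewrite absz_nat Euclid_dvdX.
Qed.

Lemma floor_ne_exists (t h : R) : 0 <= h -> Num.floor t != Num.floor (t + h) ->
  exists m : int, t < m%:~R <= t + h.
Proof.
move=> h0 ne; exists (Num.floor (t + h)).
have /andP[h1 h2] := floor_itv (t + h); rewrite h1 andbT ltNge; apply/negP => h3.
move/eqP: ne; apply; apply: floor_def; rewrite h3/=.
by apply: le_lt_trans h2; rewrite lerDl.
Qed.

(** A shift by a third of the top side moves every grid point of every level
by at least a third of the side of that level. *)
Lemma one_third (k : nat) (t h : R) : 0 <= h < 1 / 3 ->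
  Num.floor t = Num.floor (t + h) \/
  Num.floor (t - 2 ^+ k / 3) = Num.floor (t - 2 ^+ k / 3 + h).
Proof.
move=> /andP[h0 h3]; apply: contrapT => /not_orP[/eqP n1 /eqP n2].
have [m /andP[m1 m2]] := floor_ne_exists h0 n1.
have [n /andP[q1 q2]] := floor_ne_exists h0 n2.
have : `|((m - n) * 3 - (2 ^ k)%:Z)%:~R| < 1 :> R.
  rewrite intrB intrM intrB -[((2 ^ k)%:Z)%:~R]/((2 ^ k)%:R : R) natrX.
  by rewrite ltr_norml; apply/andP; split; lra.
rewrite -intr_norm -[1]/(1%:~R) ltr_int => hlt.
have : (m - n) * 3 - (2 ^ k)%:Z = 0 by move: hlt; rewrite -abszE ltz_nat ltnS leqn0 absz_eq0 => /eqP.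
by move/eqP; rewrite subr_eq0 => /eqP; exact: pow2_not_dvd3.
Qed.

Definition shift (b : {ffun 'I_d -> bool}) : 'rV[R]_d :=
  \row_i (if b i then L / 3 else 0).

(** Take the finest level whose side is more than three times [l]. On each
axis at most one of the two grids has a point inside the side of the cube. *)
Lemma cube_in_cell (a : 'rV[R]_d) (l : R) : 0 < l -> l < L / 3 ->
  exists b k, forall x : Rd R d, box a (a + const_mx l) x ->
    box a (a + const_mx l) `<=` cell (grid L (shift b)) k x /\
    side L k <= 6 * l.
Proof.
move=> l0 lL.
have ex : exists k, side L k.+1 / 3 <= l.
  have [k _ hk] := side_small L0 0 l0; exists k.
  have := side_gt0 L0 k.+1; rewrite (sideS L k) in hk; lra.
have [k hk kmin] := ex_minnP ex.
have lk : l < side L k / 3.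
  case: k => [|k] in hk kmin *; first by rewrite /side expr0 divr1.
  by rewrite ltNge; apply/negP => /kmin; rewrite ltnn.
have s0 := side_gt0 L0 k; set s := side L k in lk s0.
have h01 : 0 <= l / s < 1 / 3.
  by rewrite divr_ge0 ?(ltW l0) ?(ltW s0)//= ltr_pdivrMr//; lra.
(* coordinate by coordinate, shift exactly when a grid point separates the side *)
pose b : {ffun 'I_d -> bool} := [ffun i =>
  Num.floor (a 0 i / s) != Num.floor (a 0 i / s + l / s)].
have hb i : Num.floor ((a 0 i - shift b 0 i) / s) = Num.floor ((a 0 i - shift b 0 i) / s + l / s).
  rewrite mxE ffunE; case: ifPn => [/eqP ne|/negPn/eqP]; last by rewrite subr0.
  have [//|] := one_third k (a 0 i / s) h01.
  have -> : (a 0 i - L / 3) / s = a 0 i / s - 2 ^+ k / 3; last by [].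
  rewrite /s /side; field; rewrite ?expf_neq0 ?gt_eqF//.
have fl (y : Rd R d) i : box a (a + const_mx l) y ->
    Num.floor (((y : 'rV[R]_d) 0 i - shift b 0 i) / s) = Num.floor ((a 0 i - shift b 0 i) / s).
  move=> /(_ i); rewrite [(a + _)%R _ _]mxE [const_mx _ _ _]mxE => /andP[y1 y2].
  apply/eqP; rewrite eq_le; apply/andP; split.
    rewrite hb; apply: le_floor; rewrite -mulrDl ler_pM2r ?invr_gt0//; lra.
  by apply: le_floor; rewrite ler_pM2r ?invr_gt0//; lra.
exists b, k => x xQ; split; last by move: hk; rewrite (sideS L k); lra.
by move=> y yQ; apply/rowP => i; rewrite [LHS]mxE [RHS]mxE -[side L k]/s fl// fl.
Qed.

End OneThird.

Section CubeWeakType.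
Context (R : realType) (d m : nat) (p K : R).
Notation T := (Rd R d).
Notation leb := (@leb R d).
Context (G H : T -> 'M[R]_m).
Hypothesis m_gt0 : (0 < m)%N.
Hypothesis p_ge1 : 1 <= p.
Hypothesis mG : forall i j, measurable_fun [set: T] (fun x => G x i j).
Hypothesis mH : forall i j, measurable_fun [set: T] (fun x => H x i j).
Hypothesis GH : forall x, G x *m H x = 1%:M.
Hypothesis K_ge0 : 0 <= K.
Local Open Scope ereal_scope.
Hypothesis AQ : forall (Q : set T) g, is_cube Q -> vmeas g ->
  \int[leb]_(y in Q) (nu G y (g y) `^ p)%:E < +oo ->
  \int[leb]_(x in Q) (\int[leb]_(y in Q) (nu G x (g y))%:E) `^ p <=
  (K * fine (leb Q) `^ p)%:E * \int[leb]_(y in Q) (nu G y (g y) `^ p)%:E.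

Let p0 : (0 < p)%R. Proof. exact: lt_le_trans p_ge1. Qed.

Lemma leb_cube (a : 'rV[R]_d) (l : R) : (0 < l)%R ->
  leb (box a (a + const_mx l)%R) = (l ^+ d)%:E.
Proof.
move=> l0; rewrite leb_box /box_vol; congr EFin.
rewrite (eq_bigr (fun=> l)); first by rewrite prodr_const card_ord.
by move=> i _; rewrite [in X in (X - _)%R]mxE [const_mx _ _ _]mxE addrAC subrr add0r max_r// ltW.
Qed.

(** A grid cell and its closed hull have the same measure. *)
Lemma averaging_cell (L : R) (o : 'rV[R]_d) (L0 : (0 < L)%R) k x0 g : vmeas g ->
  \int[leb]_(y in cell (grid L o) k x0) (nu G y (g y) `^ p)%:E < +oo ->
  \int[leb]_(x in cell (grid L o) k x0)
      (\int[leb]_(y in cell (grid L o) k x0) (nu G x (g y))%:E) `^ p <=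
  (K * fine (leb (cell (grid L o) k x0)) `^ p)%:E *
    \int[leb]_(y in cell (grid L o) k x0) (nu G y (g y) `^ p)%:E.
Proof.
move=> mg; have s0 := side_gt0 L0 k.
set P := cell _ _ _; pose Q : set T := box (corner L o k x0) (corner L o k x0 + const_mx (side L k))%R.
move=> finP.
have PQ : P `<=` Q by rewrite /P cell_grid//; exact: cobox_box.
have mP : measurable P by rewrite /P cell_grid//; exact: cobox_measurable.
have cQ : is_cube Q by exists (corner L o k x0), (side L k).
have -> : leb P = leb Q by rewrite /P leb_cell// leb_cube.
pose g1 y := (\1_P y : R) *: g y.
have mg1 : vmeas g1.
  move=> j; rewrite (_ : (fun y => _) = (fun y => \1_P y * g y 0 j)%R); last first.
    by apply/funext => y; rewrite /g1 mxE.
  by apply: measurable_funM => //; exact: measurable_indic.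
have g1P : \int[leb]_(y in Q) (nu G y (g1 y) `^ p)%:E <=
    \int[leb]_(y in P) (nu G y (g y) `^ p)%:E.
  rewrite -[P in leRHS](setIidr PQ) integral_mkcondr; apply: ge0_le_integral_any => //.
  - by move=> y _; rewrite lee_fin powR_ge0.
  - by move=> y _; apply: erestrict_ge0 => z _; rewrite lee_fin powR_ge0.
  move=> y _; rewrite patchE /g1 nuZ indicE; case: (y \in P).
    by rewrite normr1 mul1r.
  by rewrite normr0 mul0r powR0 ?gt_eqF.
apply: (le_trans _ (le_trans (AQ cQ mg1 (le_lt_trans g1P finP)) _)).
  apply: ge0_le_integral_any => // x _; try exact: poweR_ge0.
  apply: gt0_ler_poweR; first exact: ltW.
  - by rewrite in_itv/= leey andbT integral_ge0// => y _; rewrite lee_fin nu_ge0.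
  - by rewrite in_itv/= leey andbT integral_ge0// => y _; rewrite lee_fin nu_ge0.
  apply: ge0_le_integral_any => // y Py; try by rewrite lee_fin nu_ge0.
  by rewrite /g1 indicE mem_set// scale1r.
by apply: lee_wpmul2l; first by rewrite lee_fin mulr_ge0// powR_ge0.
Qed.

Context (u : T -> 'rV[R]_m).
Hypothesis mu_u : vmeas u.
Let I := \int[leb]_y (nu G y (u y) `^ p)%:E.
Hypothesis I_fin : I < +oo.
Context (al : R).
Hypothesis al_gt0 : (0 < al)%R.

Definition cube_const : R :=
  (2 ^+ d * weak_const (2 ^+ d) m p * (6 ^+ d) `^ p)%R.

(** Union of the exceptional sets of the [2^d] shifted grids. *)
Lemma weak_type_bounded_side (L : R) : (0 < L)%R -> exists S : set T,
  [/\ measurable S,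
   forall (a : 'rV[R]_d) (l : R) x, (0 < l)%R -> (l < L / 3)%R ->
     box a (a + const_mx l)%R x ->
     al%:E * leb (box a (a + const_mx l)%R) <
       \int[leb]_(y in box a (a + const_mx l)%R) (nu G x (u y))%:E -> S x &
   leb S <= (cube_const * K ^+ 2 / al `^ p)%:E * I].
Proof.
move=> L0; (* a cell containing the cube may have [6 ^+ d] times its measure *)
pose al' := (al / 6 ^+ d)%R.
have al'0 : (0 < al')%R by rewrite divr_gt0// exprn_gt0.
have [S hS] := choice (fun b : {ffun 'I_d -> bool} => dyadic_weak_type
  (grid_dyadic (shift L b) L0) m_gt0 p_ge1 mG mH GH K_ge0
  (@averaging_cell L (shift L b) L0) mu_u I_fin 0%R al'0).
exists (\big[setU/set0]_b S b); split.
- by apply: bigsetU_measurable => b _; have [] := hS b.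
- move=> a l x l0 lL xQ hal; have [b [k hbk]] := cube_in_cell L0 a l0 lL.
  have [QC sl] := hbk x xQ; apply/mem_bigsetU; exists b.
  have [_ + _] := hS b; apply; apply: le_lt_trans (lt_le_trans hal _).
    rewrite [X in _ * X <= _]leb_cell// [X in _ <= _ * X]leb_cube// -!EFinM lee_fin /al' -mulrA ler_wpM2l ?(ltW al_gt0)//.
    rewrite mulrC ler_pdivrMr ?exprn_gt0// -exprMn mulrC.
    have s0 := ltW (side_gt0 L0 k).
    apply: lerXn2r; [exact: s0|by rewrite nnegrE mulr_ge0// ltW|by rewrite mulrC].
  by apply: ge0_le_integral_any => // y _; rewrite lee_fin nu_ge0.
apply: (le_trans (measure_bigsetU_le _ _ _)); first by move=> b; have [] := hS b.
apply: (@le_trans _ _ (\sum_(b : {ffun 'I_d -> bool})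
  (weak_const (2 ^+ d) m p * K ^+ 2 / al' `^ p)%:E * I)).
  by apply: lee_sum => b _; have [] := hS b.
have If : I \is a fin_num.
  by rewrite ge0_fin_numE// integral_ge0// => y _; rewrite lee_fin powR_ge0.
rewrite -(fineK If) -EFinM sumEFin lee_fin sumr_const card_ffun card_bool card_ord.
have -> : (al `^ p = al' `^ p * (6 ^+ d) `^ p)%R.
  by rewrite -powRM ?exprn_ge0 ?(ltW al'0)// /al' divfK// expf_neq0.
rewrite -[leLHS]mulr_natr natrX /cube_const.
rewrite le_eqVlt; apply/orP; left; apply/eqP; field.
by rewrite !gt_eqF ?powR_gt0 ?exprn_gt0.
Qed.

Definition large_average_set : set T := [set x | exists Q : set T,
  [/\ is_cube Q, Q x & al%:E * leb Q < \int[leb]_(y in Q) (nu G x (u y))%:E]].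

(** The top side is sent to infinity; passing to a lower limit of the
exceptional sets keeps the bound without any measurability of the maximal
function. *)
Theorem cube_weak_type :
  leb large_average_set <= (cube_const * K ^+ 2 / al `^ p)%:E * I.
Proof.
have [S hS] := choice (fun n : nat => weak_type_bounded_side (ltr0Sn R n)).
set B := _ * I in hS *.
pose U n := \bigcap_(k in [set k | (n <= k)%N]) S k.
have mS n : measurable (S n) by have [] := hS n.
have mU n : measurable (U n) by apply: bigcap_measurableType => k _.
have mUU : measurable (\bigcup_n U n) by exact: bigcup_measurable.
have EU : large_average_set `<=` \bigcup_n U n.
  move=> x [_ [[a [l [l0 ->]]] xQ hal]].
  exists (Num.bound (3 * l)%R) => // k /= hk; have [_ + _] := hS k.
  apply; [exact: l0| |exact: xQ|exact: hal].
  have := archi_boundP (mulr_ge0 (ler0n R 3) (ltW l0)).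
  have : ((Num.bound (3 * l))%:R <= k%:R :> R)%R by rewrite ler_nat.
  by rewrite ltr_pdivlMr// -natr1; lra.
apply: (le_trans (le_lebesgue_outer EU)).
have ndU : nondecreasing_seq U.
  by move=> i j ij; apply/subsetPset => x Ux k /= jk; apply: Ux => /=; exact: leq_trans jk.
rewrite [X in X <= _](_ : _ = limn (leb \o U)); last first.
  by apply/esym/cvg_lim => //; exact: nondecreasing_cvg_mu.
apply: lime_le.
  apply: ereal_nondecreasing_is_cvgn => i j ij; rewrite le_measure ?inE//.
  exact/subsetPset/ndU.
apply: nearW => n /=; have [_ _ hn] := hS n; apply: le_trans hn.
by rewrite le_measure ?inE// => x Ux; apply: Ux => /=.
Qed.

End CubeWeakType.

(** * Measurability of matrix powers *)

Local Open Scope complex_scope.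
Local Open Scope sesquilinear_scope.

Section DiagonalConjugate.
Context (C : numClosedFieldType) (n : nat) (U : 'M[C]_n).
Hypothesis uU : U \in unitmx.
Implicit Types (v w : 'rV[C]_n).

Definition conj_diag v : 'M[C]_n := invmx U *m diag_mx v *m U.

Lemma conj_diagE v i j :
  conj_diag v i j = \sum_k (invmx U i k * U k j) * v 0 k.
Proof.
rewrite /conj_diag mxE; apply: eq_bigr => k _.
by rewrite mul_mx_diag mxE mulrAC.
Qed.

Lemma conj_diagM v w :
  conj_diag v *m conj_diag w = conj_diag (\row_k (v 0 k * w 0 k)).
Proof.
rewrite /conj_diag !mulmxA mulmxK//; congr (_ *m _).
by rewrite -!mulmxA; congr (_ *m _); rewrite mulmx_diag.
Qed.

Lemma conj_diagD v w : conj_diag v + conj_diag w = conj_diag (v + w).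
Proof. by rewrite /conj_diag linearD/= mulmxDr mulmxDl. Qed.

Lemma conj_diag_const (c : C) : conj_diag (const_mx c) = c%:M.
Proof.
by rewrite /conj_diag diag_const_mx mul_mx_scalar -scalemxAl mulVmx// scalemx1.
Qed.

(** Rows of the unitary matrix are eigenvectors, tested in the quadratic
form. *)
Lemma conj_diag_form v k : U \is unitarymx -> exists2 z : 'cV[C]_n, z != 0 &
  (z^t* *m conj_diag v *m z) 0 0 = v 0 k.
Proof.
move=> UU; pose e : 'cV[C]_n := delta_mx k 0.
exists (U^t* *m e); last first.
  rewrite /conj_diag (invmx_unitary UU) trmx_mul map_mxM trmxCK.
  have /unitarymxP h := UU.
  rewrite !mulmxA -[_ *m U *m U^t*]mulmxA h mulmx1.
  rewrite -[_ *m U *m U^t*]mulmxA h mulmx1.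
  rewrite mul_mx_diag mxE (bigD1 k)//= !mxE !eqxx big1 ?addr0.
    by rewrite conjC1 mul1r mulr1.
  by move=> j /negbTE jk; rewrite !mxE jk /= mulr0.
apply/eqP => /(congr1 (mulmx U)); rewrite mulmxA.
have /unitarymxP -> := UU; rewrite mul1mx mulmx0 => /matrixP/(_ k 0).
by rewrite !mxE !eqxx => /eqP; rewrite oner_eq0.
Qed.

End DiagonalConjugate.

Section FunctionalCalculus.
Context (R : realType) (n : nat).
Notation C := R[i].
Implicit Types (A : 'M[C]_n) (f g : R -> R).

Definition eigen A (k : 'I_n) : R := complex.Re (spectral_diag A 0 k).

Definition mxfun A f : 'M[C]_n :=
  conj_diag (spectralmx A) (\row_k (f (eigen A k))%:C).

Lemma mxpowE A s : mxpow A s = mxfun A (fun t => t `^ s).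
Proof.
rewrite /mxpow /mxfun /conj_diag /eigen.
move: (spectralmx A) (spectral_diag A) => U v.
suff -> : map_mx (fun z => (complex.Re z `^ s)%:C) v =
  \row_k (complex.Re (v 0 k) `^ s)%:C by [].
by apply/rowP => k; rewrite !mxE.
Qed.

Lemma mxfunE A f i j : mxfun A f i j = \sum_k
  (invmx (spectralmx A) i k * spectralmx A k j) * (f (eigen A k))%:C.
Proof. by rewrite /mxfun conj_diagE; apply: eq_bigr => k _; rewrite mxE. Qed.

Lemma eq_mxfun A f g : (forall k, f (eigen A k) = g (eigen A k)) -> mxfun A f = mxfun A g.
Proof.
by move=> e; congr conj_diag; apply/rowP => k; rewrite !mxE e.
Qed.

Lemma mxfunM A f g : mxfun A f *m mxfun A g = mxfun A (fun t => f t * g t).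
Proof.
rewrite /mxfun (conj_diagM (spectral_unit A)).
suff -> : \row_k ((\row_k (f (eigen A k))%:C) 0 k * (\row_k (g (eigen A k))%:C) 0 k) =
  \row_k (f (eigen A k) * g (eigen A k))%:C by [].
by apply/rowP => k; rewrite !mxE -rmorphM.
Qed.

Lemma mxfunD A f g : mxfun A f + mxfun A g = mxfun A (fun t => f t + g t).
Proof.
rewrite /mxfun conj_diagD; congr conj_diag.
by apply/rowP => k; rewrite !mxE -rmorphD.
Qed.

Lemma mxfun_cst A c : mxfun A (fun=> c) = (c%:C)%:M.
Proof.
rewrite -(conj_diag_const (spectral_unit A)); congr conj_diag.
by apply/rowP => k; rewrite !mxE.
Qed.

Lemma eigenE A k : A \is hermsymmx -> (eigen A k)%:C = spectral_diag A 0 k.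
Proof.
move=> hA; have := hermitian_spectral_diag_real hA => /mxOverP /(_ 0 k).
exact: RRe_real.
Qed.

Lemma mxfun_id A : A \is hermsymmx -> mxfun A id = A.
Proof.
move=> hA; have /orthomx_spectralP Ae := hermitian_normalmx hA.
rewrite [RHS]Ae /mxfun.
suff -> : \row_k (eigen A k)%:C = spectral_diag A by [].
by apply/rowP => k; rewrite [LHS]mxE eigenE.
Qed.

Lemma eigen_gt0 A k : posdefmx A -> 0 < eigen A k.
Proof.
move=> [hA pA]; have /orthomx_spectralP Ae := hermitian_normalmx hA.
have [z z0 ez] := conj_diag_form (spectral_diag A) k (spectral_unitarymx A).
have := pA z z0; rewrite [in X in X -> _]Ae ez -(eigenE k hA).
by rewrite ltcR.
Qed.

End FunctionalCalculus.

Section PowerLimits.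
Context (R : realType).

(** Newton's iteration for the equation [expR y = t]: it uses only sums,
products and exponentials of its argument. *)
Fixpoint newton_ln (k : nat) (t : R) : R :=
  if k is k'.+1 then newton_ln k' t - 1 + t * expR (- newton_ln k' t) else 0.

(** After the first step the iterates lie above [ln t], by convexity of the
exponential, and decrease to the only fixed point. *)
Lemma newton_ln_cvg (t : R) : 0 < t -> newton_ln k t @[k --> \oo] --> ln t.
Proof.
move=> t0; pose u k := newton_ln k.+1 t.
have step y : ln t <= y - 1 + t * expR (- y).
  have := expR_ge1Dx (ln t - y); rewrite expRD lnK ?posrE//; lra.
have u_ge k : ln t <= u k by exact: step.
have u_dec : nonincreasing_seq u.
  apply/nonincreasing_seqP => k; rewrite /u [in leLHS]/=.
  have : t * expR (- newton_ln k.+1 t) <= 1; last by rewrite /=; lra.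
  by rewrite expRN ler_pdivrMr ?expR_gt0// mul1r -[leLHS]lnK ?posrE// ler_expR; exact: u_ge.
have ucv : cvgn u.
  apply: nonincreasing_is_cvgn => //; exists (ln t) => _ [k _ <-]; exact: u_ge.
have [l ul] : exists l : R, u k @[k --> \oo] --> l by exists (limn u).
have ul1 : u k.+1 @[k --> \oo] --> l by rewrite (cvg_shiftS u).
have ul2 : u k.+1 @[k --> \oo] --> l - 1 + t * expR (- l).
  apply: cvgD; first by apply: cvgB => //; exact: cvg_cst.
  apply: cvgM; first exact: cvg_cst.
  by apply: continuous_cvg; [exact: continuous_expR|exact: cvgN].
have e : l = l - 1 + t * expR (- l) by apply: (cvg_unique _ ul1 ul2).
have lE : l = ln t.
  have : expR l = t.
    have : t * expR (- l) = 1 by lra.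
    by rewrite expRN => /divr1_eq.
  by move=> <-; rewrite expRK.
by rewrite -lE -(cvg_shiftS (fun k => newton_ln k t)).
Qed.

Lemma expR_series_cvg (t : R) : series (exp_coeff t) k @[k --> \oo] --> expR t.
Proof. exact: is_cvg_series_exp_coeff. Qed.

End PowerLimits.

Section MeasurablePower.
Context (dsp : measure_display) (T : measurableType dsp) (R : realType) (n : nat).
Notation C := R[i].

Definition cmeas (g : T -> C) :=
  measurable_fun [set: T] (fun x => complex.Re (g x)) /\
  measurable_fun [set: T] (fun x => complex.Im (g x)).

Lemma cmeasD (g h : T -> C) : cmeas g -> cmeas h -> cmeas (fun x => g x + h x).
Proof.
move=> [g1 g2] [h1 h2]; split.
  rewrite (_ : (fun x => _) = (fun x => complex.Re (g x) + complex.Re (h x))).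
    exact: measurable_funD.
  by apply/funext => x; case: (g x) => ? ?; case: (h x).
rewrite (_ : (fun x => _) = (fun x => complex.Im (g x) + complex.Im (h x))).
  exact: measurable_funD.
by apply/funext => x; case: (g x) => ? ?; case: (h x).
Qed.

Lemma cmeasM (g h : T -> C) : cmeas g -> cmeas h -> cmeas (fun x => g x * h x).
Proof.
move=> [g1 g2] [h1 h2]; split.
  rewrite (_ : (fun x => _) = (fun x => complex.Re (g x) * complex.Re (h x) -
      complex.Im (g x) * complex.Im (h x))).
    by apply: measurable_funB; apply: measurable_funM.
  by apply/funext => x; case: (g x) => ? ?; case: (h x).
rewrite (_ : (fun x => _) = (fun x => complex.Re (g x) * complex.Im (h x) +
    complex.Im (g x) * complex.Re (h x))).
  by apply: measurable_funD; apply: measurable_funM.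
by apply/funext => x; case: (g x) => ? ?; case: (h x).
Qed.

Lemma cmeas_cst (c : C) : cmeas (fun=> c).
Proof. by split; exact: measurable_cst. Qed.

Lemma cmeas_sum (I : finType) (g : I -> T -> C) :
  (forall i, cmeas (g i)) -> cmeas (fun x => \sum_i g i x).
Proof.
move=> mg; rewrite unlock; elim: (index_enum I) => [|i s IH] /=; first exact: cmeas_cst.
exact: cmeasD.
Qed.

Definition mxmeas (A : T -> 'M[C]_n) := forall i j, cmeas (fun x => A x i j).

Lemma mxmeasM A B : mxmeas A -> mxmeas B -> mxmeas (fun x => A x *m B x).
Proof.
move=> mA mB i j; under eq_fun do rewrite mxE.
by apply: cmeas_sum => k; exact: cmeasM.
Qed.

Lemma mxmeasD A B : mxmeas A -> mxmeas B -> mxmeas (fun x => A x + B x).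
Proof. by move=> mA mB i j; under eq_fun do rewrite mxE; exact: cmeasD. Qed.

Context (W : T -> 'M[C]_n).
Hypothesis mW : mxmeas W.
Hypothesis pW : forall x, posdefmx (W x).

(** Functions whose functional calculus keeps matrix functions measurable. The
eigenvectors of [W x] are not chosen measurably, so this class is built from
polynomials by pointwise limits on the positive half-line. *)
Definition mxfun_meas (f : R -> R) := mxmeas (fun x => mxfun (W x) f).

Lemma eq_mxfun_meas f g : f =1 g -> mxfun_meas f -> mxfun_meas g.
Proof. by move=> /funext ->. Qed.

Lemma mxfun_measM f g : mxfun_meas f -> mxfun_meas g -> mxfun_meas (fun t => f t * g t).
Proof.
move=> mf mg i j; have := mxmeasM mf mg i j.
by under eq_fun do rewrite mxfunM.
Qed.

Lemma mxfun_measD f g : mxfun_meas f -> mxfun_meas g -> mxfun_meas (fun t => f t + g t).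
Proof.
move=> mf mg i j; have := mxmeasD mf mg i j.
by under eq_fun do rewrite mxfunD.
Qed.

Lemma mxfun_meas_cst c : mxfun_meas (fun=> c).
Proof. by move=> i j; under eq_fun do rewrite mxfun_cst; exact: cmeas_cst. Qed.

Lemma mxfun_meas_id : mxfun_meas id.
Proof.
move=> i j; rewrite (_ : (fun x => _) = (fun x => W x i j)); first exact: mW.
by apply/funext => x; rewrite mxfun_id//; have [] := pW x.
Qed.

(** Entries are linear in the values at the eigenvalues, so that for fixed [x]
the limit passes through whatever the eigenvectors are. *)
Lemma mxfun_meas_lim (F : nat -> R -> R) f : (forall k, mxfun_meas (F k)) ->
  (forall t, 0 < t -> F k t @[k --> \oo] --> f t) -> mxfun_meas f.
Proof.
move=> mF Ff i j.
pose c x k : C := invmx (spectralmx (W x)) i k * spectralmx (W x) k j.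
have reE g x : complex.Re (mxfun (W x) g i j) = \sum_k complex.Re (c x k) * g (eigen (W x) k).
  rewrite mxfunE (big_morph (@complex.Re R) (id1 := 0) (op1 := +%R))//; last by move=> [? ?] [? ?].
  by apply: eq_bigr => k _; rewrite -/(c x k); case: (c x k) => a b /=; rewrite mulr0 subr0.
have imE g x : complex.Im (mxfun (W x) g i j) = \sum_k complex.Im (c x k) * g (eigen (W x) k).
  rewrite mxfunE (big_morph (@complex.Im R) (id1 := 0) (op1 := +%R))//; last by move=> [? ?] [? ?].
  by apply: eq_bigr => k _; rewrite -/(c x k); case: (c x k) => a b /=; rewrite mulr0 add0r.
have cv (a : 'I_n -> R) x : (\sum_l a l * F k (eigen (W x) l)) @[k --> \oo] -->
    \sum_l a l * f (eigen (W x) l).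
  elim: (index_enum _) => [|l s IH].
    by under eq_fun do rewrite big_nil; rewrite big_nil; exact: cvg_cst.
  under eq_fun do rewrite big_cons; rewrite big_cons; apply: cvgD => //.
  by apply: cvgM; [exact: cvg_cst|apply: Ff; exact: eigen_gt0].
have reF g : (fun x => complex.Re (mxfun (W x) g i j)) =
    (fun x => \sum_k complex.Re (c x k) * g (eigen (W x) k)) := funext (reE g).
have imF g : (fun x => complex.Im (mxfun (W x) g i j)) =
    (fun x => \sum_k complex.Im (c x k) * g (eigen (W x) k)) := funext (imE g).
pose M (h : T -> R) := measurable_fun [set: T] h.
split.
  apply: (eq_ind_r M _ (reF f)).
  apply: (measurable_fun_cvg (h := fun k x => \sum_l complex.Re (c x l) * F k (eigen (W x) l))).
    move=> k; have [h _] := mF k i j; exact: (eq_ind _ M h _ (reF (F k))).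
  by move=> x _; exact: cv.
apply: (eq_ind_r M _ (imF f)).
apply: (measurable_fun_cvg (h := fun k x => \sum_l complex.Im (c x l) * F k (eigen (W x) l))).
  move=> k; have [_ h] := mF k i j; exact: (eq_ind _ M h _ (imF (F k))).
by move=> x _; exact: cv.
Qed.

Lemma mxfun_meas_exp f : mxfun_meas f -> mxfun_meas (fun t => expR (f t)).
Proof.
move=> mf; apply: (@mxfun_meas_lim (fun k t => series (exp_coeff (f t)) k)); last first.
  by move=> t _; exact: expR_series_cvg.
have mX k : mxfun_meas (fun t => f t ^+ k).
  elim: k => [|k IH].
    by apply: (eq_mxfun_meas _ (mxfun_meas_cst 1)) => t; rewrite expr0.
  by apply: (eq_mxfun_meas _ (mxfun_measM mf IH)) => t; rewrite exprS.
elim => [|k IH].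
  by apply: (eq_mxfun_meas _ (mxfun_meas_cst 0)) => t; rewrite /series/= big_geq.
apply: (eq_mxfun_meas _ (mxfun_measD IH
  (mxfun_measM (mX k) (mxfun_meas_cst (k`!%:R)^-1)))) => t.
by rewrite seriesSr.
Qed.

(** The logarithm is a limit of Newton iterates, built from ring operations and
exponentials. *)
Lemma mxfun_meas_ln : mxfun_meas (@ln R).
Proof.
apply: (@mxfun_meas_lim (@newton_ln R)); last by move=> t; exact: newton_ln_cvg.
elim => [|k IH]; first exact: mxfun_meas_cst.
have mN : mxfun_meas (fun t => - newton_ln k t).
  by apply: (eq_mxfun_meas _ (mxfun_measM (mxfun_meas_cst (-1)) IH)) => t; rewrite mulN1r.
by apply: (eq_mxfun_meas _ (mxfun_measD (mxfun_measD IH (mxfun_meas_cst (-1)))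
  (mxfun_measM mxfun_meas_id (mxfun_meas_exp mN)))).
Qed.

(** A power is the exponential of a multiple of the logarithm. *)
Lemma mxpow_measurable s : mxmeas (fun x => mxpow (W x) s).
Proof.
have h := mxfun_meas_exp (mxfun_measM (mxfun_meas_cst s) mxfun_meas_ln).
have e x : mxfun (W x) (fun t => expR (s * ln t)) = mxpow (W x) s.
  apply: esym; apply: etrans (mxpowE _ _) _; apply: eq_mxfun => k.
  by rewrite /powR gt_eqF// eigen_gt0.
exact: (eq_ind _ mxmeas h _ (funext e)).
Qed.

Lemma mxpowK s x : mxpow (W x) s *m mxpow (W x) (- s) = 1%:M.
Proof.
apply: etrans (congr2 mulmx (mxpowE _ _) (mxpowE _ _)) _.
apply: etrans (mxfunM _ _ _) _; apply: etrans (@eq_mxfun _ _ _ _ (fun=> 1) _) (mxfun_cst _ _) => k.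
have l0 := eigen_gt0 k (pW x).
by rewrite -powRD ?subrr ?powRr0 ?(gt_eqF l0) ?eqxx.
Qed.

End MeasurablePower.

(** * Complex matrices as real matrices *)

Section Realification.
Context (R : realType) (n : nat).
Notation C := R[i].
Notation normc := ComplexField.Normc.normc.
Implicit Types (A B : 'M[C]_n) (v : 'cV[C]_n).

Definition real_vec v : 'rV[R]_(n + n) :=
  row_mx (\row_i complex.Re (v i 0)) (\row_i complex.Im (v i 0)).

Definition cplx_vec (z : 'rV[R]_(n + n)) : 'cV[C]_n :=
  \col_i (z 0 (lshift n i) +i* z 0 (rshift n i)).

(** A complex matrix acting on columns, as a real matrix acting on rows. *)
Definition real_mx A : 'M[R]_(n + n) :=
  block_mx (\matrix_(i, j) complex.Re (A j i)) (\matrix_(i, j) complex.Im (A j i))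
    (- \matrix_(i, j) complex.Im (A j i)) (\matrix_(i, j) complex.Re (A j i)).

Lemma cplx_vecK z : real_vec (cplx_vec z) = z.
Proof.
apply/rowP => i; rewrite /real_vec mxE; case: splitP => j ij; rewrite mxE mxE /=;
  by congr (z _ _); apply/val_inj; rewrite /= ij.
Qed.

Lemma ReD (x y : C) : complex.Re (x + y) = complex.Re x + complex.Re y.
Proof. by case: x; case: y. Qed.
Lemma ImD (x y : C) : complex.Im (x + y) = complex.Im x + complex.Im y.
Proof. by case: x; case: y. Qed.

Lemma Re_sum (I : finType) (F : I -> C) :
  complex.Re (\sum_i F i) = \sum_i complex.Re (F i).
Proof. by rewrite (big_morph _ ReD (erefl (complex.Re (0 : C)))). Qed.
Lemma Im_sum (I : finType) (F : I -> C) :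
  complex.Im (\sum_i F i) = \sum_i complex.Im (F i).
Proof. by rewrite (big_morph _ ImD (erefl (complex.Im (0 : C)))). Qed.

Lemma real_mulmx A v : real_vec (A *m v) = real_vec v *m real_mx A.
Proof.
rewrite /real_vec /real_mx mul_row_block; congr row_mx; apply/rowP => j.
  rewrite mxE [(A *m v) j 0]mxE Re_sum !mxE -big_split/=; apply: eq_bigr => k _.
  by rewrite !mxE; case: (A j k) => a b; case: (v k 0) => c e /=; ring.
rewrite mxE [(A *m v) j 0]mxE Im_sum !mxE -big_split/=; apply: eq_bigr => k _.
by rewrite !mxE; case: (A j k) => a b; case: (v k 0) => c e /=; ring.
Qed.

Lemma real_mx_inv A B : B *m A = 1%:M -> real_mx A *m real_mx B = 1%:M.
Proof.
move=> BA; apply/row_matrixP => i; rewrite !rowE mulmxA.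
rewrite -[delta_mx 0 i]cplx_vecK -!real_mulmx mulmxA BA mul1mx cplx_vecK.
by rewrite mulmx1.
Qed.

Definition l1 (z : 'rV[R]_(n + n)) : R := \sum_k `|z 0 k|.

Lemma normcE (z : C) : normc z = Num.sqrt (complex.Re z ^+ 2 + complex.Im z ^+ 2).
Proof. by case: z. Qed.

Lemma normc_ge0 (z : C) : 0 <= normc z.
Proof. by rewrite normcE sqrtr_ge0. Qed.

Lemma Re_le_normc (z : C) : `|complex.Re z| <= normc z.
Proof. by rewrite normcE -sqrtr_sqr ler_wsqrtr// lerDl sqr_ge0. Qed.

Lemma Im_le_normc (z : C) : `|complex.Im z| <= normc z.
Proof. by rewrite normcE -sqrtr_sqr ler_wsqrtr// lerDr sqr_ge0. Qed.

Lemma normc_le (z : C) : normc z <= `|complex.Re z| + `|complex.Im z|.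
Proof.
rewrite normcE -(@ger0_norm _ (`|_| + `|_|)) ?addr_ge0// -sqrtr_sqr ler_wsqrtr//.
rewrite sqrrD !real_normK ?num_real// -addrA lerD2l lerDr mulrn_wge0// mulr_ge0//.
Qed.

Lemma vnorm_ge0 v : 0 <= vnorm v. Proof. exact: sqrtr_ge0. Qed.

Lemma normc_le_vnorm v i : normc (v i 0) <= vnorm v.
Proof.
rewrite /vnorm -[leLHS](@ger0_norm _) ?normc_ge0// -sqrtr_sqr ler_wsqrtr//.
by rewrite (bigD1 i)//= lerDl sumr_ge0// => j _; exact: sqr_ge0.
Qed.

Lemma vnorm_le_sum v : vnorm v <= \sum_i normc (v i 0).
Proof.
rewrite /vnorm; have S0 : 0 <= \sum_i normc (v i 0).
  by apply: sumr_ge0 => i _; exact: normc_ge0.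
rewrite -[leRHS]ger0_norm// -sqrtr_sqr ler_wsqrtr//.
suff [] : 0 <= \sum_i normc (v i 0) /\
  \sum_i normc (v i 0) ^+ 2 <= (\sum_i normc (v i 0)) ^+ 2 by [].
apply: (big_rec2 (fun a b => 0 <= b /\ a <= b ^+ 2)); first by rewrite expr0n.
move=> i a b _ [b0 ab]; have c0 := normc_ge0 (v i 0); split; first exact: addr_ge0.
by rewrite sqrrD; have : 0 <= normc (v i 0) * b; [exact: mulr_ge0|lra].
Qed.

Lemma l1E v : l1 (real_vec v) = \sum_i (`|complex.Re (v i 0)| + `|complex.Im (v i 0)|).
Proof.
rewrite /l1 big_split_ord/= big_split/=; congr (_ + _); apply: eq_bigr => i _.
  by rewrite /real_vec row_mxEl mxE.
by rewrite /real_vec row_mxEr mxE.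
Qed.

Lemma vnorm_le_l1 v : vnorm v <= l1 (real_vec v).
Proof.
apply: (le_trans (vnorm_le_sum v)); rewrite l1E; apply: ler_sum => i _.
exact: normc_le.
Qed.

Lemma l1_le_vnorm v : l1 (real_vec v) <= (2 * n%:R) * vnorm v.
Proof.
rewrite l1E; apply: (@le_trans _ _ (\sum_(i < n) (2 * vnorm v))).
  apply: ler_sum => i _; have := Re_le_normc (v i 0); have := Im_le_normc (v i 0).
  have := normc_le_vnorm v i; lra.
by rewrite sumr_const card_ord -[leLHS]mulr_natr mulrAC.
Qed.

Lemma vnorm_eq0 v : vnorm v = 0 -> v = 0.
Proof.
move=> v0; apply/matrixP => i j; rewrite ord1 mxE.
have := normc_le_vnorm v i; rewrite v0 => h; apply: ComplexField.Normc.eq0_normc.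
by apply/eqP; rewrite eq_le h normc_ge0.
Qed.

Lemma vnormZ (c : R) v : 0 <= c -> vnorm (c%:C *: v) = c * vnorm v.
Proof.
move=> c0; rewrite /vnorm -[c in RHS](@ger0_norm _)// -sqrtr_sqr -sqrtrM ?sqr_ge0//.
congr Num.sqrt; rewrite mulr_sumr; apply: eq_bigr => i _; rewrite mxE ComplexField.Normc.normcM exprMn.
by congr (_ ^+ 2 * _); rewrite normcE /= expr0n addr0 sqrtr_sqr ger0_norm.
Qed.

Lemma opnorm_has_sup A : has_sup [set vnorm (A *m v) | v in [set v | vnorm v <= 1]].
Proof.
split.
  by exists (vnorm (A *m 0)), 0 => //=; rewrite /vnorm big1 ?sqrtr0// => i _;
    rewrite mxE ComplexField.Normc.normc0 expr0n.
exists (\sum_i \sum_j normc (A i j)) => _ [v /= v1 <-].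
apply: (le_trans (vnorm_le_sum _)); apply: ler_sum => i _; rewrite mxE.
apply: (@le_trans _ _ (\sum_j normc (A i j * v j 0))).
  elim/big_ind2: _ => [|x1 x2 y1 y2 h1 h2|//]; first by rewrite ComplexField.Normc.normc0.
  apply: le_trans (le_normcD _ _) _; exact: lerD.
apply: ler_sum => j _; rewrite ComplexField.Normc.normcM ler_piMr ?normc_ge0//.
exact: le_trans (normc_le_vnorm v j) v1.
Qed.

Lemma opnorm_bound A v : vnorm (A *m v) <= opnorm A * vnorm v.
Proof.
have [v0|v0] := eqVneq (vnorm v) 0.
  by rewrite (vnorm_eq0 v0) mulmx0 (_ : vnorm 0 = 0) ?mulr0// -v0 (vnorm_eq0 v0).
have vp : 0 < vnorm v by rewrite lt_neqAle eq_sym v0 vnorm_ge0.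
have vi : 0 <= (vnorm v)^-1 by rewrite invr_ge0 ltW.
rewrite -ler_pdivrMr// mulrC -vnormZ// scalemxAr; apply: ub_le_sup.
  exact: (opnorm_has_sup A).2.
by exists ((vnorm v)^-1%:C *: v) => //=; rewrite vnormZ// mulVf.
Qed.

Lemma opnorm_ge0 A : 0 <= opnorm A.
Proof.
have [[y [v hv _]] hub] := opnorm_has_sup A.
apply: le_trans (vnorm_ge0 (A *m v)) _; apply: ub_le_sup => //; by exists v.
Qed.

End Realification.

(** * The averaging inequality from the matrix A_p condition *)

Section LowerIntegral.
Import HBNNSimple.
Context (dsp : measure_display) (T : measurableType dsp) (R : realType).
Context (mu : {measure set T -> \bar R}).
Local Open Scope ereal_scope.

(** For functions that need not be measurable the integral is a lower integral,
still insensitive to null sets. *)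
Lemma ge0_le_integral_ae (A B N : set T) (f g : T -> \bar R) :
  measurable N -> mu N = 0 -> A `<=` B ->
  (forall x, A x -> 0 <= f x) -> (forall x, B x -> 0 <= g x) ->
  (forall x, A x -> ~ N x -> f x <= g x) ->
  \int[mu]_(x in A) f x <= \int[mu]_(x in B) g x.
Proof.
move=> mN N0 AB f0 g0 fg; rewrite [leLHS]ge0_integralE//.
apply: ge_ereal_sup => _ [h hf <-].
rewrite -integralT_nnsfun (ge0_negligible_integral mN)//; last first.
- by move=> x _; rewrite lee_fin; exact: fun_ge0.
- by apply/measurable_EFinP.
rewrite [leRHS]integral_mkcond; apply: ge0_le_integral_any => //.
- by move=> x _; rewrite lee_fin; exact: fun_ge0.
- by move=> x _; exact: erestrict_ge0.
move=> x [_ Nx]; apply: (le_trans (hf x)); rewrite !patchE; case: ifPn => [/set_mem Ax|_].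
  by rewrite mem_set; [exact: fg|exact: AB].
by case: ifPn => // /set_mem Bx; exact: g0.
Qed.

(** The lower integral is a supremum over simple functions, and these can be
divided by the constant. *)
Lemma ge0_integralZl_le (A : set T) (f : T -> \bar R) (c : R) : (0 <= c)%R ->
  (forall x, A x -> 0 <= f x) ->
  \int[mu]_(x in A) (c%:E * f x) <= c%:E * \int[mu]_(x in A) f x.
Proof.
rewrite le_eqVlt => /predU1P[<- f0|c0 f0].
  by rewrite mul0e; under eq_integral do rewrite mul0e; rewrite integral0.
rewrite [leLHS]ge0_integralE; last by move=> x Ax; apply: mule_ge0; [rewrite lee_fin ltW|exact: f0].
apply: ge_ereal_sup => _ [h hf <-].
rewrite -integralT_nnsfun.
have -> : \int[mu]_x (h x)%:E = \int[mu]_x (c%:E * (c^-1 * h x)%:E).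
  by apply: eq_integral => x _; rewrite -EFinM mulrA divff ?gt_eqF// mul1r.
have hc0 x : 0 <= (c^-1 * h x)%:E by rewrite lee_fin mulr_ge0 ?invr_ge0 ?(ltW c0)// fun_ge0.
have mhc : measurable_fun [set: T] (fun x => (c^-1 * h x)%:E).
  by apply/measurable_EFinP; apply: measurable_funM.
rewrite (ge0_integralZl_EFin _ measurableT _ mhc) ?(ltW c0)//.
apply: lee_wpmul2l; first by rewrite lee_fin ltW.
rewrite [leRHS]integral_mkcond; apply: ge0_le_integral_any => //.
- by move=> x _; exact: erestrict_ge0.
move=> x _; have := hf x; rewrite !patchE; case: ifPn => [_ hx|_].
  by rewrite EFinM muleC lee_pdivrMr// muleC.
by rewrite !lee_fin => hx; apply: mulr_ge0_le0 => //; rewrite invr_ge0 ltW.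
Qed.

(** The inverse is the power of exponent -1, with the same value at 0. *)
Lemma measurable_fun_ratio (f g : T -> R) : (forall x, (0 <= g x)%R) ->
  measurable_fun [set: T] f -> measurable_fun [set: T] g ->
  measurable_fun [set: T] (fun x => f x / g x)%R.
Proof.
move=> g0 mf mg; rewrite (_ : (fun x => _) = (fun x => f x * g x `^ (-1))%R).
  exact: (measurable_funM mf (measurableT_comp (measurable_powR (-1)) mg)).
by apply/funext => x; rewrite powRN powRr1.
Qed.

Lemma hoelder_on (D : set T) (f g : T -> R) (p q : R) : measurable D ->
  measurable_fun [set: T] f -> measurable_fun [set: T] g ->
  (forall x, (0 <= f x)%R) -> (forall x, (0 <= g x)%R) ->
  (0 < p)%R -> (0 < q)%R -> (p^-1 + q^-1 = 1)%R ->
  \int[mu]_(x in D) (f x * g x)%:E <=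
  (\int[mu]_(x in D) (f x `^ p)%:E) `^ p^-1 * (\int[mu]_(x in D) (g x `^ q)%:E) `^ q^-1.
Proof.
move=> mD mf mg f0 g0 p0 q0 pq.
pose f1 x := (f x * \1_D x)%R; pose g1 x := (g x * \1_D x)%R.
have m1 : measurable_fun [set: T] (\1_D : T -> R) by exact: measurable_indic.
have mf1 : measurable_fun [set: T] f1 by exact: measurable_funM.
have mg1 : measurable_fun [set: T] g1 by exact: measurable_funM.
have := @hoelder _ _ _ mu f1 g1 p q mf1 mg1 p0 q0 pq.
have powE (k : T -> R) (r : R) : (forall x, 0 <= k x)%R -> (0 < r)%R ->
    'N[mu]_r%:E[EFin \o (fun x => k x * \1_D x)%R] =
    (\int[mu]_(x in D) (k x `^ r)%:E) `^ r^-1.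
  move=> k0 r0; rewrite unlock; congr (_ `^ _); rewrite [RHS]integral_mkcond.
  apply: eq_integral => x _; rewrite patchE /= indicE; case: (x \in D).
    by rewrite mulr1 ger0_norm.
  by rewrite mulr0 normr0 powR0// gt_eqF.
rewrite !powE// Lnorm1 [X in X <= _ -> _](_ : _ = \int[mu]_(x in D) (f x * g x)%:E)//.
rewrite [RHS]integral_mkcond; apply: eq_integral => x _.
rewrite patchE /f1 /g1 /= indicE; case: (x \in D).
  by rewrite !mulr1 ger0_norm// mulr_ge0.
by rewrite !mulr0 normr0.
Qed.

End LowerIntegral.

Definition real_field (R : realType) (T : Type) (n : nat) (M : T -> 'M[R[i]]_n) (x : T) :=
  real_mx (M x).

Section MatrixAveraging.
Context (R : realType) (d n : nat) (p : R).
Notation T := (Rd R d).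
Notation leb := (@leb R d).
Notation C := R[i].
Hypothesis p_gt1 : 1 < p.
Context (W A B : T -> 'M[C]_n) (N : set T).
Hypothesis mN : measurable N.
Hypothesis N0 : (leb N = 0)%E.
Hypothesis mA : mxmeas A.
Hypothesis mB : mxmeas B.
Hypothesis BA : forall x, B x *m A x = 1%:M.
Hypothesis AW : forall x, ~ N x -> A x = mxpow (W x) p^-1.
Hypothesis BW : forall x, ~ N x -> B x = mxpow (W x) (- p^-1).
Hypothesis Wfin : (Ap_matrix p W < +oo)%E.
Local Open Scope ereal_scope.

Notation G := (real_field A).

Lemma real_mx_measurable (M : T -> 'M[C]_n) i j : mxmeas M ->
  measurable_fun [set: T] (fun x => real_mx (M x) i j).
Proof.
move=> mM; rewrite /real_mx.
have -> : (fun x => real_mx (M x) i j) = (fun x =>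
  match fintype.split i, fintype.split j with
  | inl k, inl l => complex.Re (M x l k)
  | inl k, inr l => complex.Im (M x l k)
  | inr k, inl l => - complex.Im (M x l k)
  | inr k, inr l => complex.Re (M x l k) end)%R.
  apply/funext => x; rewrite /real_mx /block_mx mxE; case: (fintype.split i) => k;
    by rewrite mxE; case: fintype.split => l; rewrite !mxE.
case: (fintype.split i) => k; case: (fintype.split j) => l; have [mr mi] := mM l k => //.
exact: measurable_funN.
Qed.

Lemma nu_l1 x (v : 'cV[C]_n) : nu G x (real_vec v) = l1 (real_vec (A x *m v)).
Proof. by rewrite /nu /l1 /real_field real_mulmx. Qed.

Let p0 : (0 < p)%R. Proof. exact: lt_trans p_gt1. Qed.
Let p' : R := (p / (p - 1))%R.
Let p'0 : (0 < p')%R. Proof. by rewrite divr_gt0// subr_gt0. Qed.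
Let conj_exp : (p'^-1 + p^-1 = 1)%R.
Proof. by rewrite /p'; field; rewrite !gt_eqF// subr_gt0. Qed.

Definition ApK : R := ((2 * n%:R) `^ p * fine (Ap_matrix p W))%R.

Lemma Ap_ge0 : 0 <= Ap_matrix p W.
Proof.
pose Q : set T := box 0%R (0 + const_mx 1)%R.
apply: (le_trans _ (ereal_sup_ubound _)); last first.
  by exists Q => //; exists 0%R, 1%R.
rewrite /average mule_ge0 ?lee_fin ?invr_ge0 ?fine_ge0//.
by apply: integral_ge0 => x _; exact: poweR_ge0.
Qed.

Lemma vnorm_measurable (v : T -> 'cV[C]_n) : (forall i, cmeas (fun x => v x i 0%R)) ->
  measurable_fun [set: T] (fun x => vnorm (v x)).
Proof.
move=> mv; apply: measurableT_comp; first exact: (continuous_measurable_fun (@sqrt_continuous R)).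
apply: measurable_sum => i; under eq_fun do rewrite normcE sqr_sqrtr ?addr_ge0 ?sqr_ge0//.
have [mr mi] := mv i.
by apply: measurable_funD; apply: measurable_funX.
Qed.

Section OneCube.
Context (Q : set T) (g : T -> 'rV[R]_(n + n)).
Hypothesis cQ : is_cube Q.
Hypothesis mg : vmeas g.

Let z y : 'cV[C]_n := cplx_vec (g y).
Let phi y : R := vnorm (A y *m z y).
Let Iphi := \int[leb]_(y in Q) (phi y `^ p)%:E.
Let q : R := fine (leb Q).

Lemma cube_measurable : measurable Q.
Proof. by have [a [l [_ ->]]] := cQ; exact: box_measurable. Qed.

Lemma cube_fin_pos : (0 < q)%R /\ leb Q = q%:E.
Proof.
rewrite /q; have [a [l [l0 ->]]] := cQ; split; last by rewrite leb_cube.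
by rewrite leb_cube//= exprn_gt0.
Qed.

Lemma cplx_meas i : cmeas (fun y => z y i 0%R).
Proof.
rewrite /z /cplx_vec; split.
  by rewrite (_ : (fun y => _) = (fun y => g y 0%R (lshift n i))) //; apply/funext => y; rewrite mxE.
by rewrite (_ : (fun y => _) = (fun y => g y 0%R (rshift n i))) //; apply/funext => y; rewrite mxE.
Qed.

Lemma vnorm_mul_measurable (M : T -> 'M[C]_n) : mxmeas M ->
  measurable_fun [set: T] (fun y => vnorm (M y *m z y)).
Proof.
move=> mM; apply: vnorm_measurable => i; under eq_fun do rewrite mxE.
by apply: cmeas_sum => k; apply: cmeasM; [exact: mM|exact: cplx_meas].
Qed.

Lemma phi_le_nu y : (phi y <= nu G y (g y))%R.
Proof. by rewrite -[g y]cplx_vecK nu_l1; exact: vnorm_le_l1. Qed.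

Lemma nu_le_vnorm x y : (nu G x (g y) <= 2 * n%:R * vnorm (A x *m z y))%R.
Proof. by rewrite -[g y]cplx_vecK nu_l1; exact: l1_le_vnorm. Qed.

Let Aavg x := average Q (fun y =>
  ((opnorm (mxpow (W x) p^-1 *m mxpow (W y) (- p^-1))) `^ p')%:E).

Lemma Aavg_ge0 x : 0 <= Aavg x.
Proof.
rewrite /Aavg /average mule_ge0 ?lee_fin ?invr_ge0 ?(ltW (proj1 cube_fin_pos))//.
by apply: integral_ge0 => y _; rewrite lee_fin powR_ge0.
Qed.

(** Write [A x z = (A x B y) (A y z)] and apply Hoelder's inequality to the
factors [opnorm (A x B y)] and [phi y]. The first factor need not be measurable; the
quotient [r] of the vector norms replaces it. *)
Lemma inner_hoelder x : ~ N x ->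
  (\int[leb]_(y in Q) (nu G x (g y))%:E) `^ p <=
  (((2 * n%:R) `^ p * q `^ (p / p'))%:E * Iphi) * (Aavg x) `^ (p / p').
Proof.
move=> Nx; have [q0 qE] := cube_fin_pos; have mQ := cube_measurable.
pose h y := vnorm (A x *m z y); pose r y := (h y / phi y)%R.
have mh : measurable_fun [set: T] h by apply: (@vnorm_mul_measurable (fun=> A x)) => i j; exact: cmeas_cst.
have mphi : measurable_fun [set: T] phi by exact: vnorm_mul_measurable.
have phi0 y : (0 <= phi y)%R by exact: vnorm_ge0.
have r0 y : (0 <= r y)%R := divr_ge0 (vnorm_ge0 _) (phi0 y).
have mr : measurable_fun [set: T] r := measurable_fun_ratio phi0 mh mphi.
have hr y : h y = (r y * phi y)%R.
  have [e|pn] := eqVneq (phi y) 0%R; last by rewrite /r divfK.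
  have Az := vnorm_eq0 e; have z0 : z y = 0%R by rewrite -[z y]mul1mx -(BA y) -mulmxA Az mulmx0.
  apply: (@etrans _ _ (phi y)); [by rewrite /h /phi z0 !mulmx0|by rewrite e mulr0].
have rop y : ~ N y -> (r y <= opnorm (mxpow (W x) p^-1 *m mxpow (W y) (- p^-1)))%R.
  move=> Ny; have [e|pn] := eqVneq (phi y) 0%R.
    by rewrite /r e invr0 mulr0; exact: opnorm_ge0.
  rewrite /r ler_pdivrMr ?lt_neqAle ?phi0 1?eq_sym ?pn//.
  have -> : h y = vnorm ((mxpow (W x) p^-1 *m mxpow (W y) (- p^-1)) *m (A y *m z y)).
    rewrite -(AW Nx) -(BW Ny) /h -mulmxA; congr (vnorm (_ *m _)).
    by rewrite mulmxA BA mul1mx.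
  exact: opnorm_bound.
have Ir : \int[leb]_(y in Q) (r y `^ p')%:E <= q%:E * Aavg x.
  rewrite /Aavg /average -/q muleA -EFinM divff ?gt_eqF// mul1e.
  apply: (ge0_le_integral_ae mN N0) => //; try by move=> y _; rewrite lee_fin powR_ge0.
  move=> y _ Ny; rewrite lee_fin; apply: ge0_ler_powR; rewrite ?nnegrE ?opnorm_ge0 ?(ltW p'0)//.
  exact: rop.
have I1 : \int[leb]_(y in Q) (nu G x (g y))%:E <= (2 * n%:R)%:E * \int[leb]_(y in Q) (h y)%:E.
  apply: le_trans (ge0_integralZl_le _ _ _); last 2 first.
  - by rewrite mulr_ge0.
  - by move=> y _; rewrite lee_fin vnorm_ge0.
  apply: ge0_le_integral_any => // y _; rewrite ?lee_fin ?nu_ge0//.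
    by rewrite mulr_ge0 ?vnorm_ge0// mulr_ge0.
  exact: nu_le_vnorm.
have I2 : \int[leb]_(y in Q) (h y)%:E <= (q%:E * Aavg x) `^ p'^-1 * Iphi `^ p^-1.
  under eq_integral do rewrite hr.
  apply: (le_trans (hoelder_on leb mQ mr mphi r0 phi0 p'0 p0 conj_exp)).
  apply: lee_wpmul2r; first exact: poweR_ge0.
  apply: gt0_ler_poweR; rewrite ?invr_ge0 ?(ltW p'0)//.
  - by rewrite in_itv/= leey andbT; apply: integral_ge0 => y _; rewrite lee_fin powR_ge0.
  - by rewrite in_itv/= leey andbT mule_ge0 ?Aavg_ge0// lee_fin ltW.
have h0 : 0 <= \int[leb]_(y in Q) (h y)%:E by apply: integral_ge0 => y _; rewrite lee_fin vnorm_ge0.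
have n0 : 0 <= (2 * n%:R)%:E :> \bar R by rewrite lee_fin mulr_ge0.
have A0 := Aavg_ge0 x.
have Iphi0 : 0 <= Iphi by apply: integral_ge0 => y _; rewrite lee_fin powR_ge0.
apply: (@le_trans _ _ (((2 * n%:R)%:E * ((q%:E * Aavg x) `^ p'^-1 * Iphi `^ p^-1)) `^ p)).
  apply: gt0_ler_poweR; first exact: ltW.
  - by rewrite in_itv/= leey andbT; apply: integral_ge0 => y _; rewrite lee_fin nu_ge0.
  - by rewrite in_itv/= leey andbT mule_ge0// mule_ge0// poweR_ge0.
  by apply: (le_trans I1); apply: lee_wpmul2l.
rewrite poweRM// ?mule_ge0 ?poweR_ge0// poweRM ?poweR_ge0//.
rewrite -!poweRrM mulVf ?gt_eqF// poweRe1// poweRM ?lee_fin ?(ltW q0)//.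
rewrite [(p'^-1 * p)%R]mulrC !poweR_EFin.
by rewrite EFinM -!muleA; apply: lee_wpmul2l; [rewrite lee_fin powR_ge0|apply: lee_wpmul2l; [rewrite lee_fin powR_ge0|rewrite muleC]].
Qed.

(** Integrate the pointwise estimate in [x]: the remaining average is the
A_p quantity of the cube. *)
Lemma averaging_from_Ap :
  \int[leb]_(y in Q) (nu G y (g y) `^ p)%:E < +oo ->
  \int[leb]_(x in Q) (\int[leb]_(y in Q) (nu G x (g y))%:E) `^ p <=
  (ApK * fine (leb Q) `^ p)%:E * \int[leb]_(y in Q) (nu G y (g y) `^ p)%:E.
Proof.
move=> fI; have [q0 qE] := cube_fin_pos.
have Iphi0 : 0 <= Iphi by apply: integral_ge0 => y _; rewrite lee_fin powR_ge0.
have Ile : Iphi <= \int[leb]_(y in Q) (nu G y (g y) `^ p)%:E.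
  apply: ge0_le_integral_any => // y _; rewrite ?lee_fin ?powR_ge0//.
  by apply: ge0_ler_powR; rewrite ?nnegrE ?nu_ge0 ?vnorm_ge0 ?(ltW p0) ?phi_le_nu.
have If : Iphi \is a fin_num := eq_ind_r is_true (le_lt_trans Ile fI) (ge0_fin_numE Iphi0).
apply: (@le_trans _ _ ((ApK * q `^ p)%:E * Iphi)); last first.
  apply: lee_wpmul2l => //; rewrite lee_fin mulr_ge0 ?powR_ge0//.
  by rewrite /ApK mulr_ge0 ?powR_ge0// fine_ge0// Ap_ge0.
pose c := ((2 * n%:R) `^ p * q `^ (p / p') * fine Iphi)%R.
have c0 : (0 <= c)%R := mulr_ge0 (mulr_ge0 (powR_ge0 _ _) (powR_ge0 _ _)) (fine_ge0 Iphi0).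
apply: (@le_trans _ _ (\int[leb]_(x in Q) (c%:E * (Aavg x) `^ (p / p')))).
  apply: (ge0_le_integral_ae mN N0) => //.
  - by move=> x _; exact: poweR_ge0.
  - by move=> x _; rewrite mule_ge0 ?poweR_ge0// lee_fin.
  by move=> x _ Nx; have := inner_hoelder Nx; rewrite /c [in X in _ -> X]EFinM fineK.
apply: (le_trans (ge0_integralZl_le _ _ _)) => //; first by move=> x _; exact: poweR_ge0.
have Apf : Ap_matrix p W \is a fin_num by rewrite ge0_fin_numE// Ap_ge0.
have le1 : \int[leb]_(x in Q) (Aavg x) `^ (p / p') <= q%:E * Ap_matrix p W.
  rewrite muleC -lee_pdivrMr// muleC.
  by apply: ereal_sup_ubound; exists Q.
apply: (@le_trans _ _ (c%:E * (q%:E * Ap_matrix p W))).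
  by apply: lee_wpmul2l => //; rewrite lee_fin.
rewrite -(fineK Apf) -(fineK If) -!EFinM lee_fin /c /ApK.
have -> : (q `^ p = q `^ (p / p') * q)%R.
  apply: (@etrans _ _ (q `^ (p / p') * q `^ 1)%R); last by rewrite powRr1 ?(ltW q0).
  rewrite -powRD ?(gt_eqF q0) ?implybT//; congr (_ `^ _)%R.
  by rewrite /p'; field; rewrite !gt_eqF// subr_gt0.
rewrite le_eqVlt; apply/orP; left; apply/eqP; ring.
Qed.

End OneCube.

End MatrixAveraging.

(** * The upper bound *)

Lemma box_compact (R : realType) (d : nat) (a b : 'rV[R]_d) : compact (box a b).
Proof.
have -> : box a b = [set x | forall i, `[a 0 i, b 0 i]%classic (x ord0 i)].
  by apply/seteqP; split => x /= h i; move: (h i); rewrite in_itv.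
by apply: (@rV_compact R d (fun i => `[a 0 i, b 0 i]%classic)) => i; exact: segment_compact.
Qed.

(** Local integrability gives measurability on each of countably
many compact boxes. *)
Lemma locally_integrable_measurable (R : realType) (d : nat) (g : Rd R d -> R) :
  locally_integrable_Rd g -> measurable_fun [set: Rd R d] g.
Proof.
move=> ig; pose E (k : nat) : set (Rd R d) := box (const_mx (- k%:R)) (const_mx k%:R).
have -> : [set: Rd R d] = \bigcup_k E k.
  apply/seteqP; split => // x _.
  exists (Num.bound (\sum_i `|(x : 'rV[R]_d) 0 i|)) => // i; rewrite [const_mx (- _) _ _]mxE [const_mx _ _ _]mxE.
  have := archi_boundP (sumr_ge0 (index_enum 'I_d) (fun j (_ : true) => normr_ge0 ((x : 'rV[R]_d) 0 j))).
  rewrite (bigD1 i)//= => h; rewrite -ler_norml; apply: ltW; apply: le_lt_trans h.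
  by rewrite lerDl sumr_ge0.
apply/measurable_fun_bigcup => [k|k]; first exact: box_measurable.
by apply/measurable_EFinP; have /integrableP[] := ig _ (@box_compact R d (const_mx (- k%:R)) (const_mx k%:R)).
Qed.

Lemma measurable_fun_patch (dsp : measure_display) (T : measurableType dsp) (R : realType)
    (N : set T) (c : R) (g : T -> R) :
  measurable N -> measurable_fun [set: T] g ->
  measurable_fun [set: T] (fun x => if x \in N then c else g x).
Proof.
move=> mN mg; have m1 : measurable_fun [set: T] (\1_N : T -> R) by exact: measurable_indic.
rewrite (_ : (fun x => _) = (fun x => \1_N x * c + (1 - \1_N x) * g x)); last first.
  by apply/funext => x; rewrite indicE; case: (x \in N); rewrite /= ?subrr ?subr0 ?mul1r ?mul0r ?addr0 ?add0r.
apply: measurable_funD; first exact: measurable_funM m1 (measurable_cst c).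
apply: measurable_funM => //; exact: measurable_funB.
Qed.

Lemma posdefmx1 (R : realType) (n : nat) : posdefmx (1%:M : 'M[R[i]]_n).
Proof.
split; first exact: hermitian1mx_subproof.
move=> v v0; rewrite mulmx1 mxE.
have vp k : 0 <= v^t* 0 k * v k 0 by rewrite !mxE mulrC mul_conjC_ge0.
rewrite lt_neqAle sumr_ge0// andbT eq_sym; apply: contra v0 => /eqP s0.
apply/eqP/matrixP => k j; rewrite ord1 mxE.
have /(_ k erefl)/eqP := psumr_eq0P (fun k _ => vp k) s0.
by rewrite !mxE mulrC mul_conjC_eq0 => /eqP.
Qed.

Lemma weak_bound_root (R : realType) (p cc c a s A j : R) : 0 < p -> 0 <= cc -> 0 <= c ->
  0 < a -> 0 <= s -> 0 <= A -> 0 <= j ->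
  s <= cc * (c * A) ^+ 2 / a `^ p * c * j ->
  a * s `^ p^-1 <= (cc * c ^+ 3) `^ p^-1 * A `^ (2 / p) * j `^ p^-1.
Proof.
move=> p0 cc0 c0 a0 s0 A0 j0 sle; have a0' := ltW a0.
have pn : p != 0 by rewrite gt_eqF.
apply: (ler_powR_inv p0); first by rewrite mulr_ge0 ?powR_ge0.
  by rewrite !mulr_ge0 ?powR_ge0.
have P0 (x r : R) : 0 <= x `^ r := powR_ge0 x r.
rewrite (powRM _ a0' (P0 _ _)) (powRM _ (mulr_ge0 (P0 _ _) (P0 _ _)) (P0 _ _)).
rewrite (powRM _ (P0 _ _) (P0 _ _)) -!powRrM.
rewrite mulVf// mulfVK// !powRr1 ?mulr_ge0 ?exprn_ge0// powR_mulrn//.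
apply: (le_trans (ler_wpM2l (powR_ge0 _ _) sle)).
rewrite le_eqVlt; apply/orP; left; apply/eqP; field.
by rewrite gt_eqF ?powR_gt0.
Qed.

Section MatrixWeakType.
Context (R : realType) (d n : nat) (p : R).
Notation T := (Rd R d).
Notation leb := (@leb R d).
Notation C := R[i].
Hypothesis n_gt0 : (0 < n)%N.
Hypothesis p_gt1 : 1 < p.
Context (W A B : T -> 'M[C]_n) (N : set T).
Hypothesis mN : measurable N.
Hypothesis N0 : (leb N = 0)%E.
Hypothesis mA : mxmeas A.
Hypothesis mB : mxmeas B.
Hypothesis AB : forall x, A x *m B x = 1%:M.
Hypothesis BA : forall x, B x *m A x = 1%:M.
Hypothesis AW : forall x, ~ N x -> A x = mxpow (W x) p^-1.
Hypothesis BW : forall x, ~ N x -> B x = mxpow (W x) (- p^-1).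
Local Open Scope ereal_scope.
Hypothesis Wfin : Ap_matrix p W < +oo.
Context (f : T -> 'cV[C]_n).
Hypothesis fLp : in_Lp_vec p f.

Let p0 : (0 < p)%R. Proof. exact: lt_trans p_gt1. Qed.
Let u y := real_vec (B y *m f y).

Let Bf_cmeas i : cmeas (fun y => (B y *m f y) i 0%R).
Proof.
rewrite (_ : (fun y => _) = (fun y => \sum_k B y i k * f y k 0)%R); last first.
  by apply/funext => y; rewrite mxE.
by apply: cmeas_sum => k; apply: cmeasM; [exact: mB|exact: (proj1 fLp k)].
Qed.

Let mu_u : vmeas u.
Proof.
move=> j; rewrite /u /real_vec /row_mx.
rewrite (_ : (fun y => _) = (fun y => match fintype.split j with
  | inl k => complex.Re ((B y *m f y) k 0%R)
  | inr k => complex.Im ((B y *m f y) k 0%R) end)); last first.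
  by apply/funext => y; rewrite mxE; case: fintype.split => k; rewrite mxE.
by case: fintype.split => k; have [] := Bf_cmeas k.
Qed.

Let J := \int[leb]_y (vnorm (f y) `^ p)%:E.

Let J0 : 0 <= J.
Proof. by apply: integral_ge0 => y _; rewrite lee_fin powR_ge0. Qed.

Let JE : Lp_norm_vec p f = J `^ p^-1.
Proof.
rewrite /Lp_norm_vec unlock; apply: (congr1 (fun z => z `^ p^-1)); apply: eq_integral => y _.
by rewrite abse_EFin (ger0_norm (vnorm_ge0 _)).
Qed.

Let J_fin : J < +oo.
Proof.
by have [_] := fLp; rewrite JE; apply: lty_poweRy; rewrite invr_eq0 gt_eqF.
Qed.

Let I_le : \int[leb]_y (nu (real_field A) y (u y) `^ p)%:E <= ((2 * n%:R) `^ p)%:E * J.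
Proof.
apply: le_trans (ge0_integralZl_le _ _ _); last 2 first.
- exact: powR_ge0.
- by move=> y _; rewrite lee_fin powR_ge0.
apply: ge0_le_integral_any => // y _; rewrite ?lee_fin ?mulr_ge0 ?powR_ge0//.
rewrite -powRM ?mulr_ge0 ?vnorm_ge0//.
have nu0' := nu_ge0 (real_field A) y (u y).
apply: ge0_ler_powR; rewrite ?nnegrE ?(ltW p0)//; first by rewrite mulr_ge0 ?vnorm_ge0// mulr_ge0.
rewrite (nu_l1 A y (B y *m f y)) mulmxA AB mul1mx; exact: l1_le_vnorm.
Qed.

Let Phi := christ_goldberg_max p W f.

Let Phi_ge0 x : 0 <= Phi x.
Proof.
pose Q : set T := box (x : 'rV[R]_d) ((x : 'rV[R]_d) + const_mx 1)%R.
apply: (le_trans _ (ereal_sup_ubound _)); last first.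
  exists Q => //; split; first by exists x, 1%R.
  by move=> i; rewrite lexx/= !mxE lerDl.
rewrite /average mule_ge0 ?lee_fin ?invr_ge0 ?fine_ge0//.
by apply: integral_ge0 => y _; rewrite lee_fin vnorm_ge0.
Qed.

(** Away from the null set [N] the vector norms of the maximal function are
dominated by [nu] applied to [u]. *)
Lemma level_sub_large_average (a : R) :
  [set x | a%:E < `|Phi x|] `<=` large_average_set (real_field A) u a `|` N.
Proof.
move=> x /=; rewrite gee0_abs ?Phi_ge0// => /ereal_sup_gt [_ [Q [cQ Qx] <-]] aQ.
have [Nx|Nx] := pselect (N x); [by right|left; exists Q; split => //].
have [a0 [l [l0 Qe]]] := cQ.
have q0 : (0 < fine (leb Q))%R by rewrite Qe leb_cube//= exprn_gt0.
have qE : leb Q = (fine (leb Q))%:E by rewrite Qe leb_cube.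
rewrite [X in _ * X < _]qE -lte_pdivlMr//.
apply: (lt_le_trans aQ); rewrite /average muleC; apply: lee_wpmul2r.
  by rewrite lee_fin invr_ge0 ltW.
apply: (ge0_le_integral_ae mN N0) => //.
- by move=> y _; rewrite lee_fin vnorm_ge0.
- by move=> y _; rewrite lee_fin nu_ge0.
move=> y _ Ny; rewrite lee_fin (nu_l1 A x (B y *m f y)) -(AW Nx) -(BW Ny) -mulmxA.
exact: vnorm_le_l1.
Qed.

Lemma large_average_bound (a : R) : (0 < a)%R ->
  leb (large_average_set (real_field A) u a) <=
  (cube_const d (n + n) p * (ApK p W) ^+ 2 / a `^ p * (2 * n%:R) `^ p)%:E * J.
Proof.
move=> a0.
have c0 : (0 <= cube_const d (n + n) p :> R)%R.
  by rewrite /cube_const /weak_const !mulr_ge0 ?powR_ge0 ?exprn_ge0.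
have I_fin : \int[leb]_y (nu (real_field A) y (u y) `^ p)%:E < +oo.
  by apply: (le_lt_trans I_le); apply: lte_mul_pinfty => //; rewrite lee_fin powR_ge0.
have K0 : (0 <= ApK p W)%R by rewrite mulr_ge0 ?powR_ge0// fine_ge0// Ap_ge0.
have nn0 : (0 < n + n)%N by rewrite addn_gt0 n_gt0.
have mG i j := real_mx_measurable i j mA.
have mH i j := real_mx_measurable i j mB.
have GH x : real_field A x *m real_field B x = 1%:M := real_mx_inv (BA x).
apply: (le_trans (cube_weak_type nn0 (ltW p_gt1) mG mH GH K0
  (averaging_from_Ap p_gt1 mN N0 mA BA AW BW Wfin) mu_u I_fin a0)).
rewrite [X in _ <= X * _]EFinM -muleA; apply: lee_wpmul2l; last exact: I_le.
by rewrite lee_fin; exact: divr_ge0 (mulr_ge0 c0 (sqr_ge0 _)) (powR_ge0 _ _).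
Qed.

Definition final_const : R := ((cube_const d (n + n) p * (2 * n%:R) `^ p ^+ 3) `^ p^-1)%R.

Lemma weak_bound :
  weak_Lnorm p Phi <= final_const%:E * Ap_matrix p W `^ (2 / p) * Lp_norm_vec p f.
Proof.
apply: ge_ereal_sup => _ [a /= a0 <-].
have Apf : Ap_matrix p W = (fine (Ap_matrix p W))%:E.
  by apply/esym/fineK; rewrite ge0_fin_numE// Ap_ge0.
have Jf : J = (fine J)%:E by apply/esym/fineK; rewrite ge0_fin_numE.
have A0 : (0 <= fine (Ap_matrix p W))%R by rewrite fine_ge0// Ap_ge0.
have j0 : (0 <= fine J)%R by rewrite fine_ge0.
have c0 : (0 <= cube_const d (n + n) p :> R)%R.
  by rewrite /cube_const /weak_const !mulr_ge0 ?powR_ge0 ?exprn_ge0.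
have S_le : leb [set x | a%:E < `|Phi x|] <=
    (cube_const d (n + n) p * (ApK p W) ^+ 2 / a `^ p * (2 * n%:R) `^ p * fine J)%:E.
  apply: (le_trans (le_lebesgue_outer (@level_sub_large_average a))).
  apply: (le_trans (outer_measureU2 (@lebesgue_outer R d) _ _)).
  rewrite [X in _ + X](_ : _ = 0); last exact: N0.
  by rewrite adde0 [X in _ <= X]EFinM -Jf; exact: large_average_bound.
rewrite JE Jf Apf !poweR_EFin -!EFinM.
set S := leb _ in S_le *.
have S0 : 0 <= S by exact: lebesgue_outer_ge0.
have Sf : S = (fine S)%:E by apply/esym/fineK; rewrite ge0_fin_numE// (le_lt_trans S_le) ?ltry.
move: S_le; rewrite Sf poweR_EFin -EFinM !lee_fin => S_le.
have s0 : (0 <= fine S)%R by rewrite fine_ge0.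
set K := fine (Ap_matrix p W) in A0 S_le *.
exact: (weak_bound_root p0 c0 (powR_ge0 _ _) a0 s0 A0 j0 S_le).
Qed.

End MatrixWeakType.

Theorem matrix_weak_type (R : realType) (d n : nat) (p : R) : (0 < n)%N -> 1 < p ->
  forall (W : Rd R d -> 'M[R[i]]_n) (f : Rd R d -> 'cV[R[i]]_n),
  matrix_weight W -> (Ap_matrix p W < +oo)%E -> in_Lp_vec p f ->
  (weak_Lnorm p (christ_goldberg_max p W f) <=
    (final_const d n p)%:E * Ap_matrix p W `^ (2 / p) * Lp_norm_vec p f)%E.
Proof.
move=> n0 p1 W f [hW iW [N [mN N0 sN]]] Wfin fLp.
(* changed on a null set so as to be positive definite everywhere *)
pose Wt x : 'M[R[i]]_n := if x \in N then 1%:M else W x.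
have mWt : mxmeas Wt.
  move=> i j; have [iR iI] := iW i j.
  have mR := locally_integrable_measurable iR; have mI := locally_integrable_measurable iI.
  split.
    rewrite (_ : (fun x => _) = (fun x => if x \in N then
        complex.Re ((1%:M : 'M[R[i]]_n) i j) else complex.Re (W x i j))).
      exact: measurable_fun_patch.
    by apply/funext => x; rewrite /Wt; case: (x \in N).
  rewrite (_ : (fun x => _) = (fun x => if x \in N then
      complex.Im ((1%:M : 'M[R[i]]_n) i j) else complex.Im (W x i j))).
    exact: measurable_fun_patch.
  by apply/funext => x; rewrite /Wt; case: (x \in N).
have pWt x : posdefmx (Wt x).
  rewrite /Wt; case: ifPn => [_|/negP Nx]; first exact: posdefmx1.
  by apply: contrapT => np; apply: Nx; rewrite inE; exact: sN.
have WtE x : ~ N x -> Wt x = W x by move=> Nx; rewrite /Wt memNset.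
have AB x : mxpow (Wt x) p^-1 *m mxpow (Wt x) (- p^-1) = 1%:M := mxpowK pWt _ _.
have BA x : mxpow (Wt x) (- p^-1) *m mxpow (Wt x) p^-1 = 1%:M.
  by have := mxpowK pWt (- p^-1) x; rewrite opprK.
exact: (@weak_bound R d n p n0 p1 W (fun x => mxpow (Wt x) p^-1)
  (fun x => mxpow (Wt x) (- p^-1)) N mN N0 (mxpow_measurable mWt pWt _)
  (mxpow_measurable mWt pWt _) AB BA
  (fun x Nx => congr1 (fun M => mxpow M _) (WtE x Nx))
  (fun x Nx => congr1 (fun M => mxpow M _) (WtE x Nx)) Wfin f fLp).
Qed.

(** * Averages of step functions over cubes *)

Section Slabs.
Context (R : realType) (d : nat) (i0 : 'I_d).
Notation T := (Rd R d).
Notation leb := (@leb R d).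

Definition brick (u v : R) (y : 'rV[R]_d) (h : R) : set T :=
  box (\row_i if i == i0 then u else y 0 i) (\row_i if i == i0 then v else y 0 i + h).

Lemma leb_brick u v y h : 0 <= h ->
  leb (brick u v y h) = (Num.max 0 (v - u) * h ^+ d.-1)%:E.
Proof.
move=> h0; rewrite /brick leb_box /box_vol; congr EFin.
rewrite (bigD1 i0)//= [in X in X * _]mxE [in X in X * _]mxE eqxx; congr (_ * _).
rewrite (eq_bigr (fun=> h)); last first.
  by move=> i ii; rewrite !mxE (negbTE ii) addrAC subrr add0r max_r.
by rewrite prodr_const cardC1 card_ord.
Qed.

Lemma brick_measurable u v y h : measurable (brick u v y h).
Proof. exact: box_measurable. Qed.

Definition slab (c r : R) : set T := [set x | `|(x : 'rV[R]_d) 0 i0 - c| <= r].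

Lemma slab_measurable c r : measurable (slab c r).
Proof.
rewrite (_ : slab c r = (fun x : T => (x : 'rV[R]_d) 0 i0) @^-1` `[c - r, c + r]).
  by rewrite -[X in measurable X]setTI; exact: coord_measurable.
by apply/seteqP; split => x; rewrite /slab /= in_itv/= ler_distl.
Qed.

Lemma slabE c r x : \1_(slab c r) x = (`|(x : 'rV[R]_d) 0 i0 - c| <= r)%R%:R :> R.
Proof. by rewrite indicE; congr ((nat_of_bool _)%:R); apply/idP/idP; rewrite inE. Qed.

Section OneCube.
Context (a : 'rV[R]_d) (l : R).
Hypothesis l0 : 0 < l.
Let Q : set T := box a (a + const_mx l).
Let al : R := a 0 i0.

(** Distance from [c] to the far end of the [i0]-th side. It is cut at 1
because all steps have radius at least 1, which makes the estimates uniform. *)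
Definition side_reach (c : R) : R := Num.max 1 (Num.max `|al - c| `|al + l - c|).

Lemma reach_ge1 c : 1 <= side_reach c. Proof. by rewrite /side_reach le_max lexx. Qed.

Lemma reach_gt0 c : 0 < side_reach c. Proof. exact: lt_le_trans (reach_ge1 c). Qed.

Lemma reach_ge c (x : T) : Q x -> `|(x : 'rV[R]_d) 0 i0 - c| <= side_reach c.
Proof.
move=> /(_ i0); rewrite [(a + _) 0 i0]mxE [const_mx _ _ _]mxE -/al => /andP[h1 h2].
rewrite /side_reach !le_max; apply/orP; right.
have [xc|xc] := leP c ((x : 'rV[R]_d) 0 i0); apply/orP.
  by right; rewrite ger0_norm ?subr_ge0// ler_normr lerD2r h2.
by left; rewrite ltr0_norm ?subr_lt0// ler_normr opprB opprB lerD2l lerN2 h1 orbT.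
Qed.

Lemma reach_ge_half c : l / 2 <= side_reach c.
Proof.
rewrite /side_reach !le_max; apply/orP; right; apply/orP.
have [h|h] := leP (l / 2) `|al - c|; [by left|right].
move: h; rewrite ltr_norml => /andP[h1 h2].
by apply: le_trans (ler_norm _); lra.
Qed.

(** Either the side reaches to at most twice the radius, and the bound exceeds
the whole measure; or the slab is met only if the side is long, of length at
least half of the reach. *)
Lemma slab_average c r : 1 <= r ->
  (leb (Q `&` slab c r) <= (4 * r / side_reach c * l ^+ d)%:E)%E.
Proof.
move=> r1; have r0 : 0 < r by exact: lt_le_trans r1.
have dE : l ^+ d = l * l ^+ d.-1 by rewrite -exprS prednK// (leq_ltn_trans _ (ltn_ord i0)).
have -> : Q `&` slab c r = brick (Num.max al (c - r)) (Num.min (al + l) (c + r)) a l.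
  apply/seteqP; split => x /=.
    move=> [Qx]; rewrite /slab /= ler_distl => /andP[h1 h2] i; rewrite !mxE.
    have := Qx i; rewrite !mxE; case: eqP => [-> /andP[h3 h4]|//].
    by rewrite ge_max le_min h1 h2 h3 h4.
  move=> Bx; split.
    move=> i; have := Bx i; rewrite !mxE; case: eqP => [->|//].
    by rewrite ge_max le_min => /andP[/andP[-> _] /andP[-> _]].
  have := Bx i0; rewrite !mxE eqxx ge_max le_min /slab /= ler_distl.
  by move=> /andP[/andP[_ ->] /andP[_ ->]].
rewrite leb_brick ?(ltW l0)// lee_fin dE mulrA ler_wpM2r ?exprn_ge0 ?(ltW l0)//.
have m0 := reach_gt0 c.
rewrite ge_max; apply/andP; split.
  by rewrite !mulr_ge0 ?invr_ge0 ?(ltW m0) ?(ltW r0) ?(ltW l0).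
rewrite mulrAC ler_pdivlMr//.
have m1 : Num.min (al + l) (c + r) - Num.max al (c - r) <= l.
  by rewrite lerBlDr; apply: le_trans (_ : al + l <= _); rewrite ?ge_min ?lexx// addrC lerD2l le_max lexx.
have m2 : Num.min (al + l) (c + r) - Num.max al (c - r) <= 2 * r.
  rewrite lerBlDr; apply: le_trans (_ : c + r <= _); rewrite ?ge_min ?lexx ?orbT//.
  have : c - r <= Num.max al (c - r) by rewrite le_max lexx orbT.
  lra.
set w := _ - _ in m1 m2 *.
have [w0|w0] := leP w 0.
  by apply: (@le_trans _ _ 0); [rewrite mulr_le0_ge0// ltW|rewrite !mulr_ge0// ltW].
have [h|h] := leP (side_reach c) (2 * r).
  by have := ler_pM (ltW w0) (ltW m0) m1 h; nra.
(* the slab is met but does not contain the side, so the cube is long *)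
have hl : side_reach c <= 2 * l.
  have u1 : al <= c + r.
    rewrite leNgt; apply/negP => hh; move: w0; rewrite /w ltNge => /negP; apply.
    rewrite subr_le0; apply: le_trans (_ : c + r <= _); first by rewrite ge_min lexx orbT.
    by rewrite le_max (ltW hh).
  have u2 : c - r <= al + l.
    rewrite leNgt; apply/negP => hh; move: w0; rewrite /w ltNge => /negP; apply.
    rewrite subr_le0; apply: le_trans (_ : al + l <= _); first by rewrite ge_min lexx.
    by rewrite le_max (ltW hh) orbT.
  have hr : side_reach c <= r + l.
    rewrite /side_reach !ge_max; apply/and3P; split; first by lra.
      by rewrite ler_norml; apply/andP; split; lra.
    by rewrite ler_norml; apply/andP; split; lra.
  lra.
by have := ler_pM (ltW w0) (ltW m0) m2 hl; nra.
Qed.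

Lemma step_average (I : finType) (g : T -> R) (k : R) (C c r : I -> R) :
  0 <= k -> (forall j, 0 <= C j) -> (forall j, 1 <= r j) ->
  (forall x, Q x -> 0 <= g x) ->
  (forall x, Q x -> g x <= k + \sum_j C j * \1_(slab (c j) (r j)) x) ->
  (average Q (EFin \o g) <= (k + \sum_j C j * (4 * r j / side_reach (c j)))%:E)%E.
Proof.
move=> k0 C0 r1 g0 gle.
have lQ : leb Q = (l ^+ d)%:E by exact: leb_cube.
have ld : 0 < l ^+ d by rewrite exprn_gt0.
have mQ : measurable Q by exact: box_measurable.
rewrite /average lQ /= lee_pdivrMl//.
apply: (@le_trans _ _ (\int[leb]_(x in Q) (k + \sum_j C j * \1_(slab (c j) (r j)) x)%:E)%E).
  apply: ge0_le_integral_any => // x Qx.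
  by rewrite lee_fin addr_ge0// sumr_ge0// => j _; rewrite mulr_ge0// indicE ler0n.
have mI j : measurable_fun Q (EFin \o (\1_(slab (c j) (r j)) : T -> R)).
  by apply/measurable_EFinP; apply: measurable_funTS; apply: measurable_indic; exact: slab_measurable.
have mC j : measurable_fun Q (fun x => (C j * \1_(slab (c j) (r j)) x)%:E).
  apply/measurable_EFinP; apply: measurable_funM => //; exact/measurable_EFinP.
under eq_integral => x _ do rewrite EFinD -sumEFin.
rewrite ge0_integralD//; last 2 first.
- by move=> x _; apply: sume_ge0 => j _; rewrite lee_fin mulr_ge0// indicE ler0n.
- exact: emeasurable_sum.
rewrite ge0_integral_sum//; last by move=> j x _; rewrite lee_fin mulr_ge0// indicE ler0n.
have S0 : 0 <= \sum_j C j * (4 * r j / side_reach (c j)).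
  apply: sumr_ge0 => j _; apply: mulr_ge0 => //; apply: divr_ge0; last exact: ltW (reach_gt0 _).
  by apply: mulr_ge0 => //; apply: le_trans (r1 j).
rewrite integral_cst// [X in (_ * X + _)%E]lQ [X in (_ <= _ * X)%E]EFinD ge0_muleDr ?lee_fin//.
apply: leeD; first by rewrite muleC.
rewrite -EFinM mulr_sumr -sumEFin; apply: lee_sum => j _.
under eq_integral => x _ do rewrite EFinM.
rewrite ge0_integralZl_EFin//; last exact: mI.
rewrite integral_indic//; last exact: slab_measurable.
rewrite mulrCA EFinM; apply: lee_wpmul2l; first by rewrite lee_fin.
by rewrite setIC mulrC; exact: slab_average.
Qed.

End OneCube.
End Slabs.

(** * A weight with bumps at every scale *)

Section Profile.
Context (R : realType) (p : R) (m : nat).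
Hypothesis p_gt1 : 1 < p.
Hypothesis p_lt2 : p < 2.
Hypothesis m_gt0 : (0 < m)%N.

Let q := p - 1.
Let q0 : 0 < q. Proof. by rewrite subr_gt0. Qed.
Let q1 : q <= 1. Proof. by rewrite lerBlDr ltW. Qed.
Let p0 : 0 < p. Proof. exact: lt_trans p_gt1. Qed.
Let L : R := 8 ^+ m.
Let m1 : 1 <= m%:R :> R. Proof. by rewrite ler1n. Qed.
Let L1 : 1 <= L. Proof. by rewrite exprn_ege1// ler1n. Qed.

Lemma powR_le_self (x : R) : 1 <= x -> x `^ q <= x.
Proof.
by move=> x1; rewrite -[leRHS]powRr1 ?(le_trans _ x1)//; apply: ler_powR.
Qed.

Lemma le_powR (x y : R) : 0 <= x -> x <= y -> x `^ q <= y `^ q.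
Proof.
by move=> x0 xy; apply: ge0_ler_powR; rewrite ?nnegrE ?(le_trans x0 xy)// ltW.
Qed.

Lemma ge1_powR (x : R) : 1 <= x -> 1 <= x `^ q.
Proof. by move=> x1; apply: le_trans (le_powR ler01 x1); rewrite powR1. Qed.

(** The power [p - 1] makes the dual weight [1 / (m min(r, 8^m))]. *)
Definition base (r : R) : R := if r <= 1 then 1 else (m%:R * Num.min r L) `^ q.

Lemma base_ge1 r : 1 <= base r.
Proof.
rewrite /base; case: (leP r 1) => // r1; apply: ge1_powR.
by rewrite -[leLHS]mulr1; apply: ler_pM => //; rewrite le_min (ltW r1).
Qed.

Lemma base_le r M : r <= M -> 1 <= M -> base r <= (m%:R * Num.min M L) `^ q.
Proof.
move=> rM M1; have h : 1 <= Num.min M L by rewrite le_min M1.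
rewrite /base; case: (leP r 1) => r1.
  by apply: ge1_powR; rewrite -[leLHS]mulr1; apply: ler_pM.
have r0 : 0 <= Num.min r L by rewrite le_min !(le_trans ler01) ?(ltW r1).
apply: le_powR; first exact: mulr_ge0.
by apply: ler_wpM2l => //; rewrite le_min !ge_min rM lexx orbT.
Qed.

(** Heights and radii of the steps of the [j]-th bump: a unit core of height
[m], then steps approximating the inverse of the distance up to [8 ^+ j]. *)
Definition step_height (j : nat) (o : option 'I_m) : R :=
  if o is Some i then if (i < j)%N then (8 ^+ i.+1)^-1 else 0 else m%:R.
Definition step_radius (o : option 'I_m) : R := if o is Some i then 8 ^+ i.+1 else 1.

Lemma step_height_ge0 j o : 0 <= step_height j o.
Proof. by case: o => [i|] //=; case: ifP => // _; rewrite invr_ge0 exprn_ge0. Qed.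

Lemma step_radius_ge1 o : 1 <= step_radius o.
Proof. by case: o => [i|] //=; rewrite exprn_ege1// ler1n. Qed.

Lemma step_sum j : \sum_o step_height j o * step_radius o <= 2 * m%:R.
Proof.
rewrite (bigD1 None)//= mulr1 mulr_natl mulr2n lerD2l.
apply: (@le_trans _ _ (\sum_(o : option 'I_m | o != None) 1)).
  apply: ler_sum => -[i _|//] /=; case: ifP => _; last by rewrite mul0r.
  by rewrite mulVf// expf_neq0.
by rewrite sumr_const cardC1 card_option card_ord.
Qed.

Definition bump (j : nat) (y : R) : R := \sum_o step_height j o * (`|y| <= step_radius o)%R%:R.

Lemma bump_ge0 j y : 0 <= bump j y.
Proof. by apply: sumr_ge0 => o _; rewrite mulr_ge0 ?step_height_ge0 ?ler0n. Qed.

Lemma bump_ge j y o : `|y| <= step_radius o -> step_height j o <= bump j y.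
Proof.
move=> yo; rewrite /bump (bigD1 o)//= yo mulr1 lerDl sumr_ge0// => o' _.
by rewrite mulr_ge0 ?step_height_ge0 ?ler0n.
Qed.

Lemma bump_core j y : `|y| <= 1 -> m%:R <= bump j y.
Proof. by move=> y1; exact: (@bump_ge j y None). Qed.

Lemma bump_support j y : (8 ^+ j < `|y|) -> bump j y = 0.
Proof.
move=> jy; apply: big1 => o _.
have [h|_] := boolP (`|y| <= step_radius o); last by rewrite mulr0.
case: o h => [i|] /= h.
  case: ifP => ij; last by rewrite mul0r.
  have := lt_le_trans jy h; rewrite ltNge ler_eXn2l ?ltr1n//; last by rewrite ij.
have := lt_le_trans jy h; rewrite ltNge exprn_ege1// ler1n//.
Qed.

Lemma scale_exists (j : nat) (y : R) : 1 < y -> y <= 8 ^+ j ->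
  exists2 i, (i < j)%N & 8 ^+ i < y <= 8 ^+ i.+1.
Proof.
elim: j => [|j IH] y1 yj; first by rewrite expr0 leNgt y1 in yj.
have [h|h] := leP y (8 ^+ j); last by exists j => //; rewrite h yj.
by have [i ij hi] := IH y1 h; exists i => //; exact: leqW.
Qed.

(** Each step has the height of the inverse of its radius, and consecutive
radii have ratio 8. *)
Lemma bump_lower j y : (j <= m)%N -> `|y| <= 8 ^+ j ->
  (8 * Num.max 1 `|y|)^-1 <= bump j y.
Proof.
move=> jm yj; have [y1|y1] := leP `|y| 1.
  apply: le_trans (bump_core j y1); apply: le_trans m1.
  by rewrite mulr1 invf_le1// ler1n.
have [i ij /andP[h1 h2]] := scale_exists y1 yj.
have im : (i < m)%N := leq_trans ij jm.
apply: le_trans (@bump_ge j y (Some (Ordinal im)) h2); rewrite /= ij.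
by rewrite lef_pV2 ?posrE ?mulr_gt0 ?exprn_gt0 ?(lt_trans _ y1)// exprS ler_wpM2l// ltW.
Qed.

(** The bumps live on the disjoint intervals from [2 * 8^j] to [4 * 8^j], on one
side of the origin. *)
Definition profile (t : R) : R :=
  base `|t| + \sum_(j < m) (8 ^+ j) `^ p * bump j (t - 3 * 8 ^+ j).

Lemma profile_ge_base t : base `|t| <= profile t.
Proof.
by rewrite /profile lerDl sumr_ge0// => j _; rewrite mulr_ge0 ?powR_ge0 ?bump_ge0.
Qed.

Lemma profile_ge_bump (j : 'I_m) t :
  (8 ^+ j) `^ p * bump j (t - 3 * 8 ^+ j) <= profile t.
Proof.
rewrite /profile (bigD1 j)//= addrCA lerDl addr_ge0//.
  exact: le_trans (base_ge1 _).
by rewrite sumr_ge0// => k _; rewrite mulr_ge0 ?powR_ge0 ?bump_ge0.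
Qed.

Lemma profile_ge1 t : 1 <= profile t.
Proof. exact: le_trans (base_ge1 _) (profile_ge_base t). Qed.

(** Heights of the steps of a majorant of the dual weight; the step containing
the unit interval has height 1. *)
Definition dual_height (o : option 'I_m) : R :=
  if o is Some i then (8 ^+ i)^-1 / m%:R else 1.

Lemma dual_le t : profile t `^ (- q^-1) <=
  L^-1 + \sum_o dual_height o * (`|t| <= step_radius o)%R%:R.
Proof.
have pt0 : 0 < profile t by exact: lt_le_trans (profile_ge1 t).
have b0 : 0 < base `|t| by exact: lt_le_trans (base_ge1 _).
have d0 o : 0 <= dual_height o by case: o => [i|] //=; rewrite divr_ge0// invr_ge0 exprn_ge0.
have term o : `|t| <= step_radius o ->
    dual_height o <= L^-1 + \sum_o dual_height o * (`|t| <= step_radius o)%R%:R.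
  move=> ho; rewrite (bigD1 o)//= ho mulr1 addrCA lerDl addr_ge0 ?invr_ge0 ?exprn_ge0//.
  by rewrite sumr_ge0// => o' _; rewrite mulr_ge0 ?ler0n.
apply: (@le_trans _ _ (base `|t| `^ (- q^-1))).
  rewrite !powRN lef_pV2 ?posrE ?powR_gt0//.
  by apply: ge0_ler_powR; rewrite ?nnegrE ?invr_ge0 ?(ltW q0) ?(ltW pt0) ?(ltW b0) ?profile_ge_base.
rewrite /base; case: (leP `|t| 1) => t1.
  by rewrite powR1; exact: (@term None).
have tl : 0 < Num.min `|t| L by rewrite lt_min (lt_trans ltr01 t1) (lt_le_trans ltr01 L1).
rewrite -powRrM mulrN mulfV ?gt_eqF// powRN powRr1; last by rewrite mulr_ge0// ltW.
have [tL|Lt] := leP `|t| L.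
  have [i im /andP[h1 h2]] := scale_exists t1 tL.
  apply: le_trans (@term (Some (Ordinal im)) h2); rewrite /= invfM mulrC.
  apply: ler_wpM2r; first by rewrite invr_ge0.
  by rewrite lef_pV2 ?posrE ?exprn_gt0 ?(lt_trans _ t1)// ltW.
apply: (@le_trans _ _ L^-1).
  rewrite lef_pV2 ?posrE ?mulr_gt0 ?(lt_le_trans ltr01 L1) ?(lt_le_trans ltr01 m1)//.
  by rewrite ler_peMl// (le_trans ler01).
by rewrite lerDl sumr_ge0// => o _; rewrite mulr_ge0 ?ler0n.
Qed.

(** Each of the [m] scales contributes [32 / m]: the average of the dual weight
near the origin does not grow with [m]. *)
Lemma dual_sum : \sum_o dual_height o * (4 * step_radius o) <= 36.
Proof.
rewrite (bigD1 None)//= mul1r mulr1 -[leRHS]/(4 + 32)%:R natrD lerD2l.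
apply: (@le_trans _ _ (\sum_(o : option 'I_m | o != None) 32 / m%:R)).
  apply: ler_sum => -[i _|//] /=; rewrite exprS le_eqVlt; apply/orP; left; apply/eqP.
  by field; rewrite pnatr_eq0 -lt0n m_gt0 expf_neq0.
rewrite sumr_const cardC1 card_option card_ord /= -[leLHS]mulr_natr divfK//.
by rewrite pnatr_eq0 -lt0n.
Qed.

Lemma geometric_sum_le (n : nat) (X : R) : 0 <= X ->
  \sum_(j < n | 8 ^+ j <= X) 8 ^+ j <= 2 * X.
Proof.
move=> X0; have full k : \sum_(j < k) 8 ^+ j <= (8 ^+ k : R).
  elim: k => [|k IH]; first by rewrite big_ord0 expr0.
  rewrite big_ord_recr/= exprS; have : 0 <= 8 ^+ k :> R by rewrite exprn_ge0.
  lra.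
elim: n => [|n IH]; first by rewrite big_ord0 mulr_ge0.
rewrite big_mkcond big_ord_recr/= -big_mkcond/=; case: ifP => [h|_]; last by rewrite addr0.
rewrite mulr_natl mulr2n; apply: lerD => //; apply: le_trans h; apply: le_trans (full n).
rewrite [leLHS]big_mkcond; apply: ler_sum => j _; case: ifP => // _; exact: exprn_ge0.
Qed.

End Profile.

(** * The A_p constant of the weight *)

Section WeightConstant.
Context (R : realType) (d : nat) (i0 : 'I_d) (p : R) (m : nat).
Hypothesis p_gt1 : 1 < p.
Hypothesis p_lt2 : p < 2.
Hypothesis m_gt0 : (0 < m)%N.
Notation T := (Rd R d).
Notation leb := (@leb R d).

Let q := p - 1.
Let q0 : 0 < q. Proof. by rewrite subr_gt0. Qed.
Let q1 : q <= 1. Proof. by rewrite lerBlDr ltW. Qed.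
Let p0 : 0 < p. Proof. exact: lt_trans p_gt1. Qed.
Let powR_le1 (x : R) : 0 <= x -> x <= 1 -> x `^ q <= 1.
Proof. by move=> x0 x1; have := le_powR p_gt1 x0 x1; rewrite powR1. Qed.
Let L : R := 8 ^+ m.
Let m1 : 1 <= m%:R :> R. Proof. by rewrite ler1n. Qed.
Let L1 : 1 <= L. Proof. by rewrite exprn_ege1// ler1n. Qed.
Let s (j : nat) : R := 8 ^+ j.
Let s1 j : 1 <= s j. Proof. by rewrite exprn_ege1// ler1n. Qed.
Let s0 j : 0 < s j. Proof. exact: lt_le_trans (s1 j). Qed.

Definition weight (x : T) : R := profile p m ((x : 'rV[R]_d) 0 i0).

Lemma weight_measurable : measurable_fun [set: T] weight.
Proof.
apply: measurable_funD.
  rewrite (_ : (fun x => _) = (fun x : T => if x \in slab i0 0 1 then 1 else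
      (m%:R * Num.min `|(x : 'rV[R]_d) 0 i0| L) `^ q)).
    apply: measurable_fun_patch; first exact: slab_measurable.
    have mc : measurable_fun [set: T] (fun x : T => `|(x : 'rV[R]_d) 0 i0|).
      exact: measurableT_comp (@normr_measurable R setT) (@coord_measurable R d i0).
    have mm := measurable_minr mc (measurable_cst L).
    apply: (measurableT_comp (measurable_powR q)).
    apply: measurable_funM; first exact: measurable_cst.
    exact: mm.
  apply/funext => x; rewrite /base; have -> // : (x \in slab i0 0 1) = (`|(x : 'rV[R]_d) 0 i0| <= 1).
  by apply/idP/idP; rewrite inE /slab /= subr0.
apply: measurable_sum => j; apply: measurable_funM; first exact: measurable_cst.
apply: measurable_sum => o; apply: measurable_funM; first exact: measurable_cst.
rewrite (_ : (fun x => _) = (\1_(slab i0 (3 * 8 ^+ j) (step_radius R o)) : T -> R)).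
  by apply: measurable_indic; exact: slab_measurable.
by apply/funext => x; rewrite slabE.
Qed.

Section OneCube.
Context (a : 'rV[R]_d) (l : R).
Hypothesis l0 : 0 < l.
Let Q : set T := box a (a + const_mx l).
Notation reach := (side_reach i0 a l).
Notation coord x := ((x : 'rV[R]_d) 0 i0).

Let M := reach 0.
Let Mh := Num.min M L.
Let M1 : 1 <= M. Proof. exact: reach_ge1. Qed.
Let Mh1 : 1 <= Mh. Proof. by rewrite le_min M1. Qed.

Let coord_le (x : T) : Q x -> `|coord x| <= M.
Proof. by move=> Qx; rewrite -[coord x]subr0; exact: reach_ge. Qed.

(** A step averages to at most its mass over the reach of the side from its
centre, up to a constant; so does a bump, whose mass is of order [m s_j^p]. *)
Lemma weight_average (S : pred 'I_m) :
  (forall j x, ~~ S j -> Q x -> bump m j (coord x - 3 * s j) = 0) ->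
  (average Q (EFin \o weight) <=
   ((m%:R * Mh) `^ q + \sum_(j | S j) s j `^ p * (8 * m%:R / reach (3 * s j)))%:E)%E.
Proof.
move=> S0; pose C (jo : 'I_m * option 'I_m) : R := (S jo.1)%:R * s jo.1 `^ p * step_height R jo.1 jo.2.
apply: (@le_trans _ _ ((m%:R * Mh) `^ q + \sum_jo C jo * (4 * step_radius R jo.2 / reach (3 * s jo.1)))%:E).
  apply: (@step_average R d i0 a l l0 _ weight ((m%:R * Mh) `^ q) C (fun jo => 3 * s jo.1) (fun jo => step_radius R jo.2)).
  - exact: powR_ge0.
  - by move=> jo; rewrite !mulr_ge0 ?powR_ge0 ?step_height_ge0.
  - by move=> jo; exact: step_radius_ge1.
  - by move=> x _; apply: le_trans ler01 (profile_ge1 _ _ _).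
  move=> x Qx; rewrite /weight /profile; apply: lerD.
    by apply: base_le => //; exact: coord_le.
  rewrite -(pair_bigA _ (fun j o => C (j, o) * \1_(slab i0 (3 * s j) (step_radius R o)) x))/=.
  apply: ler_sum => j _; have [Sj|nSj] := boolP (S j); last first.
    by rewrite -/(s j) (S0 j x nSj Qx) mulr0 sumr_ge0// => o _; rewrite /C/= (negbTE nSj) !mul0r.
  rewrite /bump mulr_sumr; apply: ler_sum => o _.
  by rewrite slabE /C /= Sj mul1r mulrA.
rewrite lee_fin lerD2l.
rewrite -(pair_bigA _ (fun j o => C (j, o) * (4 * step_radius R o / reach (3 * s j))))/=.
rewrite [leRHS]big_mkcond; apply: ler_sum => j _.
rewrite /C /=; case: (S j); last by rewrite big1// => o _; rewrite !mul0r.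
have r0 : 0 < reach (3 * s j) := reach_gt0 _ _ _ _.
under eq_bigr do rewrite mul1r -mulrA; rewrite -mulr_sumr ler_wpM2l ?powR_ge0//.
rewrite ler_pdivlMr// mulr_suml.
rewrite (eq_bigr (fun o => 4 * (step_height R j o * step_radius R o))); last first.
  by move=> o _; field; rewrite gt_eqF.
by rewrite -mulr_sumr; have := @step_sum R m j; lra.
Qed.

(** Valid for every cube; 37 is 36 from [dual_sum] plus 1 from the constant
value beyond the last scale. *)
Lemma dual_average :
  (average Q (fun x => epow (weight x) (- (p - 1)^-1)) <= (37 / Mh)%:E)%E.
Proof.
have wp x : 0 < weight x by apply: lt_le_trans (profile_ge1 _ _ _).
have -> : (fun x => epow (weight x) (- (p - 1)^-1)) =
    EFin \o (fun x => weight x `^ (- q^-1)).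
  by apply/funext => x; rewrite /epow gt_eqF.
apply: (le_trans (@step_average R d i0 a l l0 _ _ L^-1 (@dual_height R m)
    (fun=> 0) (@step_radius R m) _ _ _ _ _)).
- by rewrite invr_ge0 (le_trans ler01).
- by case=> [i|] //=; rewrite divr_ge0// invr_ge0 exprn_ge0.
- by move=> o; exact: step_radius_ge1.
- by move=> x _; exact: powR_ge0.
- move=> x _; apply: (le_trans (dual_le _ _ _)) => //.
  by rewrite lerD2l; apply: ler_sum => o _; rewrite slabE subr0.
rewrite lee_fin; under eq_bigr do rewrite mulrA; rewrite -mulr_suml -/M.
have h := @dual_sum R m m_gt0.
have M0 : 0 < M by exact: lt_le_trans M1.
have Mh0 : 0 < Mh by exact: lt_le_trans Mh1.
have e1 : L^-1 <= Mh^-1 by rewrite lef_pV2 ?posrE ?(lt_le_trans ltr01 L1)// ge_min lexx orbT.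
have e2 : M^-1 <= Mh^-1 by rewrite lef_pV2 ?posrE// ge_min lexx.
have e3 : (\sum_(o : option 'I_m) dual_height R o * (4 * step_radius R o)) / M <= 36 / Mh.
  apply: (ler_pM _ _ h e2); last by rewrite invr_ge0 ltW.
  apply: sumr_ge0 => o _; apply: mulr_ge0; last by rewrite mulr_ge0// (le_trans ler01)// step_radius_ge1.
  by case: o => [i|] //=; rewrite divr_ge0// invr_ge0 exprn_ge0.
lra.
Qed.

Lemma dual_average_cst (w0 : R) : 0 < w0 -> (forall x, Q x -> w0 <= weight x) ->
  (average Q (fun x => epow (weight x) (- (p - 1)^-1)) <= (w0 `^ (- q^-1))%:E)%E.
Proof.
move=> w00 w0w.
have wp x : 0 < weight x by apply: lt_le_trans (profile_ge1 _ _ _).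
have -> : (fun x => epow (weight x) (- (p - 1)^-1)) =
    EFin \o (fun x => weight x `^ (- q^-1)).
  by apply/funext => x; rewrite /epow gt_eqF.
apply: (le_trans (@step_average R d i0 a l l0 'I_0 _ (w0 `^ (- q^-1)) (fun=> 0)
    (fun=> 0) (fun=> 1) _ _ _ _ _)) => //.
- exact: powR_ge0.
- by move=> x _; exact: powR_ge0.
- move=> x Qx; rewrite big_ord0 addr0 !powRN lef_pV2 ?posrE ?powR_gt0//.
  by apply: ge0_ler_powR; rewrite ?nnegrE ?invr_ge0 ?(ltW q0) ?(ltW w00) ?(ltW (wp x))// w0w.
by rewrite big_ord0 addr0.
Qed.

Lemma dual_average_ge0 : (0 <= average Q (fun x => epow (weight x) (- (p - 1)^-1)))%E.
Proof.
have wp x : 0 < weight x by apply: lt_le_trans (profile_ge1 _ _ _).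
rewrite /average mule_ge0//; first by rewrite lee_fin invr_ge0 fine_ge0.
by apply: integral_ge0 => x _; rewrite /epow gt_eqF//= lee_fin powR_ge0.
Qed.

Lemma product_le (X Y : R) : 0 <= X -> 0 <= Y ->
  (average Q (EFin \o weight) <= X%:E)%E ->
  (average Q (fun x => epow (weight x) (- (p - 1)^-1)) <= Y%:E)%E ->
  (average Q (EFin \o weight) *
   average Q (fun x => epow (weight x) (- (p - 1)^-1)) `^ (p - 1) <= (X * Y `^ q)%:E)%E.
Proof.
move=> X0 Y0 hX hY; rewrite EFinM; apply: lee_pmul => //.
- rewrite /average mule_ge0//; first by rewrite lee_fin invr_ge0 fine_ge0.
  by apply: integral_ge0 => x _; rewrite lee_fin (le_trans ler01)// profile_ge1.
- exact: poweR_ge0.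
rewrite -poweR_EFin; apply: gt0_ler_poweR; rewrite ?(ltW q0)//.
  by rewrite in_itv/= leey andbT dual_average_ge0.
by rewrite in_itv/= leey andbT lee_fin.
Qed.

Let bump_meets (j : nat) x : bump m j (coord x - 3 * s j) != 0 ->
  2 * s j <= coord x <= 4 * s j.
Proof.
move=> h; have {}h : `|coord x - 3 * s j| <= s j.
  by rewrite leNgt; apply: contra h => h; rewrite bump_support.
by move: h; rewrite ler_distl => /andP[h1 h2]; apply/andP; split; lra.
Qed.

Let powq (x : R) : 0 < x -> x `^ p = x * x `^ q.
Proof.
move=> x0; rewrite -[x in x * _](powRr1 (ltW x0)) -powRD ?(gt_eqF x0) ?implybT//.
by congr (_ `^ _); rewrite /q addrC subrK.
Qed.

(** The side is long compared with its distance to the origin, so averages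
over it are comparable to averages over a symmetric interval. The bumps that are met have scales at most [Mh],
and their masses form a geometric sum dominated by the largest one. *)
Lemma near_bound : M <= 4 * l ->
  (average Q (EFin \o weight) *
   average Q (fun x => epow (weight x) (- (p - 1)^-1)) `^ (p - 1) <= (2405 * m%:R)%:E)%E.
Proof.
move=> Ml; have M0 : 0 < M := lt_le_trans ltr01 M1.
have Mh0 : 0 < Mh := lt_le_trans ltr01 Mh1.
have hS j x : ~~ (s j <= M / 2) -> Q x -> bump m j (coord x - 3 * s j) = 0.
  rewrite -ltNge => hj Qx; have [//|/bump_meets /andP[h1 h2]] := eqVneq (bump m j (coord x - 3 * s j)) 0.
  have := coord_le Qx; have := ler_norm (coord x); lra.
have hw := @weight_average (fun j => s j <= M / 2) hS.
have B : \sum_(j < m | s j <= M / 2) s j `^ p * (8 * m%:R / reach (3 * s j)) <=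
    64 * m%:R * Mh `^ q.
  apply: (@le_trans _ _ (\sum_(j < m | s j <= M / 2) (Mh `^ q * (64 * m%:R / M)) * s j)).
    apply: ler_sum => j hj; rewrite powq//.
    have e1 : s j `^ q <= Mh `^ q.
      apply: le_powR => //; first exact: ltW.
      rewrite le_min; apply/andP; split; first by move: hj M0; lra.
      by rewrite /s /L ler_eXn2l ?ltr1n// ltnW.
    have e2 : 8 * m%:R / reach (3 * s j) <= 64 * m%:R / M.
      have r0 : 0 < reach (3 * s j) := reach_gt0 _ _ _ _.
      have rh := @reach_ge_half R d i0 a l (3 * s j).
      rewrite ler_pdivrMr// mulrAC ler_pdivlMr//.
      have := ler_wpM2l (le_trans ler01 m1) (_ : M <= 8 * reach (3 * s j)); lra.
    rewrite -mulrA mulrC; apply: ler_wpM2r; first exact: ltW.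
    apply: ler_pM => //; first exact: powR_ge0.
    by rewrite divr_ge0 ?mulr_ge0// ltW// reach_gt0.
  rewrite -mulr_sumr.
  have g : \sum_(j < m | s j <= M / 2) s j <= 2 * (M / 2).
    by apply: geometric_sum_le; rewrite divr_ge0// ltW.
  apply: (le_trans (ler_wpM2l _ g)).
    by rewrite mulr_ge0 ?powR_ge0// divr_ge0 ?mulr_ge0// ltW.
  by rewrite le_eqVlt; apply/orP; left; apply/eqP; field; rewrite gt_eqF.
have mq : (m%:R * Mh) `^ q <= m%:R * Mh `^ q.
  by rewrite powRM// ?(ltW Mh0)//; apply: ler_wpM2r; [exact: powR_ge0|exact: powR_le_self].
apply: (le_trans (@product_le (65 * m%:R * Mh `^ q) (37 / Mh) _ _ _ dual_average)).
- by rewrite !mulr_ge0 ?powR_ge0.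
- by rewrite divr_ge0// ltW.
- by apply: (le_trans hw); rewrite lee_fin; lra.
(* 2405 = 65 * 37, since [37 `^ q <= 37] *)
rewrite lee_fin -mulrA -powRM ?(ltW Mh0) ?divr_ge0 ?(ltW Mh0)// mulrCA mulfV ?gt_eqF// mulr1.
have : 37 `^ q <= 37 :> R by apply: powR_le_self => //; rewrite ler1n.
move=> /(ler_wpM2l (le_trans ler01 m1)); lra.
Qed.

(** The side is short compared with its distance to the origin: it meets at most
one bump, the base varies by a factor at most [2 m] on it, and the bump has average
at most [64 m] times its minimum. *)
Lemma far_bound : 4 * l < M -> exists2 w0 : R, 0 < w0 &
  (forall x, Q x -> w0 <= weight x) /\
  (average Q (EFin \o weight) <= (66 * m%:R * w0)%:E)%E.
Proof.
move=> lM; have M0 : 0 < M := lt_le_trans ltr01 M1.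
have Mh0 : 0 < Mh := lt_le_trans ltr01 Mh1.
have m0 : 0 <= m%:R :> R by [].
pose b0 := (Mh / 2) `^ q.
have b00 : 0 < b0 by rewrite powR_gt0// divr_gt0.
(* away from the unit interval the cube stays at distance comparable to [M] *)
have farx x : Q x -> M = 1 \/ 3 / 4 * M <= `|coord x|.
  move=> Qx; have := Qx i0; rewrite [(a + _) 0 i0]mxE [const_mx _ _ _]mxE => /andP[h1 h2].
  have [Me|Me] := leP M 1; first by left; apply/eqP; rewrite eq_le Me M1.
  right; have : M <= `|coord x| + l; last by move: lM; lra.
  have n1 := ler_norm (coord x); have n2 := ler_norm (- coord x); rewrite normrN in n2.
  move: Me; rewrite /M /side_reach !subr0 lt_max ltxx /= => Me.
  rewrite max_r; last by rewrite le_max; move: Me; rewrite lt_max => /orP[/ltW->|/ltW->]; rewrite ?orbT.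
  by rewrite ge_max !ler_norml; apply/andP; split; apply/andP; split; lra.
have bge x : Q x -> b0 <= base p m `|coord x|.
  move=> Qx; have [Me|h] := farx x Qx.
    apply: le_trans (base_ge1 _ _ _) => //; apply: powR_le1.
      by rewrite divr_ge0// ltW.
    have : Mh <= M by rewrite ge_min lexx.
    lra.
  have hm : Mh <= M by rewrite ge_min lexx.
  have hl : Mh <= L by rewrite ge_min lexx orbT.
  rewrite /base; case: (leP `|coord x| 1) => h1.
    apply: powR_le1; first by rewrite divr_ge0// ltW.
    lra.
  apply: le_powR => //; first by rewrite divr_ge0// ltW.
  apply: (@le_trans _ _ (1 * Num.min `|coord x| L)).
    by rewrite mul1r le_min; apply/andP; split; lra.
  by apply: ler_wpM2r => //; rewrite le_min !(le_trans ler01)// ltW.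
have ble : (m%:R * Mh) `^ q <= 2 * m%:R * b0.
  have -> : m%:R * Mh = (2 * m%:R) * (Mh / 2) by field.
  rewrite powRM ?divr_ge0 ?mulr_ge0 ?(ltW Mh0)//; apply: ler_wpM2r; first exact: ltW.
  have h2 : 1 <= 2 * m%:R :> R by have := m1; lra.
  exact: powR_le_self.
pose S (j : 'I_m) := `[< exists x, Q x /\ bump m j (coord x - 3 * s j) != 0 >].
have hS j x : ~~ S j -> Q x -> bump m j (coord x - 3 * s j) = 0.
  by move=> /asboolPn nS Qx; apply/eqP; apply: contrapT => /negP h; apply: nS; exists x.
have hw := @weight_average S hS.
have wb0 x : Q x -> b0 <= weight x.
  by move=> Qx; apply: le_trans (bge x Qx) (profile_ge_base _ _ _).
have [[j Sj]|nS] := pselect (exists j, S j); last first.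
  exists b0 => //; split => //; apply: (le_trans hw); rewrite lee_fin big_pred0.
    rewrite addr0; apply: (le_trans ble); apply: ler_wpM2r; first exact: ltW.
    by apply: ler_wpM2r => //; rewrite ler_nat.
  by move=> j; apply/negP => Sj; apply: nS; exists j.
have Sloc k : S k -> 2 * s k <= M /\ M <= 16 / 3 * s k.
  move=> /asboolP[x [Qx /bump_meets /andP[h1 h2]]].
  have h3 := coord_le Qx; have h4 := s1 k; have h5 := s0 k.
  have h6 : `|coord x| = coord x by rewrite ger0_norm//; lra.
  rewrite h6 in h3; split; first by lra.
  by have [Me|] := farx x Qx; [lra|rewrite h6; lra].
have Suniq k : S k -> k = j.
  move=> Sk; have [k1 k2] := Sloc k Sk; have [j1 j2] := Sloc j Sj.
  have gap (i i' : nat) : (i < i')%N -> 8 * s i <= s i'.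
    by move=> ii; rewrite /s -exprS ler_eXn2l ?ltr1n.
  have sj0 := s0 j; have sk0 := s0 k.
  apply: val_inj => /=; case: (ltngtP k j) => [h|h|//].
    by exfalso; have := gap _ _ h; lra.
  by exfalso; have := gap _ _ h; lra.
have [j1 j2] := Sloc j Sj.
have r0 : 0 < reach (3 * s j) := reach_gt0 _ _ _ _.
(* a lower bound for the bump on the part of the cube in its support *)
pose w1 := s j `^ p / (8 * reach (3 * s j)).
have ww1 x : Q x -> w1 <= weight x.
  move=> Qx; have yr := @reach_ge R d i0 a l (3 * s j) x Qx.
  have [ys|ys] := leP `|coord x - 3 * s j| (s j).
    apply: le_trans (profile_ge_bump p_gt1 m_gt0 j (coord x)); apply: ler_wpM2l; first exact: powR_ge0.
    apply: le_trans (@bump_lower R m m_gt0 j _ (ltnW (ltn_ord j)) ys).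
    rewrite lef_pV2 ?posrE ?mulr_gt0 ?lt_max ?ltr01//.
    by apply: ler_wpM2l => //; rewrite ge_max yr reach_ge1.
  apply: le_trans (wb0 x Qx).
  apply: (@le_trans _ _ (s j `^ q)).
    rewrite /w1 powq// ler_pdivrMr ?mulr_gt0// mulrC; apply: ler_wpM2l; first exact: powR_ge0.
    lra.
  apply: le_powR => //; first exact: ltW.
  rewrite ler_pdivlMr// le_min mulrC j1 /=.
  apply: (@le_trans _ _ (s j.+1)); first by rewrite /s exprS -/(s j) ler_wpM2r ?ler_nat ?(ltW (s0 j)).
  by rewrite /s /L ler_eXn2l ?ltr1n.
have w10 : 0 < w1 by rewrite divr_gt0 ?powR_gt0 ?mulr_gt0.
exists (Num.max b0 w1); first by rewrite lt_max b00.
split; first by move=> x Qx; rewrite ge_max wb0// ww1.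
apply: (le_trans hw); rewrite lee_fin.
rewrite (eq_bigl (pred1 j)); last first.
  by move=> k; apply/idP/eqP => [/Suniq//|->].
rewrite big_pred1_eq.
have -> : s j `^ p * (8 * m%:R / reach (3 * s j)) = 64 * m%:R * w1.
  by rewrite /w1; field; rewrite gt_eqF.
have e1 : b0 <= Num.max b0 w1 by rewrite le_max lexx.
have e2 : w1 <= Num.max b0 w1 by rewrite le_max lexx orbT.
have := ler_wpM2l m0 e1; have := ler_wpM2l m0 e2.
by move: ble; lra.
Qed.

End OneCube.

Lemma weight_Ap : (Ap_scalar p weight <= (2405 * m%:R)%:E)%E.
Proof.
apply: ge_ereal_sup => _ [_ [a [l [l0 ->]]] <-].
have [h|h] := leP (side_reach i0 a l 0) (4 * l); first exact: near_bound.
have [w0 w00 [wge wavg]] := far_bound l0 h.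
apply: (le_trans (product_le _ _ wavg (dual_average_cst l0 w00 wge))).
- by rewrite !mulr_ge0// ltW.
- exact: powR_ge0.
rewrite lee_fin -powRrM mulNr mulVf ?gt_eqF// powRN powRr1 ?(ltW w00)// mulfK ?gt_eqF//.
by apply: ler_wpM2r => //; rewrite ler_nat.
Qed.

End WeightConstant.

(** * Testing the maximal function on indicators *)

Section TestFunction.
Context (R : realType) (d : nat) (p : R).
Notation T := (Rd R d).
Notation leb := (@leb R d).
Hypothesis p_gt1 : 1 < p.

Let p0 : 0 < p. Proof. exact: lt_trans p_gt1. Qed.

Lemma compact_sub_box (K : set 'rV[R]_d) : compact K -> exists a b, K `<=` box a b.
Proof.
move=> cK.
have hb (i : 'I_d) : exists M : R, forall x, K x -> `|x 0 i| <= M.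
  have cI : compact ((fun x : 'rV[R]_d => x 0 i) @` K).
    apply: continuous_compact => //; apply: continuous_subspaceT => x.
    exact: coord_continuous.
  have [M [_ hM]] := compact_bounded cI.
  exists (M + 1) => x Kx; apply: (hM (M + 1)); first by rewrite ltrDl.
  by exists x.
have [M hM] := choice hb.
exists (\row_i (- M i)), (\row_i M i) => x Kx i; rewrite !mxE -ler_norml; exact: hM.
Qed.

Lemma bounded_locally_integrable (g : T -> R) (c : R) : measurable_fun [set: T] g ->
  (forall x, `|g x| <= c) -> locally_integrable_Rd g.
Proof.
move=> mg gc K cK; apply/integrableP; split.
  by apply: measurable_funTS; exact/measurable_EFinP.
have [a [b Kab]] := compact_sub_box cK.
apply: (@le_lt_trans _ _ (\int[leb]_(x in box a b) c%:E)%E).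
  by apply: ge0_le_integral_any => // x _; rewrite lee_fin ?(le_trans _ (gc x)).
rewrite integral_cst; last exact: box_measurable.
by rewrite [X in (_ * X < _)%E](_ : _ = (box_vol a b)%:E) ?ltry//; exact: leb_box.
Qed.

Lemma max_norm_ge (w : T -> R) (f : T -> R[i]) (al v F : R) (S : set T) :
  in_Lp p f -> Lp_norm p f = F%:E -> 0 < F -> 0 < al -> 0 <= v ->
  S `<=` [set x | (al%:E < `|scalar_max p w f x|)%E] -> (v%:E <= leb S)%E ->
  ((al * v `^ p^-1 / F)%:E <= scalar_max_norm p w)%E.
Proof.
move=> fLp fF F0 al0 v0 Ssub vS; apply: le_ereal_inf_tmp => _ [K [K0 hK] <-].
have := hK f fLp; rewrite fF -EFinM => hF; rewrite lee_fin ler_pdivrMr// -lee_fin.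
apply: le_trans hF; apply: (le_trans _ (ereal_sup_ubound _)); last by exists al.
rewrite EFinM; apply: lee_wpmul2l; first by rewrite lee_fin ltW.
rewrite -poweR_EFin; apply: gt0_ler_poweR.
- by rewrite invr_ge0 ltW.
- by rewrite in_itv/= leey andbT lee_fin.
- by rewrite in_itv/= leey andbT lebesgue_outer_ge0.
by apply: (le_trans vS); exact: le_lebesgue_outer.
Qed.

Definition test_fun (E : set T) (x : T) : R[i] := (\1_E x : R)%:C.

Lemma normc_test (E : set T) x : ComplexField.Normc.normc (test_fun E x) = \1_E x :> R.
Proof. by rewrite normcE /= expr0n addr0 sqrtr_sqr ger0_norm// indicE. Qed.

Lemma test_norm (E : set T) (v : R) : measurable E -> leb E = v%:E ->
  Lp_norm p (test_fun E) = (v `^ p^-1)%:E.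
Proof.
move=> mE Ev; rewrite /Lp_norm unlock -poweR_EFin -Ev; apply: (congr1 (fun z => z `^ p^-1)%E).
rewrite -[E in RHS]setIT -integral_indic//.
apply: eq_integral => x _; rewrite normc_test abse_EFin poweR_EFin indicE.
by case: (x \in E); rewrite ?normr1 ?powR1// normr0 powR0// gt_eqF.
Qed.

Lemma test_in_Lp (E : set T) (v : R) : measurable E -> leb E = v%:E ->
  in_Lp p (test_fun E).
Proof.
move=> mE Ev; split; last by rewrite (test_norm mE Ev) ltry.
by split; [exact: measurable_indic|exact: measurable_cst].
Qed.

(** The average over [Q] is at least the relative measure of [B], where both the
test function and the weight are 1. *)
Lemma scalar_max_ge (w : T -> R) (E Q B : set T) (x : T) (b c : R) :
  is_cube Q -> Q x -> measurable B -> B `<=` Q -> B `<=` E ->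
  (forall y, B y -> w y = 1) -> 0 < w x -> leb B = b%:E -> leb Q = c%:E ->
  ((w x `^ p^-1 * (c^-1 * b))%:E <= scalar_max p w (test_fun E) x)%E.
Proof.
move=> cQ Qx mB BQ BE w1 wx Bb Qc.
rewrite EFinM /scalar_max /epow gt_eqF//=; apply: lee_wpmul2l.
  by rewrite lee_fin powR_ge0.
apply: (le_trans _ (ereal_sup_ubound _)); last by exists Q.
have c0 : 0 <= c by rewrite -lee_fin -Qc lebesgue_outer_ge0.
rewrite /average [X in fine X]Qc /= EFinM; apply: lee_wpmul2l.
  by rewrite lee_fin invr_ge0.
rewrite -Bb -[B in leLHS]setIT -integral_indic// [leLHS]integral_mkcond/=.
rewrite [leLHS](_ : _ = \int[leb]_(y in B) 1)%E; last first.
  rewrite [RHS]integral_mkcond; apply: eq_integral => y _; rewrite !patchE in_setT indicE.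
  by case: (y \in B).
apply: ge0_le_integral_any => // y Bys; first exact: abse_ge0.
have /= -> := normc_test E y.
rewrite indicE (mem_set (BE _ Bys)) (w1 _ Bys) oner_eq0 powR1.
by rewrite /= mulr1 normr1.
Qed.

End TestFunction.

(** * The lower bound *)

Section WeightNorm.
Context (R : realType) (d : nat) (i0 : 'I_d) (p : R) (m : nat).
Hypothesis p_gt1 : 1 < p.
Hypothesis p_lt2 : p < 2.
Hypothesis m_gt0 : (0 < m)%N.
Notation T := (Rd R d).
Notation leb := (@leb R d).
Notation w := (weight i0 p m).

Let p0 : 0 < p. Proof. exact: lt_trans p_gt1. Qed.
Let L : R := 8 ^+ m.
Let L1 : 1 <= L. Proof. by rewrite exprn_ege1// ler1n. Qed.
Let s (j : nat) : R := 8 ^+ j.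
Let s1 j : 1 <= s j. Proof. by rewrite exprn_ege1// ler1n. Qed.
Let s0 j : 0 < s j. Proof. exact: lt_le_trans (s1 j). Qed.
Let sL j : (j < m)%N -> s j <= L. Proof. by move=> jm; rewrite /s /L ler_eXn2l ?ltr1n// ltnW. Qed.

Lemma weight_scalar : scalar_weight w.
Proof.
have w1 x : 1 <= w x by exact: profile_ge1.
split; first by move=> x; apply: le_trans (w1 x).
pose c : R := (m%:R * L) `^ (p - 1) + \sum_(j < m) (8 ^+ j) `^ p * \sum_o step_height R j (o : option 'I_m).
apply: (@bounded_locally_integrable R d _ c); first exact: weight_measurable.
move=> x; rewrite ger0_norm ?(le_trans _ (w1 x))//; apply: lerD.
  pose r := `|(x : 'rV[R]_d) 0 i0|.
  have rM : r <= Num.max 1 r by rewrite le_max lexx orbT.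
  have M1 : 1 <= Num.max 1 r by rewrite le_max lexx.
  apply: (le_trans (base_le p_gt1 m_gt0 rM M1)); apply: le_powR => //.
    by rewrite mulr_ge0// le_min !(le_trans ler01).
  by apply: ler_wpM2l => //; rewrite ge_min lexx orbT.
apply: ler_sum => j _; apply: ler_wpM2l; first exact: powR_ge0.
apply: ler_sum => o _; rewrite -[leRHS]mulr1; apply: ler_wpM2l; first exact: step_height_ge0.
by case: (`|_| <= _)%R; rewrite ?ler01 ?lexx.
Qed.

Let N : R := 4 * L.
Let N0 : 0 < N. Proof. by rewrite mulr_gt0// (lt_le_trans ltr01). Qed.
Let E : set T := brick i0 (- 2^-1) 2^-1 0 N.
Let v : R := N ^+ d.-1.
Let v0 : 0 < v. Proof. exact: exprn_gt0. Qed.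
Let piece (j : nat) : set T := brick i0 (3 * s j - 2^-1) (3 * s j + 2^-1) 0 N.

Let leb_unit (u u' : R) y h : u' - u = 1 -> 0 <= h -> leb (brick i0 u u' y h) = (h ^+ d.-1)%:E.
Proof. by move=> uu h0; rewrite leb_brick// uu max_r// mul1r. Qed.

Let leb_E : leb E = v%:E.
Proof. by apply: leb_unit; [lra|exact: ltW]. Qed.

Let brick_i0 u u' y h (x : T) : brick i0 u u' y h x -> u <= (x : 'rV[R]_d) 0 i0 <= u'.
Proof. by move=> /(_ i0); rewrite !mxE eqxx. Qed.

Let brick_i u u' y h (x : T) i : brick i0 u u' y h x -> i != i0 ->
  y 0 i <= (x : 'rV[R]_d) 0 i <= y 0 i + h.
Proof. by move=> /(_ i) + /negbTE ii; rewrite !mxE ii. Qed.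

Let w_one x : `|(x : 'rV[R]_d) 0 i0| <= 2^-1 -> w x = 1.
Proof.
move=> x2; rewrite /weight /profile /base (le_trans x2) ?invf_le1 ?ler1n//.
rewrite big1 ?addr0// => j _; rewrite bump_support ?mulr0//.
rewrite ltr_normr; apply/orP; right; have := s1 j; rewrite -/(s j).
move: x2; rewrite ler_norml => /andP[h1 h2]; lra.
Qed.

(** The cube of side [4 s_j] starting at [-1/2] along the axis contains the slab
and the bump. In the other directions it is placed inside the box containing the
support of the test function. *)
Lemma piece_max_ge (j : 'I_m) x : piece j x ->
  ((m%:R `^ p^-1 / 5)%:E < `|scalar_max p w (test_fun E) x|)%E.
Proof.
move=> px; have /andP[x1 x2] := brick_i0 px; have sj := s1 j; have sj0 := s0 j.
have sN : 4 * s j <= N by rewrite ler_wpM2l// sL.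
pose a : 'rV[R]_d := \row_i if i == i0 then - 2^-1 else Num.min ((x : 'rV[R]_d) 0 i) (N - 4 * s j).
pose l := 4 * s j; have l0 : 0 < l by rewrite mulr_gt0.
pose Q : set T := box a (a + const_mx l).
pose B : set T := brick i0 (- 2^-1) 2^-1 a l.
have aE i : i != i0 -> a 0 i = Num.min ((x : 'rV[R]_d) 0 i) (N - 4 * s j).
  by move=> /negbTE ii; rewrite mxE ii.
have a0 i : i != i0 -> 0 <= a 0 i.
  move=> ii; rewrite aE// le_min subr_ge0 sN andbT.
  by have /andP[] := brick_i px ii; rewrite mxE.
have a1 i : i != i0 -> a 0 i + l <= N.
  by move=> ii; rewrite aE// -lerBrDr ge_min lexx orbT.
have Qx : Q x.
  move=> i; rewrite [(a + _) 0 i]mxE [const_mx _ _ _]mxE; have [->|ii] := eqVneq i i0.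
    by rewrite mxE eqxx /l; apply/andP; split; lra.
  rewrite aE// ge_min lexx /= -lerBlDr le_min /l.
  have /andP[h1 h2] := brick_i px ii; rewrite mxE in h1 h2.
  by apply/andP; split; lra.
have BQ : B `<=` Q.
  move=> y By i; rewrite [(a + _) 0 i]mxE [const_mx _ _ _]mxE; have [->|ii] := eqVneq i i0.
    have /andP[h1 h2] := brick_i0 By.
    by rewrite mxE eqxx /l h1 /=; lra.
  exact: brick_i By ii.
have BE : B `<=` E.
  move=> y By i; rewrite !mxE; case: eqP => [->|/eqP ii]; first exact: brick_i0 By.
  have /andP[h1 h2] := brick_i By ii; have := a0 i ii; have := a1 i ii.
  by move=> h3 h4; apply/andP; split; lra.
have wB y : B y -> w y = 1.
  by move=> By; apply: w_one; rewrite ler_norml; exact: brick_i0 By.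
have wx : m%:R * s j `^ p <= w x.
  apply: le_trans (profile_ge_bump p_gt1 m_gt0 j ((x : 'rV[R]_d) 0 i0)).
  rewrite mulrC; apply: ler_wpM2l; first exact: powR_ge0.
  by apply: bump_core; rewrite -/(s j) ler_distl; apply/andP; split; lra.
have mR : 0 < m%:R :> R by rewrite ltr0n.
have wx0 : 0 < w x by apply: lt_le_trans wx; rewrite mulr_gt0// powR_gt0.
have lebQ : leb Q = (l ^+ d)%:E by exact: leb_cube.
have lebB : leb B = (l ^+ d.-1)%:E by apply: leb_unit; [lra|exact: ltW].
have h := @scalar_max_ge R d p w E Q B x (l ^+ d.-1) (l ^+ d)
  (ex_intro _ a (ex_intro _ l (conj l0 erefl))) Qx (@brick_measurable R d i0 _ _ _ _)
  BQ BE wB wx0 lebB lebQ.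
apply: lt_le_trans (lee_abs _); apply: lt_le_trans h; rewrite lte_fin.
have -> : (l ^+ d)^-1 * l ^+ d.-1 = l^-1.
  have -> : l ^+ d = l * l ^+ d.-1 by rewrite -exprS prednK// (leq_ltn_trans _ (ltn_ord i0)).
  by rewrite invfM -mulrA mulVf ?mulr1// expf_neq0// gt_eqF.
have wr : m%:R `^ p^-1 * s j <= w x `^ p^-1.
  have -> : m%:R `^ p^-1 * s j = (m%:R * s j `^ p) `^ p^-1.
    by rewrite powRM ?powR_ge0// -powRrM mulfV ?gt_eqF// powRr1// ltW.
  by apply: ge0_ler_powR; rewrite ?nnegrE ?invr_ge0 ?(ltW p0) ?(ltW wx0)// mulr_ge0// powR_ge0.
rewrite ltr_pdivlMr// mulrAC ltr_pdivrMr//; apply: (@lt_le_trans _ _ (m%:R `^ p^-1 * s j * 5)).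
  by rewrite -mulrA ltr_pM2l ?powR_gt0// /l; lra.
by apply: ler_wpM2r.
Qed.

(** The level set contains [m] disjoint pieces, each with the measure of the
support of the test function. *)
Lemma weight_norm_ge : ((m%:R `^ (2 / p) / 5)%:E <= scalar_max_norm p w)%E.
Proof.
have mR : 0 < m%:R :> R by rewrite ltr0n.
have mE : measurable E by exact: brick_measurable.
pose S : set T := \big[setU/set0]_(j < m) piece j.
have mp (j : nat) : measurable (piece j) by exact: brick_measurable.
have lebS : leb S = (m%:R * v)%:E.
  rewrite [LHS](@measure_semi_additive_ord _ _ _ leb m (fun j : 'I_m => piece j)) //.
  - rewrite (eq_bigr (fun=> v%:E)).
      by rewrite sumEFin sumr_const card_ord mulr_natl.
    by move=> j _; apply: leb_unit; [lra|exact: ltW].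
  - apply/trivIsetP => i j _ _ ij; apply/seteqP; split => // x [/brick_i0/andP[x1 x2] /brick_i0/andP[x3 x4]].
    have gap (k k' : nat) : (k < k')%N -> 8 * s k <= s k'.
      by move=> kk; rewrite /s -exprS ler_eXn2l ?ltr1n.
    have s1i := s1 i; have s1j := s1 j.
    case: (ltngtP i j) => [/gap h|/gap h|/val_inj h]; [exfalso; lra|exfalso; lra|].
    by rewrite h eqxx in ij.
  - by apply: bigsetU_measurable => j _.
have Sm : S `<=` [set x | ((m%:R `^ p^-1 / 5)%:E < `|scalar_max p w (test_fun E) x|)%E].
  by move=> x /mem_bigsetU [j px]; exact: piece_max_ge px.
have := @max_norm_ge R d p p_gt1 w (test_fun E) (m%:R `^ p^-1 / 5) (m%:R * v) (v `^ p^-1) S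
  (test_in_Lp p_gt1 mE leb_E) (test_norm p_gt1 mE leb_E) (powR_gt0 _ v0)
  (divr_gt0 (powR_gt0 _ mR) _) (mulr_ge0 (ltW mR) (ltW v0)) Sm.
rewrite lebS => /(_ (ltr0n _ _) (lexx _)).
suff -> : m%:R `^ p^-1 / 5 * (m%:R * v) `^ p^-1 / v `^ p^-1 = m%:R `^ (2 / p) / 5 by [].
rewrite powRM ?(ltW mR) ?(ltW v0)//.
have -> : 2 / p = p^-1 + p^-1 by field; rewrite gt_eqF.
rewrite powRD ?(gt_eqF mR) ?implybT//.
by field; rewrite gt_eqF ?powR_gt0.
Qed.

End WeightNorm.

Section UnitWeight.
Context (R : realType) (d : nat) (p : R).
Notation T := (Rd R d).
Notation leb := (@leb R d).
Hypothesis p_gt1 : 1 < p.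

Lemma unit_weight_scalar : scalar_weight (fun _ : T => 1%R : R).
Proof.
split; first by move=> x; exact: ler01.
apply: (@bounded_locally_integrable R d _ 1); first exact: measurable_cst.
by move=> x; rewrite normr1.
Qed.

Lemma unit_weight_Ap : (Ap_scalar p (fun _ : T => 1%R : R) <= 1)%E.
Proof.
apply: ge_ereal_sup => _ [_ [a [l [l0 ->]]] <-].
have avg1 : average (box a (a + const_mx l)) (fun=> 1%:E) = 1%E :> \bar R.
  rewrite /average integral_cst; last exact: box_measurable.
  have lQ : leb (box a (a + const_mx l)) = (l ^+ d)%:E by exact: leb_cube.
  rewrite mul1e [X in fine X]lQ [X in (_ * X)%E]lQ.
  by rewrite -EFinM mulVf// gt_eqF// exprn_gt0.
have -> : (fun x : T => epow (1%R : R) (- (p - 1)^-1)) = fun=> 1%:E.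
  by apply/funext => x; rewrite /epow oner_eq0/= powR1.
have -> : EFin \o (fun _ : T => 1%R : R) = fun=> 1%:E by [].
by rewrite avg1 poweR1r mule1.
Qed.

Lemma unit_weight_norm : ((2^-1)%:E <= scalar_max_norm p (fun _ : T => 1%R : R))%E.
Proof.
pose Q : set T := box 0 (0 + const_mx 1).
have lQ : leb Q = 1%:E by rewrite [LHS]leb_cube// expr1n.
have mQ : measurable Q by exact: box_measurable.
have cQ : is_cube Q by exists 0, 1.
have h x : Q x -> (2^-1%:E < `|scalar_max p (fun _ : T => 1%R : R) (test_fun Q) x|)%E.
  move=> Qx; apply: lt_le_trans (lee_abs _).
  apply: lt_le_trans (@scalar_max_ge R d p (fun=> 1) Q Q Q x 1 1 cQ Qx mQ
    (fun _ => id) (fun _ => id) (fun _ _ => erefl) ltr01 lQ lQ).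
  by rewrite lte_fin powR1 invr1 !mulr1 invf_lt1// ltr1n.
have := @max_norm_ge R d p p_gt1 (fun=> 1) (test_fun Q) 2^-1 1 (1 `^ p^-1) Q
  (test_in_Lp p_gt1 mQ lQ) (test_norm p_gt1 mQ lQ) (powR_gt0 _ ltr01) _ ler01 h.
by rewrite powR1 mulr1 divr1; apply; rewrite ?lQ.
Qed.

End UnitWeight.

(** For small [t] the constant weight suffices; otherwise the number of scales
is the integer part of [t / 2405]. *)
Lemma phi_M_lower (R : realType) (d : nat) (p : R) : (0 < d)%N -> 1 < p -> p < 2 ->
  exists2 c : R, 0 < c & forall t : R, 1 <= t -> ((c * t `^ (2 / p))%:E <= phi_M d p t)%E.
Proof.
case: d => // d _ p1 p2; have [C CE] : exists C : R, C = 2405 by exists 2405.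
have p0 : 0 < p by exact: lt_trans p1.
have r0 : 0 < 2 / p by rewrite divr_gt0.
have C0 : 0 < C by rewrite CE ltr0n.
pose c : R := ((2 * C)^-1) `^ (2 / p) / 5.
have c0 : 0 < c by rewrite divr_gt0// powR_gt0// invr_gt0 mulr_gt0.
exists c => // t t1; have t0 : 0 < t := lt_le_trans ltr01 t1.
have cE : c * t `^ (2 / p) = (t / (2 * C)) `^ (2 / p) / 5.
  by rewrite /c mulrAC -powRM ?invr_ge0 ?mulr_ge0 ?(ltW C0) ?(ltW t0)// [_^-1 * t]mulrC.
have mono (x y : R) : 0 <= x -> x <= y -> x `^ (2 / p) <= y `^ (2 / p).
  by move=> x0 xy; apply: ge0_ler_powR; rewrite ?nnegrE ?(le_trans x0 xy)// ltW.
have [tC|Ct] := leP C t; last first.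
  apply: (@le_trans _ _ (scalar_max_norm p (fun _ : Rd R d.+1 => 1%R : R))).
    apply: le_trans (unit_weight_norm _ p1); rewrite lee_fin cE.
    apply: (@le_trans _ _ (1 / 5)); last by lra.
    apply: ler_wpM2r; first by rewrite invr_ge0.
    apply: (@le_trans _ _ (1 `^ (2 / p))); last by rewrite powR1.
    apply: mono; first by rewrite divr_ge0 ?mulr_ge0// ltW.
    by rewrite ler_pdivrMr ?mulr_gt0// mul1r; lra.
  apply: ereal_sup_ubound; exists (fun=> 1) => //; split; first exact: unit_weight_scalar.
  by apply: le_trans; [exact: unit_weight_Ap|rewrite lee_fin].
(* the largest number of scales whose weight is admissible for [t] *)
pose m := Num.trunc (t / C).
have tC1 : 1 <= t / C by rewrite ler_pdivlMr// mul1r.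
have /andP[m1 m2] : m%:R <= t / C < m.+1%:R by apply: truncn_itv; rewrite (le_trans ler01).
have m0 : (0 < m)%N.
  by rewrite -ltnS -(ltr_nat R); apply: le_lt_trans m2.
apply: (@le_trans _ _ (scalar_max_norm p (weight (ord0 : 'I_d.+1) p m))).
  apply: le_trans (weight_norm_ge _ p1 m0); rewrite lee_fin cE.
  apply: ler_wpM2r; first by rewrite invr_ge0.
  apply: mono; first by rewrite divr_ge0 ?mulr_ge0// ltW.
  have h1 : 1 <= m%:R :> R by rewrite ler1n.
  rewrite invfM mulrCA; move: m2; rewrite -natr1; lra.
apply: ereal_sup_ubound; exists (weight (ord0 : 'I_d.+1) p m) => //.
split; first exact: weight_scalar.
apply: (le_trans (weight_Ap _ p1 p2 m0)); rewrite lee_fin -CE mulrC -ler_pdivlMr//.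
Qed.

Theorem theorem1p1 (R : realType) (d : nat) (p : R)
    (d_ge1 : (1 <= d)%N) (p_gt1 : 1 < p) (p_lt2 : p < 2) :
  (forall n : nat, (1 <= n)%N ->
    exists C : R,
      forall (W : Rd R d -> 'M[R[i]%C]_n) (f : Rd R d -> 'cV[R[i]%C]_n),
        matrix_weight W -> (Ap_matrix p W < +oo)%E -> in_Lp_vec p f ->
        (weak_Lnorm p (christ_goldberg_max p W f) <=
          C%:E * Ap_matrix p W `^ (2 / p) * Lp_norm_vec p f)%E) /\
  (exists2 c : R, 0 < c &
    forall t : R, 1 <= t -> ((c * t `^ (2 / p))%:E <= phi_M d p t)%E).
Proof.
split; last exact: phi_M_lower.
by move=> n n0; exists (final_const d n p) => W f; exact: matrix_weak_type.
Qed.
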